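(* Let $X\subseteq\{1,2,3\}^{\mathbb N}$ and $Y\subseteq\{1,2\}^{\mathbb N}$ be irreducible shifts of finite type such that $Y$ is the full shift or has transition matrix $\begin{pmatrix}0&1\\1&1\end{pmatrix}$. Let $\pi:X\to Y$ be a one-block factor map with $\pi(1)=1$, $\pi(2)=\pi(3)=2$. Let $\mu$ be the measure of maximal entropy for $\sigma_X$, i.e. $h_\mu(\sigma_X)=\sup\{h_\nu(\sigma_X):\nu\in M(X,\sigma_X)\}$, and let $\Phi$ be the sequence on $Y$ associated to the relative pressure function $P(\sigma_X,\pi,0)$. Then $\Phi$ is almost additive on $Y$ if and only if there exists a function $\hat g\in C(Y)$ for which $\pi\mu$ is the unique invariant Gibbs measure. If $\Phi$ is merely weakly almost additive on $Y$, then there exists $\hat g\in C(Y)$ for which $\pi\mu$ is the unique invariant weak Gibbs measure.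
   Context: For a $k\times k$ zero-one matrix $A=(a_{ij})$, the shift of finite type with transition matrix $A$ is $X_A=\{x\in\{1,\dots,k\}^{\mathbb N}:a_{x_nx_{n+1}}=1\ \forall n\}$ with the shift $(\sigma x)_i=x_{i+1}$. A subshift $X$ is irreducible if for all allowable words $u,v\in B(X)$ there is $w\in B(X)$ with $uwv\in B(X)$ ($B(X)$ is the set of all finite blocks of $X$, including the empty word); $[x_1\dots x_n]$ denotes a cylinder set. A factor map $\pi:X\to Y$ is a continuous surjection with $\pi\circ\sigma_X=\sigma_Y\circ\pi$; it is one-block if it is induced letterwise by a map on symbols (also denoted $\pi$ and applied to words). $M(X,\sigma_X)$ is the set of $\sigma_X$-invariant Borel probability measures, $h_\nu(\sigma_X)$ is entropy, $\pi\mu(B)=\mu(\pi^{-1}B)$, $S_ng=\sum_{i=0}^{n-1}g\circ\sigma^i$. For $f\in C(X)$, the sequence associated to $P(\sigma_X,\pi,f)$ is $\{\log g_n\}_{n\ge1}$ where $g_n(y)=\sup_{E_n(y)}\sum_{x\in E_n(y)}e^{(S_nf)(x)}$, the supremum being over sets $E_n(y)$ consisting of exactly one point from each cylinder $[x_1\dots x_n]$ of $X$ with $\pi(x_1\dots x_n)=y_1\dots y_n$. Thus for $f=0$, $\Phi=\{\log\phi_n\}$ with $\phi_n(y)$ the number of blocks $x_1\dots x_n$ of $X$ with $\pi(x_1\dots x_n)=y_1\dots y_n$. A sequence $\{\log f_n\}$ of continuous functions ($f_n>0$) is almost additive if there is $C>0$ with $e^{-C}f_n(y)f_m(\sigma^ny)\le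 f_{n+m}(y)\le e^Cf_n(y)f_m(\sigma^ny)$ for all $y$ and $n,m\in\mathbb N$; weakly almost additive if there are $C_n>0$ with $C_n/n\to0$ such that this holds with $C$ replaced by $C_n$. For a function $g$, an invariant probability measure $m$ is a weak Gibbs measure for $g$ if there are $P\in\mathbb R$ and $C_n>0$ with $\frac1n\log C_n\to0$ such that $\frac1{C_n}\le m[y_1\dots y_n]/e^{-nP+(S_ng)(y)}\le C_n$ for all $y$ and $n$; it is a Gibbs measure for $g$ if one can take $C_n=C$ for all $n$. *)

(* Defs.v *)
From HB Require Import structures.
From mathcomp Require Import all_boot all_order all_algebra.
From mathcomp Require Import all_classical all_reals all_analysis.
Import Order.TTheory GRing.Theory Num.Theory.
Import numFieldTopology.Exports numFieldNormedType.Exports.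

Set Implicit Arguments.
Unset Strict Implicit.
Unset Printing Implicit Defensive.

Local Open Scope classical_set_scope.
Local Open Scope ring_scope.

(* The alphabet {1, ..., k} is encoded as 'I_k = {0, ..., k - 1} (symbol i of
   the mathematical text is the ordinal of value i - 1), and one-sided
   sequences are indexed from 0 (x_i of the text is [x i.-1]).  Subshifts are
   subsets of [fullshift k]. *)
Definition fullshift (k : nat) : Type :=
  prod_topology (fun _ : nat => discrete_topology 'I_k).

HB.instance Definition _ k := Topological.on (fullshift k).
(* Measurable types are pointed, whence the restriction to k.+1 below. *)
HB.instance Definition _ k := isPointed.Build (fullshift k.+1) (fun=> ord0).
HB.instance Definition _ k := Measurable.copy (fullshift k.+1)
  (g_sigma_algebraType (@open (fullshift k.+1))).

Section symbolic.
Variable k : nat.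
Implicit Types (X : set (fullshift k)) (x : fullshift k) (u v w : seq 'I_k).

Definition shiftmap x : fullshift k := fun i => x i.+1.

(* x_1 ... x_n *)
Definition initial_block x (n : nat) : seq 'I_k := mkseq x n.

Definition sft (A : 'M[bool]_k) : set (fullshift k) :=
  [set x | forall n, A (x n) (x n.+1)].

Definition is_sft X := exists A : 'M[bool]_k, X = sft A.

(* B(X), including the empty block *)
Definition block X : set (seq 'I_k) :=
  [set w | exists2 x, X x &
     exists i, w = initial_block (iter i shiftmap x) (size w)].

Definition irreducible X :=
  forall u v, block X u -> block X v ->
    exists2 w, block X w & block X (u ++ w ++ v).

Definition cylinder X w : set (fullshift k) :=
  X `&` [set x | initial_block x (size w) = w].

Definition birkhoff (R : realType) (f : fullshift k -> R) (n : nat) x : R :=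
  \sum_(i < n) f (iter i shiftmap x).

End symbolic.

Definition letterwise k l (p : 'I_k -> 'I_l) (x : fullshift k) : fullshift l :=
  fun i => p (x i).

Definition factor_map k l (X : set (fullshift k)) (Y : set (fullshift l))
    (f : fullshift k -> fullshift l) :=
  [/\ {within X, continuous f}, f @` X = Y &
      forall x, X x -> f (shiftmap x) = shiftmap (f x)].

(* 0 stands for the forbidden transition: the matrix ((0, 1), (1, 1)). *)
Definition golden_mean : 'M[bool]_2 :=
  \matrix_(i, j) ((i != ord0) || (j != ord0)).

Section entropy.
Context d (T : measurableType d) (R : realType).
Variable m : probability T R.
Variable sigma : T -> T.

(* The finite measurable partitions of T are the families of fibres of maps
   T -> 'I_r with measurable fibres; an itinerary of length n is an atom of the
   join of the preimages of the partition by the first n iterates of sigma. *)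
Definition measurable_partition r (xi : T -> 'I_r) :=
  forall i, measurable (xi @^-1` [set i]).

Definition join_atom r (xi : T -> 'I_r) n (w : n.-tuple 'I_r) : set T :=
  [set x | forall i : 'I_n, xi (iter i sigma x) = tnth w i].

(* Shannon entropy; [ln 0 = 0], so null atoms do not contribute. *)
Definition join_entropy r (xi : T -> 'I_r) n : R :=
  - \sum_(w : n.-tuple 'I_r)
      fine (m (join_atom xi w)) * ln (fine (m (join_atom xi w))).

Definition partition_entropy r (xi : T -> 'I_r) : R :=
  limn (fun n => n%:R^-1 * join_entropy xi n).

(* Kolmogorov-Sinai entropy *)
Definition entropy : \bar R :=
  ereal_sup [set h | exists r (xi : T -> 'I_r),
    measurable_partition xi /\ h = (partition_entropy xi)%:E].

End entropy.

(* Borel probability measures on a (closed) set X are identified with the Borel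
   probability measures on the full shift that give X full measure. *)
Definition invariant_probability k (R : realType) (X : set (fullshift k.+1)) :
    set (probability (fullshift k.+1) R) :=
  [set nu | nu X = 1%E /\
    forall B, measurable B -> nu (@shiftmap k.+1 @^-1` B) = nu B].

Definition max_entropy_measure k (R : realType) (X : set (fullshift k.+1))
    (mu : probability (fullshift k.+1) R) :=
  invariant_probability X mu /\
  entropy mu (@shiftmap k.+1) =
    ereal_sup [set entropy nu (@shiftmap k.+1) | nu in invariant_probability X].

Section relative_pressure.
Context k l (R : realType) (X : set (fullshift k)) (p : 'I_k -> 'I_l).

Definition fibre_block n (y : fullshift l) : set (seq 'I_k) :=
  [set w | [/\ block X w, size w = n & map p w = initial_block y n]].

(* E consists of exactly one point from each cylinder over y_1 ... y_n. *)
Definition fibre_section n (y : fullshift l) (E : set (fullshift k)) :=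
  (forall w, fibre_block n y w -> exists! x, E x /\ cylinder X w x) /\
  (forall x, E x -> exists2 w, fibre_block n y w & cylinder X w x).

(* n |-> g_n, where {log g_n} is the sequence associated to P(sigma_X, pi, f),
   pi being the one-block map induced by p. *)
Definition rel_pressure_seq (f : fullshift k -> R) (n : nat)
    (y : fullshift l) : R :=
  sup [set s | exists2 E, fibre_section n y E &
                 s = \sum_(x \in E) expR (birkhoff f n x)].

End relative_pressure.

(* A sequence {log f_n} is represented by n |-> f_n; n and m range over the
   positive integers, and index 0 is irrelevant. *)
Section sequences_of_functions.
Context k (R : realType) (Y : set (fullshift k)) (f : nat -> fullshift k -> R).

Definition positive_continuous_seq := forall n, (0 < n)%N ->
  {within Y, continuous (f n)} /\ forall y, Y y -> 0 < f n y.

Definition additivity_bounds (C : nat -> R) :=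
  forall y n m, Y y -> (0 < n)%N -> (0 < m)%N ->
    expR (- C n) * (f n y * f m (iter n (@shiftmap k) y)) <= f (n + m)%N y
    /\ f (n + m)%N y <= expR (C n) * (f n y * f m (iter n (@shiftmap k) y)).

Definition almost_additive :=
  positive_continuous_seq /\
  exists C : R, 0 < C /\ additivity_bounds (fun=> C).

Definition weakly_almost_additive :=
  positive_continuous_seq /\
  exists C : nat -> R,
    [/\ forall n, (0 < n)%N -> 0 < C n,
        (fun n => C n / n%:R) @ \oo --> (0 : R) &
        additivity_bounds C].

End sequences_of_functions.

Section gibbs.
Context k (R : realType) (Y : set (fullshift k.+1)) (g : fullshift k.+1 -> R).
Implicit Types m : probability (fullshift k.+1) R.

Definition gibbs_bounds m (P : R) (C : nat -> R) :=
  forall y n, Y y -> (0 < n)%N ->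
    let q := fine (m (cylinder Y (initial_block y n)))
             / expR (- n%:R * P + birkhoff g n y) in
    (C n)^-1 <= q /\ q <= C n.

Definition gibbs m := exists P C : R, 0 < C /\ gibbs_bounds m P (fun=> C).

Definition weak_gibbs m := exists (P : R) (C : nat -> R),
  [/\ forall n, (0 < n)%N -> 0 < C n,
      (fun n => n%:R^-1 * ln (C n)) @ \oo --> (0 : R) &
      gibbs_bounds m P C].

End gibbs.

(* m is the only measure in M(Y, sigma_Y) with property Q; measures are compared
   on Borel sets, their values on other sets being meaningless. *)
Definition unique_invariant k (R : realType) (Y : set (fullshift k.+1))
    (Q : probability (fullshift k.+1) R -> Prop)
    (m : probability (fullshift k.+1) R) :=
  [/\ invariant_probability Y m, Q m &
      forall nu, invariant_probability Y nu -> Q nu ->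
        forall B, measurable B -> nu B = m B].

(* Letterwise maps are Borel, so that [distribution mu (letterwise p)] is the
   image probability B |-> mu (pi^-1 B). *)
Lemma prod_continuous (T : topologicalType) (K : nat -> topologicalType)
    (f : T -> prod_topology K) :
  (forall i, continuous (fun x => f x i)) -> continuous f.
Proof.
move=> fc x; apply/cvg_sup => i.
suff : continuous (f : T -> initial_topology (fun y : prod_topology K => y i)).
  by apply.
by apply: continuous_comp_initial; exact: fc.
Qed.

Lemma coord_continuous (K : nat -> topologicalType) (i : nat) :
  continuous (fun f : prod_topology K => f i).
Proof. exact: (@proj_continuous nat K i). Qed.

Lemma discrete_continuous (S T : discreteTopologicalType) (f : S -> T) :
  continuous f.
Proof. by apply/continuousP => A _; exact: discrete_open. Qed.

Lemma comp_continuous (S T U : topologicalType) (f : S -> T) (g : T -> U) :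
  continuous f -> continuous g -> continuous (g \o f).
Proof.
by move=> cf cg x; apply: continuous_comp; [exact: cf | exact: cg].
Qed.

Lemma letterwise_continuous k l (p : 'I_k -> 'I_l) :
  continuous (letterwise p : fullshift k -> fullshift l).
Proof.
apply: (@prod_continuous (fullshift k)
  (fun=> discrete_topology 'I_l) (letterwise p)) => i.
have pc : continuous (p : discrete_topology 'I_k -> discrete_topology 'I_l).
  exact: discrete_continuous.
exact: (@comp_continuous (fullshift k) _ _ _ _
  (@coord_continuous (fun=> discrete_topology 'I_k) i) pc).
Qed.

Lemma letterwise_measurable k l (p : 'I_k.+1 -> 'I_l.+1) :
  measurable_fun [set: fullshift k.+1]
    (letterwise p : fullshift k.+1 -> fullshift l.+1).
Proof.
apply: (measurability (@open (fullshift l.+1))) => // _ [A oA <-].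
rewrite setTI; apply: sub_sigma_algebra.
by move/continuousP: (@letterwise_continuous _ _ p); apply.
Qed.

HB.instance Definition _ k l (p : 'I_k.+1 -> 'I_l.+1) :=
  isMeasurableFun.Build _ _ (fullshift k.+1) (fullshift l.+1) (letterwise p)
    (letterwise_measurable p).

(* Main.v *)
(* The maximal entropy measure mu of X is Markov with the Parry transitions:
   tilting the Parry weights after a word u towards the transitions of mu would
   otherwise lower the cross entropy below log lambda, while the Parry measure has
   entropy at least log lambda.  Hence mu[x_1...x_n] is c(x_1) r(x_n) lambda^(-n), so
   m = pi mu satisfies m[y_1...y_n] ~ lambda^(-n) phi_n(y) up to a constant, and as
   the symbol 1 has a single preimage, m is a renewal measure:
   m[s1t] m[1] = m[s1] m[1t].  This turns a Gibbs measure into almost additivity of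
   Phi.  Conversely put g(y) = log (m[y_1...y_N] / m[y_2...y_N]), where y_N is the
   first 1 after y_1; by renewal N may be replaced by the position of any later 1, so
   S_n g telescopes and additivity of log m up to C_n gives |log m - S_n g| <= C_n.
   Continuity of g at the points followed by 222... amounts to the convergence of
   m[2^(k+1) 1] / m[2^k 1], which solves a linear recurrence given by a 2 x 2 zero-one
   matrix.  Two weak Gibbs measures nu and m for g have relative entropy o(n) on
   n-blocks; the tilting argument then shows that nu has the transitions of m after
   every word containing 1, and the exponential decay of m[2^n] gives nu = m. *)
Require Import Defs.
From HB Require Import structures.
From mathcomp Require Import all_boot all_order all_algebra.
From mathcomp Require Import all_classical all_reals all_analysis.
From mathcomp Require Import ring lra zify.
Import Order.TTheory GRing.Theory Num.Theory.
Import numFieldTopology.Exports numFieldNormedType.Exports.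

Set Implicit Arguments.
Unset Strict Implicit.
Unset Printing Implicit Defensive.

Local Open Scope classical_set_scope.
Local Open Scope ring_scope.

(** * Topology and Borel sets of the shift *)

(** The hypothesis on [mu] only says that a supremum of entropies is attained, so the growth rate
    lambda has to come from a competitor: the Parry measure is built by hand from Perron-Frobenius
    eigenvectors. Measures are compared by relative entropy on finite words. A discrepancy between
    the transitions after one fixed word recurs, by stationarity, at every position, so it costs an
    amount linear in n and contradicts any bound o(n). Weak Gibbs constants give exactly such
    bounds, and Gibbs constants are a special case, so one uniqueness argument serves both notions.
    The obstacle to a continuous potential is a tail 222..., where no later 1 lets the renewal
    property cut the word. There the value must be a limit of ratios, and both this limit and its
    complement to 1 need finite logarithms; additivity with a first block of length one supplies
    that. The shape of Y enters by allowing a 1 to be placed after a 2 and followed by 2s for ever,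
    which approximates the points ending in 2s by points to which renewal applies. *)

Section shift_topology.
Variable k : nat.
Implicit Types (x y : fullshift k) (A : set (fullshift k)).

Lemma initial_blockP x y n :
  initial_block x n = initial_block y n <-> forall i, (i < n)%N -> x i = y i.
Proof.
rewrite /initial_block; split=> [E i lin|E].
  by rewrite -(nth_mkseq (x i) x lin) E nth_mkseq.
apply: (@eq_from_nth _ (x 0%N)); rewrite !size_mkseq // => i lin.
by rewrite !nth_mkseq // E.
Qed.

Lemma take_initial_block x m n : (m <= n)%N ->
  take m (initial_block x n) = initial_block x m.
Proof.
by move=> mn; rewrite /initial_block /mkseq -map_take take_iota (minn_idPl mn).
Qed.

Lemma coord_open i (a : 'I_k) : open [set x : fullshift k | x i = a].
Proof.
have /continuousP := @Defs.coord_continuous (fun=> discrete_topology 'I_k) i.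
by move=> /(_ [set a]); apply; exact: discrete_open.
Qed.

Lemma block_open n w : open [set x : fullshift k | initial_block x n = w].
Proof.
case: (pselect (exists x0 : fullshift k, initial_block x0 n = w)); last first.
  move=> H; rewrite (_ : [set _ | _] = set0); first exact: open0.
  by rewrite -subset0 => x /= xw; apply: H; exists x.
move=> [x0 <-].
have -> : [set x : fullshift k | initial_block x n = initial_block x0 n] =
    \big[setI/setT]_(i < n) [set x : fullshift k | x i = x0 i].
  rewrite -(bigcap_mkord n (fun i => [set x : fullshift k | x i = x0 i])).
  apply/seteqP; split => x /=.
    by move=> /initial_blockP E i /= lin; exact: E.
  by move=> E; apply/initial_blockP => i lin; exact: E.
elim/big_ind : _ => [|B C oB oC|i _]; first exact: openT.
  exact: openI.
exact: coord_open.
Qed.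

Lemma nbhs_blockP x A : nbhs x A <->
  exists n, [set y | initial_block y n = initial_block x n] `<=` A.
Proof.
split; last first.
  move=> [n nA]; apply: (filterS nA).
  by apply: open_nbhs_nbhs; split => //; exact: block_open.
pose B n := [set y | initial_block y n = initial_block x n].
have PF : Filter (filter_from [set: nat] B).
  apply: filter_from_filter; first by exists 0%N.
  move=> i j _ _; exists (maxn i j) => // y /initial_blockP E.
  by split; apply/initial_blockP => l ll; apply: E; rewrite leq_max ll ?orbT.
(* The product topology is a supremum of initial topologies, so it suffices that the filter of block
   neighbourhoods converges in each coordinate. *)
move=> xA; suff : (filter_from [set: nat] B) -->
    (x : prod_topology (fun=> discrete_topology 'I_k)).
  by move=> /(_ _ xA) [n _ nA]; exists n.
apply/cvg_sup => i U.
case=> V [[W oW <-]] /= Wx VU.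
exists i.+1 => // y /initial_blockP /(_ i (ltnSn _)) E.
by apply: VU; rewrite /= E.
Qed.

End shift_topology.

(** * Cylinders generate the Borel sets and determine measures *)

Section shift_measurable.
Variable k : nat.
Local Notation T := (fullshift k.+1).

Lemma open_measurable_shift (A : set T) : open A -> measurable A.
Proof. by move=> oA; exact: (@sub_sigma_algebra T setT (@open T)). Qed.

Lemma block_measurable n w : measurable [set x : T | initial_block x n = w].
Proof. by apply: open_measurable_shift; exact: block_open. Qed.

Definition block_sets : set (set T) :=
  [set A | exists w, A = [set x : T | initial_block x (size w) = w]].

Lemma measurable_block_sets : @measurable _ T = <<s block_sets >>.
Proof.
apply/seteqP; split.
  apply: smallest_sub; first exact: smallest_sigma_algebra.
  move=> A oA.
  pose W := [set w | [set x : T | initial_block x (size w) = w] `<=` A].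
  have -> : A = \bigcup_(w in W) [set x : T | initial_block x (size w) = w].
    apply/seteqP; split=> x; last by move=> [w + xw]; apply.
    move=> Ax; have /nbhs_blockP[n nA] : nbhs x A by exact: open_nbhs_nbhs.
    exists (initial_block x n); last by rewrite /= size_mkseq.
    by rewrite /W/= size_mkseq.
  (* Words are countable: [F] enumerates the cylinders inside [A] through their codes, which makes
     the union countable. *)
  pose F (i : nat) := if unpickle i is Some w then
      (if w \in W then [set x : T | initial_block x (size w) = w] else set0)
      else set0.
  have -> : \bigcup_(w in W) [set x : T | initial_block x (size w) = w] =
      \bigcup_i F i.
    apply/seteqP; split=> [x [w Ww xw]|x [i _]].
      by exists (pickle w) => //; rewrite /F pickleK mem_set.
    rewrite /F; case: unpickle => [w|//]; case: ifPn => // /set_mem Ww xw.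
    by exists w.
  apply: sigma_algebra_bigcup => i.
  rewrite /F; case: unpickle => [w|]; last exact: sigma_algebra0.
  case: ifPn => _; last exact: sigma_algebra0.
  by apply: sub_sigma_algebra; exists w.
apply: smallest_sub; first exact: sigma_algebra_measurable.
by move=> _ [w ->]; exact: block_measurable.
Qed.

(** Two cylinders are nested or disjoint, so together with the empty set they form a pi-system, and
    measures that agree on it agree on the sigma-algebra it generates. *)
Lemma eq_measure_block (R : realType) (m1 m2 : probability T R) :
  (forall w, m1 [set x | initial_block x (size w) = w] =
             m2 [set x | initial_block x (size w) = w]) ->
  forall A, measurable A -> m1 A = m2 A.
Proof.
move=> E A mA.
apply: (@measure_unique _ R T (block_sets `|` [set set0]) (fun=> setT)) => //.
- rewrite measurable_block_sets; apply/seteqP; split.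
    apply: smallest_sub; first exact: smallest_sigma_algebra.
    by move=> B BB; apply: sub_sigma_algebra; left.
  apply: smallest_sub; first exact: smallest_sigma_algebra.
  move=> B [BB|->]; first exact: sub_sigma_algebra.
  exact: sigma_algebra0.
- have H u v : (size u <= size v)%N ->
    (block_sets `|` [set set0]) ([set x : T | initial_block x (size u) = u] `&`
      [set x | initial_block x (size v) = v]).
    move=> uv; case: (pselect (take (size u) v = u)) => [uE|uN].
      left; exists v; apply/seteqP; split=> [x []//|x /= xv]; split=> //=.
      by rewrite -[RHS]uE -[in RHS]xv take_initial_block.
    right; rewrite /= -subset0 => x /= [xu xv]; apply: uN.
    by rewrite -[in LHS]xv -[RHS]xu take_initial_block.
  move=> B C [[u ->]|->] [[v ->]|->]; rewrite ?setI0 ?set0I; try by right.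
  case: (leqP (size u) (size v)) => [|/ltnW] uv; first exact: H.
  by rewrite setIC; exact: H.
- by move=> _; left; exists [::]; apply/seteqP; split.
- by rewrite bigcup_const //; exists 0%N.
- by move=> B [[w ->]|->]; rewrite ?measure0 //; exact: E.
- by move=> _; apply: (le_lt_trans (probability_le1 _ _)); rewrite ?ltry.
Qed.

End shift_measurable.

(** * Finite distributions and Gibbs' inequality *)

Section gibbs_inequality.
Variable R : realType.

Lemma ln_lt_sub1 (x : R) : 0 < x -> x != 1 -> ln x < x - 1.
Proof.
move=> x0 x1; rewrite -ltr_expR lnK//.
have /expR_gt1Dx : x - 1 != 0 by rewrite subr_eq0.
by rewrite addrC subrK.
Qed.

Lemma ln_le_sub1 (x : R) : 0 < x -> ln x <= x - 1.
Proof.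
move=> x0; have [->|x1] := eqVneq x 1; first by rewrite ln1 subrr.
exact/ltW/ln_lt_sub1.
Qed.

(** This is ln x <= x - 1 at x = q / p, with the case p = 0 apart. *)
Lemma gibbs_term (p q : R) : 0 <= p -> 0 <= q -> (0 < p -> 0 < q) ->
  p - q <= p * (ln p - ln q).
Proof.
move=> p0 q0 pq; have [->|pN0] := eqVneq p 0; first by rewrite mul0r sub0r oppr_le0.
have {}p0 : 0 < p by rewrite lt_neqAle eq_sym pN0.
have {}q0 := pq p0.
have := ln_le_sub1 (divr_gt0 q0 p0); rewrite ln_div ?posrE// -(ler_pM2l p0).
rewrite [p * (q / p - 1)]mulrBr mulr1 mulrCA divff ?gt_eqF// mulr1; lra.
Qed.

Lemma gibbs_term_eq (p q : R) : 0 <= p -> 0 <= q -> (0 < p -> 0 < q) ->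
  p * (ln p - ln q) <= p - q -> p = q.
Proof.
move=> p0 q0 pq; have [->|pN0] := eqVneq p 0.
  by rewrite mul0r sub0r oppr_ge0 => q0'; apply/eqP; rewrite eq_le q0 q0'.
have {}p0 : 0 < p by rewrite lt_neqAle eq_sym pN0.
have {}q0 := pq p0.
have [qp1|/(ln_lt_sub1 (divr_gt0 q0 p0))] := eqVneq (q / p) 1.
  by move=> _; rewrite -[LHS]mul1r -qp1 divfK ?gt_eqF.
rewrite ln_div ?posrE// -(ltr_pM2l p0).
rewrite [p * (q / p - 1)]mulrBr mulr1 mulrCA divff ?gt_eqF// mulr1; lra.
Qed.

Lemma gibbs_sum (F : finType) (p q : F -> R) :
  (forall z, 0 <= p z) -> (forall z, 0 <= q z) -> (forall z, 0 < p z -> 0 < q z) ->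
  \sum_z q z <= \sum_z p z -> 0 <= \sum_z p z * (ln (p z) - ln (q z)).
Proof.
move=> p0 q0 pq spq; rewrite -subr_ge0 in spq.
apply: (le_trans spq); rewrite -sumrB; apply: ler_sum => z _.
by apply: gibbs_term => //; exact: pq.
Qed.

(** Equality case of Gibbs' inequality: the termwise slacks of [gibbs_term] are nonnegative and
    their sum is at most 0, so each of them vanishes. This is what turns an entropy bound into an
    identity of transitions. *)
Lemma gibbs_sum_eq (F : finType) (p q : F -> R) :
  (forall z, 0 <= p z) -> (forall z, 0 <= q z) -> (forall z, 0 < p z -> 0 < q z) ->
  \sum_z q z <= \sum_z p z -> \sum_z p z * (ln (p z) - ln (q z)) <= 0 ->
  forall z, p z = q z.
Proof.
move=> p0 q0 pq spq D0.
have H : \sum_z (p z * (ln (p z) - ln (q z)) - (p z - q z)) == 0.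
  rewrite eq_le; apply/andP; split.
    by rewrite !sumrB; rewrite -subr_ge0 in spq; lra.
  by apply: sumr_ge0 => z _; rewrite subr_ge0; apply: gibbs_term => //; exact: pq.
rewrite psumr_eq0 in H; last first.
  by move=> z _; rewrite subr_ge0; apply: gibbs_term => //; exact: pq.
move=> z; have /allP/(_ z) := H; rewrite mem_index_enum => /(_ isT)/eqP E.
by apply: gibbs_term_eq => //; [exact: pq | lra].
Qed.

End gibbs_inequality.

(** * Sums over words of a given length *)

Section tuple_sums.
Variables (R : zmodType) (F : finType).

Lemma big_tuple_cons n (f : seq F -> R) :
  \sum_(w : n.+1.-tuple F) f w = \sum_a \sum_(w : n.-tuple F) f (a :: w).
Proof.
rewrite pair_big /= (reindex (fun aw : F * n.-tuple F => [tuple of aw.1 :: aw.2])) //=.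
exists (fun w => (thead w, [tuple of behead w])) => [[a w] _|w _] /=.
  by congr pair; apply: val_inj.
by rewrite [w in RHS]tuple_eta.
Qed.

Lemma big_tuple_rcons n (f : seq F -> R) :
  \sum_(w : n.+1.-tuple F) f w = \sum_(w : n.-tuple F) \sum_a f (rcons w a).
Proof.
elim: n f => [|n IHn] f.
  rewrite big_tuple_cons exchange_big /=; apply: eq_bigr => w _.
  by rewrite tuple0.
rewrite big_tuple_cons.
under eq_bigr do rewrite (IHn (fun w => f (_ :: w))).
by rewrite (big_tuple_cons n (fun w => \sum_a f (rcons w a))).
Qed.

Lemma big_tuple0 (f : seq F -> R) : \sum_(w : 0.-tuple F) f w = f [::].
Proof.
rewrite (bigD1 [tuple]) //= big1 ?addr0 // => w.
by move=> /negP[]; apply/eqP; exact: tuple0.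
Qed.

End tuple_sums.

(** * Laws of random variables with finitely many values *)

Section finite_laws.
Context d (T : measurableType d) (R : realType) (m : probability T R).
Implicit Types F G : finType.

Definition fmeasurable F (Z : T -> F) := forall z, measurable (Z @^-1` [set z]).

Definition law F (Z : T -> F) (z : F) : R := fine (m (Z @^-1` [set z])).

Lemma law_ge0 F (Z : T -> F) z : 0 <= law Z z.
Proof. exact: fine_ge0. Qed.

Lemma preimage_predE F (Z : T -> F) (D : pred F) :
  Z @^-1` [set` D] = \bigcup_(z in [set` D]) Z @^-1` [set z].
Proof.
by apply/seteqP; split=> [x /= Dx|x [z /= Dz ->]//]; exists (Z x).
Qed.

Lemma fmeasurable_pred F (Z : T -> F) (D : pred F) : fmeasurable Z ->
  measurable (Z @^-1` [set` D]).
Proof.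
move=> mZ; rewrite preimage_predE.
by apply: fin_bigcup_measurable => // z _; exact: mZ.
Qed.

Lemma law_pred F (Z : T -> F) (D : pred F) : fmeasurable Z ->
  fine (m (Z @^-1` [set` D])) = \sum_(z | D z) law Z z.
Proof.
move=> mZ; rewrite preimage_predE measure_fin_bigcup //; last first.
  exact: trivIset_preimage1.
rewrite -(bigfs _ (index_enum_uniq F)); last first.
  by move=> z _; rewrite mem_index_enum.
by rewrite -sum_fine // => z _; apply: fin_num_measure; exact: mZ.
Qed.

Lemma law_sum1 F (Z : T -> F) : fmeasurable Z -> \sum_z law Z z = 1.
Proof.
move=> mZ; rewrite -(law_pred predT)//.
rewrite (_ : _ @^-1` _ = setT) ?probability_setT//.
by apply/seteqP; split.
Qed.

Lemma fmeasurable_comp F G (Z : T -> F) (f : F -> G) :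
  fmeasurable Z -> fmeasurable (f \o Z).
Proof.
move=> mZ z; rewrite (_ : _ @^-1` _ = Z @^-1` [set` [pred t | f t == z]]).
  exact: fmeasurable_pred.
by apply/seteqP; split=> x /= /eqP.
Qed.

Lemma law_comp F G (Z : T -> F) (f : F -> G) z : fmeasurable Z ->
  law (f \o Z) z = \sum_(t | f t == z) law Z t.
Proof.
move=> mZ; rewrite -(law_pred [pred t | f t == z])//.
rewrite /law; congr (fine (m _)).
by apply/seteqP; split=> x /= /eqP.
Qed.

Lemma law_expect_comp F G (Z : T -> F) (f : F -> G) (g : G -> R) :
  fmeasurable Z ->
  \sum_z law (f \o Z) z * g z = \sum_t law Z t * g (f t).
Proof.
move=> mZ; rewrite [RHS](partition_big f predT) //=; apply: eq_bigr => z _.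
rewrite law_comp // mulr_suml; apply: eq_bigr => t /eqP ft.
by rewrite ft.
Qed.

Lemma law_comp_le F G (Z : T -> F) (f : F -> G) z : fmeasurable Z ->
  law Z z <= law (f \o Z) (f z).
Proof.
move=> mZ; rewrite law_comp // (bigD1 z) //= lerDl; apply: sumr_ge0 => *.
exact: law_ge0.
Qed.

(** The entropy of a function of [Z] is at most that of [Z], since an atom of [Z] is no heavier than
    the atom of [f \o Z] containing it; Gibbs' inequality then passes to the cross entropy against
    the sub-probability [Q]. *)
Lemma law_entropy_le F G (Z : T -> F) (f : F -> G) (Q : F -> R) :
  fmeasurable Z -> (forall z, 0 <= Q z) -> \sum_z Q z <= 1 ->
  (forall z, 0 < law Z z -> 0 < Q z) ->
  - \sum_t law (f \o Z) t * ln (law (f \o Z) t) <=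
  - \sum_z law Z z * ln (Q z).
Proof.
move=> mZ Q0 Q1 ZQ; rewrite lerN2 (law_expect_comp _ (fun t => ln (law (f \o Z) t)))//.
have := @gibbs_sum R F (law Z) Q (law_ge0 Z) Q0 ZQ.
rewrite law_sum1// => /(_ Q1).
under eq_bigr do rewrite mulrBr.
rewrite sumrB subr_ge0 => /le_trans; apply.
apply: ler_sum => z _.
have [->|zN0] := eqVneq (law Z z) 0; first by rewrite !mul0r.
have z0 : 0 < law Z z by rewrite lt_neqAle eq_sym zN0 law_ge0.
have zf := law_comp_le f z mZ.
by rewrite ler_pM2l// ler_ln// posrE (lt_le_trans z0).
Qed.

End finite_laws.

(** * Masses of words *)

Section word_mass.
Variables (k : nat) (R : realType).
Local Notation T := (fullshift k.+1).
Local Notation sh := (@shiftmap k.+1).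
Implicit Types (m : probability T R) (w : seq 'I_k.+1).

Definition word_mass m w : R :=
  fine (m [set x : T | initial_block x (size w) = w]).

Definition shift_invariant m := forall B, measurable B -> m (sh @^-1` B) = m B.

Definition block_map n (x : T) : n.-tuple 'I_k.+1 := [tuple x i | i < n].

Lemma iter_shiftmap n (x : T) i : iter n sh x i = x (n + i)%N.
Proof. by elim: n i => // n IHn i /=; rewrite /shiftmap IHn addnS. Qed.

Lemma block_mapE n x : block_map n x = initial_block x n :> seq _.
Proof.
apply: (@eq_from_nth _ ord0); rewrite ?size_tuple ?size_mkseq // => i ilt.
by rewrite nth_mkseq // -[i]/(val (Ordinal ilt)) -tnth_nth tnth_mktuple.
Qed.

Lemma preimage_block_map n (w : n.-tuple 'I_k.+1) :
  block_map n @^-1` [set w] = [set x : T | initial_block x (size w) = w].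
Proof.
apply/seteqP; split=> x /=; rewrite size_tuple -block_mapE; first by move=> ->.
exact: val_inj.
Qed.

Lemma fmeasurable_block n : fmeasurable (@block_map n).
Proof. by move=> w; rewrite preimage_block_map; exact: block_measurable. Qed.

Lemma law_block m n (w : n.-tuple 'I_k.+1) : law m (@block_map n) w = word_mass m w.
Proof. by rewrite /law preimage_block_map. Qed.

Lemma measurable_shift : measurable_fun [set: T] sh.
Proof.
apply: (measurability (@open T)) => // _ [A oA <-]; rewrite setTI.
apply: open_measurable_shift.
suff /continuousP : continuous (sh : T -> T) by apply.
apply: (@prod_continuous T (fun=> discrete_topology 'I_k.+1)) => i.
exact: (@Defs.coord_continuous (fun=> discrete_topology 'I_k.+1) i.+1).
Qed.

Lemma measurable_preimage_shift (B : set T) : measurable B -> measurable (sh @^-1` B).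
Proof. by move=> mB; rewrite -[X in measurable X]setTI; apply: measurable_shift. Qed.

Lemma shift_invariant_iter m n B : shift_invariant m -> measurable B ->
  m (iter n sh @^-1` B) = m B.
Proof.
move=> mi; elim: n B => // n IHn B mB.
rewrite -[RHS]mi // -[RHS]IHn; last exact: measurable_preimage_shift.
by congr (m _); apply/seteqP; split=> x /=; rewrite -iterS iterSr.
Qed.

Lemma measurable_iter_shift n (B : set T) :
  measurable B -> measurable (iter n sh @^-1` B).
Proof.
elim: n B => // n IHn B mB.
have -> : iter n.+1 sh @^-1` B = iter n sh @^-1` (sh @^-1` B) by [].
by apply: IHn; exact: measurable_preimage_shift.
Qed.

Lemma fmeasurable_iter_shift (F : finType) (Z : T -> F) n :
  fmeasurable Z -> fmeasurable (Z \o iter n sh).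
Proof. by move=> mZ z; rewrite comp_preimage; exact: measurable_iter_shift. Qed.

Lemma law_iter_shift m (F : finType) (Z : T -> F) n :
  shift_invariant m -> fmeasurable Z -> law m (Z \o iter n sh) = law m Z.
Proof.
move=> mi mZ; apply/funext => z.
by rewrite /law comp_preimage shift_invariant_iter.
Qed.

Lemma word_mass_ge0 m w : 0 <= word_mass m w.
Proof. exact: fine_ge0. Qed.

Lemma word_mass_nil m : word_mass m [::] = 1.
Proof.
rewrite /word_mass (_ : [set x : T | _] = setT) ?probability_setT //.
by apply/seteqP; split.
Qed.

Lemma word_massEfin m w :
  m [set x : T | initial_block x (size w) = w] = (word_mass m w)%:E.
Proof. by rewrite fineK //; apply: fin_num_measure; exact: block_measurable. Qed.

Lemma word_mass_sum m n : \sum_(w : n.-tuple 'I_k.+1) word_mass m w = 1.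
Proof.
under eq_bigr do rewrite -law_block.
by apply: law_sum1; exact: fmeasurable_block.
Qed.

Lemma initial_blockS (x : T) n : initial_block x n.+1 = rcons (initial_block x n) (x n).
Proof. by rewrite /initial_block mkseqS. Qed.

Lemma initial_blockSl (x : T) n : initial_block x n.+1 = x 0%N :: initial_block (sh x) n.
Proof.
rewrite /initial_block /mkseq /= -[1%N]addn0 iotaDl -map_comp.
by congr (_ :: _); apply: eq_map.
Qed.

Lemma initial_blockD (x : T) n n' :
  initial_block x (n + n') = initial_block x n ++ initial_block (iter n sh x) n'.
Proof.
rewrite /initial_block /mkseq iotaD map_cat; congr (_ ++ _).
rewrite add0n -[n in iota n]addn0 iotaDl -map_comp.
by apply: eq_map => i /=; rewrite iter_shiftmap.
Qed.

Lemma fmeasurable_pair d (S : measurableType d) (F G : finType)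
    (Z : S -> F) (Z' : S -> G) :
  fmeasurable Z -> fmeasurable Z' -> fmeasurable (fun x => (Z x, Z' x)).
Proof.
move=> mZ mZ' [a b].
rewrite (_ : _ @^-1` _ = Z @^-1` [set a] `&` Z' @^-1` [set b]).
  exact: measurableI.
by apply/seteqP; split=> x /= => [[-> ->]|[-> ->]].
Qed.

Lemma fmeasurable_coord i : fmeasurable (fun x : T => x i).
Proof.
by move=> a; apply: open_measurable_shift; exact: coord_open.
Qed.

Lemma word_mass_rcons m w : word_mass m w = \sum_a word_mass m (rcons w a).
Proof.
rewrite -[w]/(val (in_tuple w)) -law_block.
pose Z (x : T) := (block_map (size w) x, x (size w)).
have mZ : fmeasurable Z.
  by apply: fmeasurable_pair; [exact: fmeasurable_block|exact: fmeasurable_coord].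
rewrite (_ : block_map _ = fst \o Z) // law_comp //.
rewrite (reindex (fun a => (in_tuple w, a))) /=; last first.
  exists snd => // [[a b]]; rewrite inE /= => /eqP -> //.
apply: eq_big => [a|a _]; first by rewrite eqxx.
rewrite /law /word_mass; congr (fine (m _)); apply/seteqP; split=> x /=.
  case=> bw <-; have xw : initial_block x (size w) = w by rewrite -block_mapE.
  by rewrite size_rcons initial_blockS xw.
rewrite size_rcons initial_blockS => /rcons_inj[xw <-].
by congr pair; apply: val_inj; rewrite /= block_mapE.
Qed.

Lemma word_mass_rcons_le m w a : word_mass m (rcons w a) <= word_mass m w.
Proof.
rewrite [leRHS]word_mass_rcons (bigD1 a) //= lerDl.
by apply: sumr_ge0 => *; exact: word_mass_ge0.
Qed.

Lemma word_mass_cons m w : shift_invariant m ->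
  word_mass m w = \sum_a word_mass m (a :: w).
Proof.
move=> mi; rewrite -[w]/(val (in_tuple w)) -law_block.
rewrite -(law_iter_shift 1 mi (@fmeasurable_block _)).
pose Z (x : T) := (x 0%N, block_map (size w) (sh x)).
have mZ : fmeasurable Z.
  apply: fmeasurable_pair; first exact: fmeasurable_coord.
  exact: (fmeasurable_iter_shift 1 (@fmeasurable_block _)).
rewrite (_ : _ \o _ = snd \o Z) // law_comp //.
rewrite (reindex (fun a => (a, in_tuple w))) /=; last first.
  exists fst => // [[a b]]; rewrite inE /= => /eqP -> //.
apply: eq_big => [a|a _]; first by rewrite eqxx.
rewrite /law /word_mass; congr (fine (m _)); apply/seteqP; split=> x /=.
  case=> <- bw; have xw : initial_block (sh x) (size w) = w by rewrite -block_mapE.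
  by rewrite initial_blockSl xw.
rewrite initial_blockSl => -[<- xw].
by congr pair; apply: val_inj; rewrite /= block_mapE.
Qed.

Lemma word_mass_cat_le m u w : shift_invariant m -> word_mass m (u ++ w) <= word_mass m w.
Proof.
move=> mi; elim: u => // a u IHu; apply: le_trans IHu.
rewrite [leRHS](word_mass_cons _ mi) (bigD1 a) //= lerDl.
by apply: sumr_ge0 => *; exact: word_mass_ge0.
Qed.

Lemma word_mass_catl_le m u w : word_mass m (u ++ w) <= word_mass m u.
Proof.
elim/last_ind: w => [|w a IHw]; first by rewrite cats0.
by rewrite -rcons_cat; apply: le_trans IHw; exact: word_mass_rcons_le.
Qed.

End word_mass.

(** * Tilting reference weights after a word *)

Section window.
Variables (k : nat) (R : realType).
Local Notation T := (fullshift k.+1).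
Implicit Types (w : seq 'I_k.+1).
Variable m : probability T R.
Hypothesis mi : shift_invariant m.

Lemma word_expect_drop j n (f : seq 'I_k.+1 -> R) :
  \sum_(w : (j + n).-tuple 'I_k.+1) word_mass m w * f (drop j w) =
  \sum_(w : n.-tuple 'I_k.+1) word_mass m w * f w.
Proof.
elim: j => [|j IHj]; first by under eq_bigr do rewrite drop0.
rewrite -IHj (big_tuple_cons _ (fun w => word_mass m w * f (drop j.+1 w))).
rewrite exchange_big /=; apply: eq_bigr => w _.
by rewrite (word_mass_cons _ mi) mulr_suml.
Qed.

Lemma word_expect_rcons n (f : seq 'I_k.+1 -> R) :
  \sum_(w : n.-tuple 'I_k.+1) \sum_a word_mass m (rcons w a) * f w =
  \sum_(w : n.-tuple 'I_k.+1) word_mass m w * f w.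
Proof.
by apply: eq_bigr => w _; rewrite -mulr_suml -word_mass_rcons.
Qed.

Variable M : seq 'I_k.+1 -> R.
Hypothesis M_ge0 : forall w, 0 <= M w.
Hypothesis M_nil : M [::] = 1.
Hypothesis M_rcons : forall w, M w = \sum_a M (rcons w a).
Hypothesis M_dom : forall w, 0 < word_mass m w -> 0 < M w.
Variable u : seq 'I_k.+1.
Hypothesis u_gt0 : 0 < word_mass m u.
Hypothesis u_renewal : forall w a,
  M (w ++ rcons u a) * M u = M (w ++ u) * M (rcons u a).

(** The mass of [u] times the Kullback-Leibler divergence of the transitions of [m] after [u] from
    those of [M]. *)
Definition window_gain : R := \sum_a word_mass m (rcons u a) *
  (ln (word_mass m (rcons u a)) - ln (word_mass m u * (M (rcons u a) / M u))).

Lemma window_gain_eq0 : window_gain <= 0 ->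
  forall a, word_mass m (rcons u a) = word_mass m u * (M (rcons u a) / M u).
Proof.
move=> W0; apply: gibbs_sum_eq => //.
- by move=> a; exact: word_mass_ge0.
- by move=> a; rewrite mulr_ge0 ?word_mass_ge0// divr_ge0.
- by move=> a a0; rewrite mulr_gt0// divr_gt0// M_dom.
- rewrite -mulr_sumr -mulr_suml -M_rcons -word_mass_rcons divff ?mulr1//.
  by rewrite gt_eqF// M_dom.
Qed.

(** The truncated difference makes the test fail on words shorter than [u]: then all of [w] is
    compared with [u]. *)
Let kernel w a : R := if drop (size w - size u) w == u
  then word_mass m (rcons u a) / word_mass m u else M (rcons w a) / M w.

(* The reference weights M with the transitions after u replaced by those of m. *)
Definition tilted_mass w : R := \prod_(i < size w) kernel (take i w) (nth ord0 w i).

Lemma tilted_mass_rcons w a : tilted_mass (rcons w a) = tilted_mass w * kernel w a.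
Proof.
rewrite /tilted_mass size_rcons big_ord_recr /=; congr (_ * _).
  apply: eq_bigr => i _; rewrite nth_rcons ltn_ord.
  by rewrite -cats1 takel_cat // ltnW.
by rewrite nth_rcons ltnn eqxx -cats1 take_size_cat.
Qed.

Let kernel_ge0 w a : 0 <= kernel w a.
Proof.
by rewrite /kernel; case: ifP => _; rewrite divr_ge0 ?word_mass_ge0.
Qed.

Lemma tilted_mass_ge0 w : 0 <= tilted_mass w.
Proof. by apply: prodr_ge0 => i _. Qed.

Let kernel_sum w : \sum_a kernel w a <= 1.
Proof.
rewrite /kernel; case: eqP => _.
  by rewrite -mulr_suml -word_mass_rcons divff ?gt_eqF.
rewrite -mulr_suml -M_rcons; have [->|?] := eqVneq (M w) 0; first by rewrite mul0r.
by rewrite divff.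
Qed.

Lemma tilted_mass_sum n : \sum_(w : n.-tuple 'I_k.+1) tilted_mass w <= 1.
Proof.
elim: n => [|n IHn]; first by rewrite big_tuple0 /tilted_mass big_ord0.
rewrite big_tuple_rcons; apply: le_trans IHn; apply: ler_sum => w _.
under eq_bigr do rewrite tilted_mass_rcons.
by rewrite -mulr_sumr ler_piMr ?tilted_mass_ge0.
Qed.

Lemma suffix_catE w : drop (size w - size u) w == u ->
  exists w', w = w' ++ u.
Proof.
by move=> /eqP E; exists (take (size w - size u) w); rewrite -[LHS](cat_take_drop (size w - size u)) E.
Qed.

Let kernel_gt0 w a : 0 < word_mass m (rcons w a) -> 0 < kernel w a.
Proof.
move=> wa0; rewrite /kernel; case: ifP => [/suffix_catE[w' wE]|_].
  rewrite divr_gt0 //; apply: (lt_le_trans wa0).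
  by rewrite wE rcons_cat; exact: word_mass_cat_le.
by rewrite divr_gt0 // M_dom //; apply: lt_le_trans wa0 _; exact: word_mass_rcons_le.
Qed.

Lemma tilted_mass_gt0 w : 0 < word_mass m w -> 0 < tilted_mass w.
Proof.
elim/last_ind: w => [_|w a IHw wa0]; first by rewrite /tilted_mass big_ord0.
rewrite tilted_mass_rcons mulr_gt0 // ?kernel_gt0//; apply: IHw.
by apply: lt_le_trans wa0 _; exact: word_mass_rcons_le.
Qed.

Let gain w : R := if (size w == (size u).+1) && (take (size u) w == u)
  then ln (word_mass m w) - ln (word_mass m u * (M w / M u)) else 0.

(** The weights change only when [w] ends in [u], and there [u_renewal] makes the old transition
    M(wa) / M(w) equal to M(ua) / M(u), whatever precedes [u]. So the increment depends on the last
    letters alone. *)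
Let ln_tilted_rcons w a : 0 < word_mass m (rcons w a) ->
  ln (tilted_mass (rcons w a)) - ln (M (rcons w a)) =
  ln (tilted_mass w) - ln (M w) + gain (drop (size w - size u) (rcons w a)).
Proof.
move=> wa0; have w0 : 0 < word_mass m w.
  by apply: lt_le_trans wa0 _; exact: word_mass_rcons_le.
have [Mw Mwa] := (M_dom w0, M_dom wa0).
rewrite tilted_mass_rcons lnM ?posrE ?tilted_mass_gt0 ?kernel_gt0//.
rewrite drop_rcons ?leq_subr// /gain /kernel.
case: ifPn => [/[dup] /eqP wu /suffix_catE[w' wE]|wu].
  rewrite wu size_rcons -cats1 take_size_cat // !eqxx cats1 /=.
  have ua0 : 0 < word_mass m (rcons u a).
    by apply: (lt_le_trans wa0); rewrite wE rcons_cat; exact: word_mass_cat_le.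
  have [Mu Mua] := (M_dom u_gt0, M_dom ua0).
  have -> : M (rcons w a) = M w * (M (rcons u a) / M u).
    by rewrite mulrA wE -u_renewal rcons_cat mulfK // gt_eqF.
  rewrite !(ln_div, lnM) ?posrE ?divr_gt0//; lra.
rewrite ifN ?addr0; last first.
  apply: contra wu => /andP[/eqP]; rewrite size_rcons => -[su].
  by rewrite -cats1 -[X in take X _]su take_size_cat.
rewrite ln_div ?posrE//; lra.
Qed.

(** Each letter after the first [size u] completes one window of length [(size u).+1]; by
    stationarity every window has the same expected gain. *)
Lemma ln_tilted_mass n :
  \sum_(w : n.-tuple 'I_k.+1) word_mass m w * (ln (tilted_mass w) - ln (M w)) =
  (n - size u)%:R * window_gain.
Proof.
elim: n => [|n IHn].
  rewrite (big_tuple0 (fun w => word_mass m w * (ln (tilted_mass w) - ln (M w)))).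
  by rewrite /tilted_mass big_ord0 M_nil ln1 subrr mulr0 sub0n mul0r.
rewrite (big_tuple_rcons _ (fun w => word_mass m w * (ln (tilted_mass w) - ln (M w)))).
transitivity (\sum_(w : n.-tuple 'I_k.+1) \sum_a
   word_mass m (rcons w a) * (ln (tilted_mass w) - ln (M w)) +
  \sum_(w : n.-tuple 'I_k.+1) \sum_a
   word_mass m (rcons w a) * gain (drop (n - size u) (rcons w a))).
  rewrite -big_split /=; apply: eq_bigr => w _.
  rewrite -big_split /=; apply: eq_bigr => a _; rewrite -mulrDr.
  have [->|wa] := eqVneq (word_mass m (rcons w a)) 0; first by rewrite !mul0r.
  rewrite ln_tilted_rcons ?size_tuple //.
  by rewrite lt_neqAle eq_sym wa word_mass_ge0.
rewrite (word_expect_rcons _ (fun w => ln (tilted_mass w) - ln (M w))) IHn.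
rewrite -(big_tuple_rcons _ (fun w => word_mass m w * gain (drop (n - size u) w))).
have [nu|un] := ltnP n (size u).
  have -> : (n - size u = 0)%N by lia.
  have -> : (n.+1 - size u = 0)%N by lia.
  rewrite mul0r add0r big1 // => w _.
  rewrite drop0 /gain ifN ?mulr0//.
  by rewrite size_tuple; apply/negP => /andP[/eqP]; lia.
have nE : (n.+1 = (n - size u) + (size u).+1)%N by lia.
rewrite [X in _ + X](_ : _ = window_gain).
  by rewrite subSn// -[in RHS]addn1 natrD mulrDl mul1r.
have drop_gain j N : (N = j + (size u).+1)%N ->
    \sum_(w : N.-tuple 'I_k.+1) word_mass m w * gain (drop j w) =
    \sum_(w : (size u).+1.-tuple 'I_k.+1) word_mass m w * gain w.
  by move=> ->; rewrite word_expect_drop.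
rewrite (drop_gain _ _ nE) (big_tuple_rcons _ (fun w => word_mass m w * gain w)).
rewrite (bigD1 (in_tuple u)) //= [X in _ + X]big1 ?addr0; last first.
  move=> w wu; rewrite big1 // => a _.
  rewrite /gain ifN ?mulr0//; apply: contra wu => /andP[_].
  by rewrite -cats1 -{1}(size_tuple w) take_size_cat.
apply: eq_bigr => a _.
by rewrite /gain size_rcons eqxx -cats1 take_size_cat // eqxx cats1.
Qed.

End window.

(** * Approximation of partitions by blocks *)

Section approximation.
Variables (k : nat) (R : realType).
Local Notation T := (fullshift k.+1).
Variable m : probability T R.

Definition finite_range_set (B : set T) :=
  exists n (D : pred (seq 'I_k.+1)), B = [set x | D (initial_block x n)].

Lemma finite_range_setC B : finite_range_set B -> finite_range_set (~` B).
Proof.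
move=> [n [D ->]]; exists n, (fun w => ~~ D w); apply/seteqP.
by split=> x /= => [/negP|/negP].
Qed.

Lemma finite_range_setU A B :
  finite_range_set A -> finite_range_set B -> finite_range_set (A `|` B).
Proof.
move=> [n [D ->]] [n' [D' ->]].
exists (maxn n n'), (fun w => D (take n w) || D' (take n' w)); apply/seteqP.
by split=> x /=; rewrite !take_initial_block ?leq_maxl ?leq_maxr// => /orP.
Qed.

Lemma finite_range_measurable B : finite_range_set B -> measurable B.
Proof.
move=> [n [D ->]].
rewrite (_ : [set _ | _] = @block_map k n @^-1` [set` [pred w : n.-tuple _ | D w]]).
  by apply: fmeasurable_pred; exact: fmeasurable_block.
by apply/seteqP; split=> x /=; rewrite inE block_mapE.
Qed.

Lemma measurable_symdiff (A B : set T) :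
  measurable A -> measurable B -> measurable ((A `\` B) `|` (B `\` A)).
Proof. by move=> mA mB; apply: measurableU; exact: measurableD. Qed.

Definition approximable (A : set T) := measurable A /\ forall e : R, 0 < e ->
  exists2 B, finite_range_set B & (m ((A `\` B) `|` (B `\` A)) < e%:E)%E.

Lemma approximableU A B : approximable A -> approximable B -> approximable (A `|` B).
Proof.
move=> [mA aA] [mB aB]; split; first exact: measurableU.
move=> e e0; have e20 : 0 < e / 2 by rewrite divr_gt0.
have [[A' fA AA'] [B' fB BB']] := (aA _ e20, aB _ e20).
exists (A' `|` B'); first exact: finite_range_setU.
have [mA' mB'] := (finite_range_measurable fA, finite_range_measurable fB).
rewrite [e]splitr EFinD; apply: le_lt_trans (lteD AA' BB').
apply: (le_trans _ (measureU2 _ _ _)); try exact: measurable_symdiff.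
apply: le_measure; rewrite ?inE; try apply: measurableU;
  try exact: measurable_symdiff; try (apply: measurableD; exact: measurableU).
move=> x /= [[[Ax|Bx]]|[[Ax|Bx]]].
- by move=> /not_orP[? ?]; left; left.
- by move=> /not_orP[? ?]; right; left.
- by move=> /not_orP[? ?]; left; right.
- by move=> /not_orP[? ?]; right; right.
Qed.

(** A complement has the same symmetric difference. A countable union is first replaced by a finite
    one, half of the error being spent on continuity from below, and the finite one is then
    approximated with the other half. *)
Lemma approximable_sigma_algebra : sigma_algebra setT approximable.
Proof.
have approx_fin B : finite_range_set B -> approximable B.
  move=> fB; split; first exact: finite_range_measurable.
  move=> e e0; exists B => //; rewrite setDv setU0 measure0 lte_fin //.
have approx0 : approximable set0.
  apply: approx_fin; exists 0%N, pred0; by apply/seteqP; split.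
split => //.
- move=> A [mA aA]; split; first exact: measurableD.
  move=> e /aA [B fB AB]; exists (~` B); first exact: finite_range_setC.
  apply: le_lt_trans AB; rewrite le_eqVlt; apply/orP; left; apply/eqP; congr (m _).
  apply/seteqP; split=> x /=.
    by move=> [[[_ Ax] /contrapT Bx]|[Bx /not_andP[//|/contrapT Ax]]]; [right|left].
  by move=> [[Ax Bx]|[Bx Ax]]; [right|left]; split => //; case.
- move=> A aA; have mA i : measurable (A i) by have [] := aA i.
  split; first exact: bigcup_measurable.
  move=> e e0; have e20 : 0 < e / 2 by rewrite divr_gt0.
  pose U := \bigcup_i A i; pose V n := \big[setU/set0]_(i < n) A i.
  have mU : measurable U by exact: bigcup_measurable.
  have aV n : approximable (V n).
    rewrite /V; elim: n => [|n IHn]; first by rewrite big_ord0.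
    by rewrite big_ord_recr /=; exact: approximableU.
  have mV n : measurable (V n) by have [] := aV n.
  have VU n : V n `<=` U.
    by rewrite /V -bigcup_mkord => x [i _ Ax]; exists i.
  have cV : (m \o V) @ \oo --> m (\bigcup_n V n).
    apply: nondecreasing_cvg_mu => //; first exact: bigcup_measurable.
    by move=> i j ij; apply/subsetPset; exact: subset_bigsetU.
  have VE : \bigcup_n V n = U.
    apply/seteqP; split=> [x [n _ /VU]//|x [i _ Ax]].
    by exists i.+1 => //; rewrite /V big_ord_recr /=; right.
  have [n mUV] : exists n, (m (U `\` V n) < (e / 2)%:E)%E.
    rewrite VE in cV.
    have /fine_cvgP[_ /cvgrPdist_lt /(_ _ e20)[n _ /(_ n (leqnn n)) Hn]] :
      (m \o V) @ \oo --> (fine (m U))%:E by rewrite fineK// fin_num_measure.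
    exists n; have -> : m (U `\` V n) = (fine (m U) - fine (m (V n)))%:E.
      have Uoo : (m U < +oo)%E by rewrite ltey_eq fin_num_measure.
      by rewrite measureD// setIidr// EFinB !fineK ?fin_num_measure.
    by rewrite lte_fin; apply: le_lt_trans Hn; exact: ler_norm.
  have [_ /(_ _ e20)[B fB VB]] := aV n.
  exists B => //; have mB := finite_range_measurable fB.
  rewrite [e]splitr EFinD; apply: le_lt_trans (lteD mUV VB).
  apply: (le_trans _ (measureU2 _ _ _)); [|exact: measurableD|exact: measurable_symdiff].
  apply: le_measure; rewrite ?inE; try exact: measurable_symdiff.
    by apply: measurableU; [exact: measurableD|exact: measurable_symdiff].
  move=> x /= [[Ux Bx]|[Bx Ux]]; last by right; right; split => // /VU.
  by case: (pselect (V n x)) => Vx; [right; left|left].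
Qed.

Lemma measurable_approximable A : measurable A -> approximable A.
Proof.
have : measurable `<=` approximable.
  rewrite measurable_block_sets; apply: smallest_sub.
    exact: approximable_sigma_algebra.
  move=> _ [w ->]; split; first exact: block_measurable.
  move=> e e0; exists [set x | initial_block x (size w) = w].
    exists (size w), (pred1 w); apply/seteqP.
    by split=> x /= /eqP.
  by rewrite setDv setU0 measure0 lte_fin.
exact.
Qed.

Lemma partition_approx r (xi : T -> 'I_r) (e : R) : measurable_partition xi -> 0 < e ->
  exists l (c : seq 'I_k.+1 -> 'I_r),
    fine (m [set x | xi x != c (initial_block x l)]) <= e.
Proof.
move=> mxi e0; have e0' : 0 < e / r.+1%:R by rewrite divr_gt0.
have /choice[N HN] : forall i, exists n, exists D : pred (seq 'I_k.+1),
    fine (m ((xi @^-1` [set i] `\` [set x | D (initial_block x n)]) `|`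
     ([set x | D (initial_block x n)] `\` xi @^-1` [set i]))) <= e / r.+1%:R.
  move=> i; have [_ /(_ _ e0')[B [n [D ->]] H]] := measurable_approximable (mxi i).
  exists n, D; rewrite -lee_fin fineK ?ltW//; apply: fin_num_measure.
  apply: measurable_symdiff; first exact: mxi.
  by apply: finite_range_measurable; exists n, D.
have /choice[D HD] := HN.
pose l := \max_i N i.
(* [c] guesses a label whose approximating set contains the block. A wrong guess puts [x] in the
   symmetric difference [S i] for the guessed label, or for the true label when no set contains the
   block. *)
pose c w := odflt (xi point) [pick i | D i (take (N i) w)].
exists l, c.
pose S i := (xi @^-1` [set i] `\` [set x | D i (initial_block x (N i))]) `|`
     ([set x | D i (initial_block x (N i))] `\` xi @^-1` [set i]).
have mS i : measurable (S i).
  apply: measurable_symdiff; first exact: mxi.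
  by apply: finite_range_measurable; exists (N i), (D i).
have mN : measurable [set x | xi x != c (initial_block x l)].
  pose Z x := (xi x, c (initial_block x l)).
  have mZ : fmeasurable Z.
    apply: fmeasurable_pair => // z; apply: finite_range_measurable.
    by exists l, (fun w => c w == z); apply/seteqP; split => x /= /eqP.
  exact: (fmeasurable_pred [pred z | z.1 != z.2] mZ).
apply: (@le_trans _ _ (\sum_(i < r) fine (m (S i)))); last first.
  apply: (@le_trans _ _ (\sum_(i < r) e / r.+1%:R)); first by apply: ler_sum => i _; exact: HD.
  rewrite sumr_const card_ord -[leLHS]mulr_natr -mulrA ler_piMr ?(ltW e0)//.
  by rewrite mulrC ler_pdivrMr// mul1r ler_nat.
rewrite sum_fine; last by move=> i _; rewrite fin_num_measure.
rewrite fine_le ?fin_num_measure//.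
  by apply/sum_fin_numP => i _ _; rewrite fin_num_measure.
have [mU] : measurable (\big[setU/set0]_(i < r) S i) /\
    (m (\big[setU/set0]_(i < r) S i) <= \sum_(i < r) m (S i))%E.
  elim/big_rec2 : _ => [|i U y _ [mU Uy]]; first by rewrite measure0.
  split; first exact: measurableU.
  by apply: (le_trans (measureU2 _ _ _)) => //; rewrite leeD2l.
apply: le_trans; apply: le_measure; rewrite ?inE//.
move=> x /= xc.
suff [i Six] : exists i, S i x by rewrite (bigD1 i) //=; left.
move: xc; rewrite /c; case: pickP => [i|noD] /=.
  rewrite take_initial_block ?leq_bigmax// => Di xi_i; exists i; right.
  by split => //=; apply/eqP.
move=> _; exists (xi x); left; split => //= Dx.
by have := noD (xi x); rewrite take_initial_block ?leq_bigmax// Dx.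
Qed.

End approximation.

(** * Entropy bounds *)

Lemma ln_prod (R : realType) n (f : 'I_n -> R) : (forall i, 0 < f i) ->
  ln (\prod_(i < n) f i) = \sum_(i < n) ln (f i).
Proof.
move=> f0; suff [] : 0 < \prod_(i < n) f i /\
    ln (\prod_(i < n) f i) = \sum_(i < n) ln (f i) by [].
elim/big_rec2 : _ => [|i y z _ [z0 <-]]; first by rewrite ln1.
by rewrite lnM ?posrE// mulr_gt0.
Qed.

Section entropy_bound.
Variables (k : nat) (R : realType).
Local Notation T := (fullshift k.+1).
Local Notation sh := (@shiftmap k.+1).
Variable m : probability T R.

Definition itinerary r (xi : T -> 'I_r) n (x : T) : n.-tuple 'I_r :=
  [tuple xi (iter i sh x) | i < n].

Lemma fmeasurable_itinerary r (xi : T -> 'I_r) n :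
  measurable_partition xi -> fmeasurable (@itinerary r xi n).
Proof.
move=> mxi w.
have -> : @itinerary r xi n @^-1` [set w] =
    \bigcap_(i in [set: 'I_n]) (iter i sh @^-1` (xi @^-1` [set tnth w i])).
  apply/seteqP; split=> x /= => [<- i _|xw]; first by rewrite /= tnth_mktuple.
  by apply: eq_from_tnth => i; rewrite tnth_mktuple; exact: xw.
apply: fin_bigcap_measurable => // i _.
by apply: measurable_iter_shift; exact: mxi.
Qed.

Lemma join_entropyE r (xi : T -> 'I_r) n :
  join_entropy m sh xi n =
  - \sum_(w : n.-tuple 'I_r) law m (@itinerary r xi n) w *
                             ln (law m (@itinerary r xi n) w).
Proof.
rewrite /join_entropy; congr (- _); apply: eq_bigr => w _.
rewrite (_ : join_atom sh xi w = @itinerary r xi n @^-1` [set w]) //.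
apply/seteqP; split=> x /= => [xw|<- i]; last by rewrite tnth_mktuple.
by apply: eq_from_tnth => i; rewrite tnth_mktuple; exact: xw.
Qed.

Lemma join_entropy_ge0 r (xi : T -> 'I_r) n : measurable_partition xi ->
  0 <= join_entropy m sh xi n.
Proof.
move=> mxi; rewrite join_entropyE oppr_ge0; apply: sumr_le0 => w _.
apply: mulr_ge0_le0; first exact: law_ge0.
apply: ln_le0; rewrite -(law_sum1 m (@fmeasurable_itinerary r xi n mxi)).
rewrite (bigD1 w) //= lerDl; apply: sumr_ge0 => *; exact: law_ge0.
Qed.

Lemma tuple_prod_le1 (F : finType) n (f : nat -> F -> R) (a : F) :
  (forall i z, 0 <= f i z) -> (forall i, \sum_z f i z <= 1) ->
  \sum_(v : n.-tuple F) \prod_(i < n) f i (nth a v i) <= 1.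
Proof.
move=> f0 f1; elim: n => [|n IHn].
  by rewrite (big_tuple0 (fun v => \prod_(i < 0) f i (nth a v i))) big_ord0.
rewrite (big_tuple_rcons _ (fun v => \prod_(i < n.+1) f i (nth a v i))).
apply: le_trans IHn; apply: ler_sum => v _.
have E z : \prod_(i < n.+1) f i (nth a (rcons v z) i) =
    \prod_(i < n) f i (nth a v i) * f n z.
  rewrite big_ord_recr /= nth_rcons size_tuple ltnn eqxx; congr (_ * _).
  by apply: eq_bigr => i _; rewrite nth_rcons size_tuple ltn_ord.
under eq_bigr do rewrite E.
by rewrite -mulr_sumr ler_piMr // prodr_ge0.
Qed.

Hypothesis mi : shift_invariant m.

(** The itinerary is nearly a function of the block of length [n + l], the label at time i being
    decoded from the l letters starting there. Weighting the pair (itinerary, block) by [Q] on the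
    block and by a decoder allowing rare errors bounds the entropy, at a cost of [e] per letter. *)
Lemma join_entropy_upper r (xi : T -> 'I_r) (e : R) : measurable_partition xi -> 0 < e ->
  exists l, forall n (Q : seq 'I_k.+1 -> R),
    (forall w, 0 <= Q w) -> \sum_(w : (n + l).-tuple 'I_k.+1) Q w <= 1 ->
    (forall w, 0 < word_mass m w -> 0 < Q w) ->
    join_entropy m sh xi n <=
    - (\sum_(w : (n + l).-tuple 'I_k.+1) word_mass m w * ln (Q w)) + n%:R * e.
Proof.
move=> mxi e0.
have r0 : (0 < r)%N by case: r xi mxi => // xi _; have [] := xi point.
(* A correct guess costs - ln (1 - d) = e / 2. A wrong one costs at most |L|, and the decoder is
   chosen to err with probability at most (e / 2) / (1 + |L|), which adds at most e / 2. *)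
pose d := 1 - expR (- (e / 2)).
have e20 : 0 < e / 2 by rewrite divr_gt0.
have d0 : 0 < d by rewrite subr_gt0 expR_lt1 oppr_lt0.
have d1 : 0 < 1 - d by rewrite /d opprB addrC subrK expR_gt0.
have lnd : ln (1 - d) = - (e / 2) by rewrite /d opprB addrC subrK expRK.
pose L := ln (d / r%:R).
have L0 : 0 < 1 + `|L| by rewrite ltr_wpDr.
have [l [c Hc]] := partition_approx m mxi (divr_gt0 e20 L0).
exists l => n Q Q0 Q1 mQ.
pose q (w : seq 'I_k.+1) (j : 'I_r) : R := if j == c w then 1 - d else d / r%:R.
have q0 w j : 0 < q w j by rewrite /q; case: ifP => // _; rewrite divr_gt0// ltr0n.
have q1 w : \sum_j q w j <= 1.
  rewrite (bigD1 (c w)) //= {1}/q eqxx.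
  rewrite (eq_bigr (fun=> d / r%:R)); last by move=> j /negPf jc; rewrite /q jc.
  have : \sum_(j < r | j != c w) d / r%:R <= \sum_(j < r) d / r%:R.
    by rewrite [leRHS](bigD1 (c w)) //= lerDr divr_ge0// ltW.
  rewrite [X in _ <= X -> _]sumr_const card_ord -[X in _ <= X -> _]mulr_natr.
  rewrite divfK ?pnatr_eq0 -?lt0n//; lra.
pose sub (w : seq 'I_k.+1) i := take l (drop i w).
pose Z x := (@itinerary r xi n x, @block_map k (n + l) x).
have mZ : fmeasurable Z.
  by apply: fmeasurable_pair; [exact: fmeasurable_itinerary|exact: fmeasurable_block].
have j0 : 'I_r := xi point.
pose Q' (z : n.-tuple 'I_r * (n + l).-tuple 'I_k.+1) :=
  Q z.2 * \prod_(i < n) q (sub z.2 i) (nth j0 z.1 i).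
have Q'1 : \sum_z Q' z <= 1.
  rewrite -(pair_bigA _ (fun v w => Q' (v, w))) /= exchange_big /=.
  apply: le_trans Q1; apply: ler_sum => w _; rewrite /Q' /= -mulr_sumr.
  rewrite ler_piMr //.
  by apply: (@tuple_prod_le1 _ n (fun i => q (sub w i)) j0) => [i j|i]; [exact: ltW|].
have Q'0 z : 0 <= Q' z by rewrite mulr_ge0// prodr_ge0// => i _; exact: ltW.
have Q'gt0 z : 0 < law m Z z -> 0 < Q' z.
  move=> Zz; rewrite mulr_gt0 ?prodr_gt0 // mQ // -law_block.
  by apply: lt_le_trans Zz _; exact: (law_comp_le m snd z mZ).
rewrite join_entropyE; apply: le_trans (law_entropy_le fst mZ Q'0 Q'1 Q'gt0) _.
have step z : law m Z z * ln (Q' z) = law m Z z * ln (Q z.2) +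
    \sum_(i < n) law m Z z * ln (q (sub z.2 i) (nth j0 z.1 i)).
  have [->|zN0] := eqVneq (law m Z z) 0.
    by rewrite !mul0r add0r big1 // => i _; rewrite mul0r.
  have /Q'gt0 : 0 < law m Z z by rewrite lt_neqAle eq_sym zN0 law_ge0.
  rewrite /Q' pmulr_lgt0 ?prodr_gt0// => Qz0.
  rewrite lnM ?posrE ?prodr_gt0// mulrDr -mulr_sumr ln_prod //.
under eq_bigr do rewrite step.
rewrite big_split /= exchange_big /= opprD.
rewrite -(law_expect_comp _ _ (fun w : (n + l).-tuple 'I_k.+1 => ln (Q w)) mZ).
rewrite lerD //.
  by rewrite lerN2; apply: ler_sum => w _; rewrite -law_block.
(* By stationarity the chance of a decoding error at position [i] is that at position 0, bounded by
   [Hc]. *)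
have term (i : 'I_n) :
  - (e) <= \sum_z law m Z z * ln (q (sub z.2 i) (nth j0 z.1 i)).
  pose W (x : T) := xi x == c (initial_block x l).
  have mW : fmeasurable W.
    have -> : W = (fun z : 'I_r * l.-tuple 'I_k.+1 => z.1 == c z.2) \o (fun x => (xi x, @block_map k l x)).
      by apply/funext => x; rewrite /W /= -block_mapE.
    by apply: fmeasurable_comp; apply: fmeasurable_pair => //; exact: fmeasurable_block.
  pose f (z : n.-tuple 'I_r * (n + l).-tuple 'I_k.+1) := nth j0 z.1 i == c (sub z.2 i).
  have fZ : f \o Z = W \o iter i sh.
    apply/funext => x.
    have xiE : nth j0 (@itinerary r xi n x) i = xi (iter i sh x).
      by rewrite -tnth_nth tnth_mktuple.
    have subE : sub (@block_map k (n + l) x) i = initial_block (iter i sh x) l.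
      rewrite /sub block_mapE.
      have -> : (n + l = i + (n - i + l))%N by have := ltn_ord i; lia.
      by rewrite initial_blockD drop_size_cat ?size_mkseq// take_initial_block ?leq_addl.
    by rewrite [LHS]/comp /f [(Z x).1]/= [(Z x).2]/= xiE subE.
  rewrite (_ : \sum_z _ = \sum_z law m Z z * (fun b : bool => ln (if b then 1 - d else d / r%:R)) (f z)) //.
  rewrite -(law_expect_comp m f (fun b : bool => ln (if b then 1 - d else d / r%:R)) mZ).
  rewrite fZ law_iter_shift // big_bool /= lnd -/L.
  have Wf : law m W false <= e / 2 / (1 + `|L|).
    rewrite (_ : law m W false = fine (m [set x | xi x != c (initial_block x l)])) //.
    rewrite /law; congr (fine (m _)); apply/seteqP; split=> x /=; rewrite /W; first by move=> ->.
    by move/negPf.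
  have Wt : law m W true <= 1.
    rewrite -(law_sum1 m mW) big_bool /= lerDl; exact: law_ge0.
  have Wf0 := law_ge0 m W false.
  have WL : law m W false * `|L| <= e / 2.
    have : law m W false * (1 + `|L|) <= e / 2 by rewrite -ler_pdivlMr.
    lra.
  have : - `|L| <= L by rewrite lerNl ler_normr lexx orbT.
  move=> /(ler_wpM2l Wf0) LL.
  have : law m W true * (e / 2) <= e / 2 by rewrite ler_piMl// ltW.
  lra.
rewrite -sumrN.
apply: (@le_trans _ _ (\sum_(i < n) e)).
  by apply: ler_sum => i _; rewrite lerNl.
by rewrite sumr_const card_ord mulr_natl.
Qed.

End entropy_bound.

(** [partition_entropy] is a formal limit. If the sequence converges, the bound passes to the limit;
    if it does not, [limn] takes its default value 0, and nonnegativity of [u] makes [a] at least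
    0. *)
Lemma limn_le_harmonic (R : realType) (u : nat -> R) (a : R) :
  (forall n, 0 <= u n) ->
  (forall e, 0 < e -> exists C N, forall n, (N <= n)%N -> (0 < n)%N ->
     u n <= a + e + C / n%:R) -> limn u <= a.
Proof.
move=> u0 ua.
have H e : 0 < e -> \forall n \near \oo, u n <= a + e.
  move=> e0; have [C [N HN]] := ua _ (divr_gt0 e0 (ltr0n R 2)).
  have [n0 Hn0] : exists n0 : nat, C / (e / 2) <= n0%:R.
    exists (Num.truncn `|C / (e / 2)|).+1.
    by apply: (le_trans (ler_norm _)); apply/ltW; exact: truncnS_gt.
  exists (maxn (maxn N n0) 1) => // n /=; rewrite !geq_max => /andP[/andP[Nn n0n] n1].
  apply: le_trans (HN _ Nn n1) _.
  have nR : 0 < n%:R :> R by rewrite ltr0n.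
  suff : C / n%:R <= e / 2 by lra.
  rewrite ler_pdivrMr // mulrC -ler_pdivrMr ?divr_gt0//.
  by apply: le_trans Hn0 _; rewrite ler_nat.
have [cu|du] := pselect (cvgn u).
  apply/ler_addgt0Pr => e e0; apply: limr_le => //; exact: H.
rewrite (dvgP du) /point /=; apply/ler_addgt0Pr => e /H[n _ /(_ n (leqnn n))].
exact: le_trans.
Qed.

Lemma word_expect_le (k : nat) (R : realType) (m : probability (fullshift k.+1) R)
    n (f : seq 'I_k.+1 -> R) (c : R) :
  (forall w, size w = n -> 0 < word_mass m w -> f w <= c) ->
  \sum_(w : n.-tuple 'I_k.+1) word_mass m w * f w <= c.
Proof.
move=> fc; rewrite -[leRHS]mulr1 -(word_mass_sum m n) mulr_sumr.
apply: ler_sum => w _; rewrite [leRHS]mulrC.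
have [->|wN0] := eqVneq (word_mass m w) 0; first by rewrite !mul0r.
have w0 : 0 < word_mass m w by rewrite lt_neqAle eq_sym wN0 word_mass_ge0.
by rewrite ler_pM2l// fc ?size_tuple.
Qed.

(** * Entropy bounded above by tilting and below by uniform word masses *)

Section entropy_rates.
Variables (k : nat) (R : realType).
Local Notation T := (fullshift k.+1).
Local Notation sh := (@shiftmap k.+1).
Variable m : probability T R.
Hypothesis mi : shift_invariant m.
Variables (lam K : R).

(** The tilted weights serve as [Q] in [join_entropy_upper]: the cross entropy against [M] grows at
    rate at most ln lam, and tilting lowers it by one window gain per letter. *)
Lemma entropy_le_window (M : seq 'I_k.+1 -> R) (u : seq 'I_k.+1) :
  (forall w, 0 <= M w) -> M [::] = 1 -> (forall w, M w = \sum_a M (rcons w a)) ->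
  (forall w, 0 < word_mass m w -> 0 < M w) -> 0 < word_mass m u ->
  (forall w a, M (w ++ rcons u a) * M u = M (w ++ u) * M (rcons u a)) ->
  (forall w, 0 < word_mass m w -> - ln (M w) <= (size w)%:R * ln lam + K) ->
  (entropy m sh <= (ln lam - window_gain m M u)%:E)%E.
Proof.
move=> M0 Mn Mr Md u0 ur MK; apply: ge_ereal_sup => _ [r [xi [mxi ->]]].
rewrite lee_fin; apply: limn_le_harmonic => [n|e e0].
  by rewrite mulr_ge0 ?invr_ge0// join_entropy_ge0.
have [l Hl] := join_entropy_upper mi mxi e0.
set W := window_gain m M u.
(* All terms of the entropy bound that do not grow with [n]; dividing by [n] makes them harmless. *)
exists (K + l%:R * ln lam - (l%:R - (size u)%:R) * W), (size u) => n un n0.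
have := Hl n (tilted_mass m M u) (fun w => tilted_mass_ge0 m M0 u w).
move=> /(_ (tilted_mass_sum M0 Mr u0 _)).
have tM w : 0 < word_mass m w -> 0 < tilted_mass m M u w.
  exact: tilted_mass_gt0.
move=> /(_ tM).
have : \sum_(w : (n + l).-tuple 'I_k.+1)
    word_mass m w * (ln (tilted_mass m M u w) - ln (M w)) =
    (n + l - size u)%:R * window_gain m M u.
  exact: ln_tilted_mass.
under eq_bigr do rewrite mulrBr.
rewrite sumrB -/W => /eqP; rewrite subr_eq => /eqP ->.
have MH : - (\sum_(w : (n + l).-tuple 'I_k.+1) word_mass m w * ln (M w)) <=
    (n + l)%:R * ln lam + K.
  rewrite -sumrN; under eq_bigr do rewrite -mulrN.
  apply: (word_expect_le (f := fun w => - ln (M w))) => w <-; exact: MK.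
have -> : (n + l - size u)%:R = n%:R + (l%:R - (size u)%:R) :> R.
  by rewrite natrB ?natrD ?addrA// (leq_trans un)// leq_addr.
rewrite natrD in MH => HH.
rewrite mulrC ler_pdivrMr ?ltr0n//.
rewrite [leRHS]mulrDl divfK ?pnatr_eq0 -?lt0n//.
lra.
Qed.

(** The partition by the coordinate 0 suffices: its itineraries are the blocks, and the entropy of
    n-blocks stays within [K] of n ln lam, an average of values that all do so. *)
Lemma entropy_ge_uniform :
  (forall w, 0 < word_mass m w ->
     `|- ln (word_mass m w) - (size w)%:R * ln lam| <= K) ->
  ((ln lam)%:E <= entropy m sh)%E.
Proof.
move=> HK; pose xi (x : T) : 'I_k.+1 := x 0%N.
have mxi : measurable_partition xi by exact: fmeasurable_coord.
apply: ereal_sup_ubound; exists k.+1, xi; split => //; congr EFin.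
rewrite /partition_entropy; apply/esym/cvg_lim => //.
have H n : `|join_entropy m sh xi n - n%:R * ln lam| <= K.
  rewrite join_entropyE (_ : @itinerary _ _ xi n = @block_map k n); last first.
    apply/funext => x; apply: eq_from_tnth => i; rewrite !tnth_mktuple /xi.
    by rewrite iter_shiftmap addn0.
  rewrite ler_norml -sumrN lerBrDr lerBlDr; apply/andP; split.
    rewrite -lerN2 -sumrN; under eq_bigr do rewrite opprK law_block.
    apply: (word_expect_le (f := fun w => ln (word_mass m w))) => w <- /HK.
    by rewrite ler_norml; lra.
  under eq_bigr do rewrite -mulrN law_block.
  apply: (word_expect_le (f := fun w => - ln (word_mass m w))) => w <- /HK.
  by rewrite ler_norml; lra.
apply/cvgrPdist_le => e e0.
have [n0 Hn0] : exists n0 : nat, K / e <= n0%:R.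
  by exists (Num.truncn (K / e)).+1; apply/ltW; exact: truncnS_gt.
exists n0.+1 => // n /= n0n.
have nR : 0 < n%:R :> R by rewrite ltr0n (leq_trans _ n0n).
have -> : ln lam - n%:R^-1 * join_entropy m sh xi n =
   - ((join_entropy m sh xi n - n%:R * ln lam) / n%:R).
  by rewrite mulrBl mulrAC divff ?gt_eqF//; ring.
rewrite normrN normrM normfV (ger0_norm (ltW nR)) ler_pdivrMr//.
apply: le_trans (H n) _; rewrite mulrC -ler_pdivrMr//; apply: le_trans Hn0 _.
by rewrite ler_nat ltnW.
Qed.

End entropy_rates.

(** * Measures from consistent word weights *)

Section word_measure.
Variables (k : nat) (R : realType).
Local Notation T := (fullshift k.+1).
Variable M : seq 'I_k.+1 -> R.
Hypothesis M_ge0 : forall w, 0 <= M w.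
Hypothesis M_nil : M [::] = 1.
Hypothesis M_rcons : forall w, M w = \sum_a M (rcons w a).

Let lsum w (j : nat) : R := \sum_(i < j) M (rcons w (inord i)).

Let lsum_all w : lsum w k.+1 = M w.
Proof.
by rewrite M_rcons; apply: eq_bigr => i _; rewrite inord_val.
Qed.

Let lsumS w (a : 'I_k.+1) : lsum w a.+1 = lsum w a + M (rcons w a).
Proof. by rewrite /lsum big_ord_recr /= inord_val. Qed.

Let lsum_homo w : {homo lsum w : i j / (i <= j)%N >-> i <= j}.
Proof.
by apply: homo_leq => // [?|i]; [exact: le_trans|rewrite /lsum big_ord_recr lerDl].
Qed.

(* The words of length n index consecutive subintervals of [0, 1[ of lengths M w,
   each subdivided by its one-letter extensions. *)
Let left w : R := \sum_(i < size w) lsum (take i w) (nth ord0 w i).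

Let left_rcons w a : left (rcons w a) = left w + lsum w a.
Proof.
rewrite /left size_rcons big_ord_recr /= nth_rcons ltnn eqxx.
rewrite -cats1 take_size_cat //; congr (_ + _).
by apply: eq_bigr => i _; rewrite nth_cat ltn_ord takel_cat // ltnW.
Qed.

Let cell w : set R := [set t | left w <= t < left w + M w].

Let letter t w : 'I_k.+1 := odflt ord0 [pick a | t \in cell (rcons w a)].

Let cellP w t : cell w t -> cell (rcons w (letter t w)) t.
Proof.
move=> /andP[wt tw]; rewrite /letter; case: pickP => [a /set_mem//|nocell].
suff H j : (j <= k.+1)%N -> left w + lsum w j <= t.
  by have := H _ (leqnn _); rewrite lsum_all leNgt tw.
elim: j => [|j IHj] jk; first by rewrite /lsum big_ord0 addr0.
have {}IHj := IHj (ltnW jk).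
have nc : ~ cell (rcons w (Ordinal jk)) t by move=> /mem_set; rewrite nocell.
rewrite leNgt; apply/negP => jt; apply: nc.
by rewrite /cell /= left_rcons -addrA -lsumS /= IHj.
Qed.

Let cell_rcons w a t : cell (rcons w a) t -> cell w t.
Proof.
rewrite /cell /= left_rcons -addrA -lsumS => /andP[wt tw]; apply/andP; split.
  by apply: le_trans wt; rewrite lerDl sumr_ge0.
by apply: lt_le_trans tw _; rewrite lerD2l -lsum_all lsum_homo.
Qed.

Let cell_inj w a b t : cell (rcons w a) t -> cell (rcons w b) t -> a = b.
Proof.
rewrite /cell /= !left_rcons -!addrA -!lsumS => /andP[wa aw] /andP[wb bw].
apply: val_inj; apply/eqP; rewrite eqn_leq; apply/andP; split; rewrite leqNgt; apply/negP => ab.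
  have := lsum_homo w ab; lra.
have := lsum_homo w ab; lra.
Qed.

Let code t : nat -> seq 'I_k.+1 := fix code n :=
  if n is n'.+1 then rcons (code n') (letter t (code n')) else [::].

Let cell_code t n : 0 <= t < 1 -> cell (code t n) t.
Proof.
move=> t01; elim: n => /= [|n /cellP//].
by rewrite /cell /left /= big_ord0 M_nil add0r.
Qed.

Let cell_codeE t w : 0 <= t < 1 -> (code t (size w) = w) <-> cell w t.
Proof.
move=> t01; split=> [<-|]; first exact: cell_code.
elim/last_ind: w => // w a IHw wa; rewrite size_rcons /=.
have wt := cell_rcons wa.
rewrite IHw //; congr rcons; apply: cell_inj wa.
by apply: cellP.
Qed.

(** Off the unit interval the value is a constant sequence, which keeps the map total and measurable
    without affecting its law. *)
Let point_of (t : R) : T := fun i => if 0 <= t < 1 then letter t (code t i) else ord0.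

Let block_point_of t n : 0 <= t < 1 -> initial_block (point_of t) n = code t n.
Proof.
move=> t01; elim: n => // n IHn.
by rewrite initial_blockS IHn /point_of t01.
Qed.

Let cell_itv w : cell w = [set` `[left w, left w + M w[].
Proof. by apply/seteqP; split=> t; rewrite /cell /= in_itv. Qed.

Let cell_sub w t : cell w t -> 0 <= t < 1.
Proof.
elim/last_ind: w => [|w a IHw /cell_rcons//].
by rewrite /cell /left /= big_ord0 M_nil add0r.
Qed.

Let unit_itv : set R := `[0, 1[%classic.

Let unit_itvE t : unit_itv t = (0 <= t < 1) :> Prop.
Proof. by rewrite /unit_itv /= in_itv. Qed.

Let preimage_point_of w :
  point_of @^-1` [set x | initial_block x (size w) = w] `&` unit_itv = cell w.
Proof.
apply/seteqP; split=> t; rewrite /setI /= unit_itvE.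
  by move=> [+ t01]; rewrite block_point_of // => /(cell_codeE w t01).
move=> wt; have t01 := cell_sub wt; split => //.
by rewrite block_point_of //; apply/cell_codeE.
Qed.

Let measurable_point_of : measurable_fun [set: measurableTypeR R] point_of.
Proof.
apply: (measurability (@block_sets k)).
  by rewrite -measurable_block_sets.
move=> _ [_ [w ->] <-]; rewrite setTI.
rewrite -(setIT (_ @^-1` _)) -(setUv unit_itv) setIUr preimage_point_of.
apply: measurableU; first by rewrite cell_itv; exact: measurable_itv.
case: (pselect (initial_block ((fun=> ord0) : T) (size w) = w)) => w0.
  rewrite (_ : _ `&` _ = ~` unit_itv).
    by apply: measurableC; exact: measurable_itv.
  apply/seteqP; split=> [t []//|t ut]; split => //.
  move: ut; rewrite /setC /= unit_itvE => t01.
  rewrite -[RHS]w0; apply/initial_blockP => i _; rewrite /point_of.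
  by case: ifPn.
rewrite (_ : _ `&` _ = set0); first exact: measurable0.
rewrite -subset0 => t [/= tw]; rewrite /setC /= unit_itvE => t01; apply: w0.
rewrite -[RHS]tw; apply/initial_blockP => i _; rewrite /point_of.
by case: ifPn.
Qed.

(** The measure is the image of Lebesgue measure on [0, 1[ under the coding [point_of]: the preimage
    of a cylinder is a cell, an interval of length [M w]. Normalisation divides by 1 and only
    packages a probability. *)
Lemma word_measure_exists :
  exists m : probability T R, forall w, word_mass m w = M w.
Proof.
have mU : measurable (unit_itv : set (measurableTypeR R)) by exact: measurable_itv.
pose P := mnormalize (mrestr (@lebesgue_measure R) mU) (dirac (0 : measurableTypeR R)).
have P_E A : P A = lebesgue_measure (A `&` unit_itv).
  have e1 : mrestr (@lebesgue_measure R) mU setT = 1%E.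
    rewrite /mrestr setTI /unit_itv lebesgue_measure_itv /= lte_fin ltr01.
    by rewrite sube0.
  by rewrite /P /mnormalize /= e1 ifF ?invr1 ?mule1 //= onee_eq0.
pose X : {mfun measurableTypeR R >-> T} := HB.pack point_of
  (isMeasurableFun.Build _ _ (measurableTypeR R) T point_of measurable_point_of).
exists (distribution P X) => w.
transitivity (fine (lebesgue_measure (cell w : set R))).
  by rewrite -(preimage_point_of w) -P_E.
rewrite cell_itv lebesgue_measure_itv /= lte_fin ltrDl.
case: ifPn => [_|]; first by rewrite -EFinB /= addrAC subrr add0r.
by rewrite -leNgt => Mw; apply/esym/eqP; rewrite eq_le Mw M_ge0.
Qed.

End word_measure.

(** * Perron-Frobenius eigenvectors *)

Section perron_frobenius.
Variables (R : realType) (n : nat).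
Variables (A : rel 'I_n.+1) (V : pred 'I_n.+1) (v0 : 'I_n.+1).
Implicit Types (r s : 'I_n.+1 -> R) (t : R).
Hypothesis AV : forall i j, A i j -> V i && V j.
Hypothesis A_connect : forall i j, V i -> V j -> connect A i j.
Hypothesis A_succ : forall i, V i -> exists j, A i j.
Hypothesis V_v0 : V v0.

Let app r i : R := \sum_(j | A i j) r j.

Let feasible t r := forall i, V i -> app r i <= t * r i.

Let positive r := forall i, V i -> 0 < r i.

Let N : R := n.+1%:R.

Let N_ge1 : 1 <= N. Proof. by rewrite ler1n. Qed.

Let feasible_edge t r i j : positive r -> feasible t r -> A i j -> r j <= t * r i.
Proof.
move=> r0 rt Aij; have /andP[Vi Vj] := AV Aij.
apply: le_trans (rt i Vi); rewrite /app (bigD1 j) //= lerDl.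
by apply: sumr_ge0 => l /andP[/AV/andP[_ Vl] _]; exact/ltW/r0.
Qed.

(** Along an edge an entry of a feasible vector grows at most by the factor [N], so along a path of
    length d by N^d. The bound is uniform in [t] and [r], and thus confines normalised feasible
    vectors to a compact box away from 0. *)
Let harnack : exists2 M : R, 0 < M & forall t r, positive r -> t <= N -> feasible t r ->
  forall i j, V i -> V j -> r j <= M * r i.
Proof.
have dist i j : exists d : nat, V i -> V j -> forall t r, positive r -> t <= N ->
    feasible t r -> r j <= N ^+ d * r i.
  have [/andP[Vi Vj]|nV] := boolP (V i && V j); last first.
    by exists 0%N => Vi Vj; move: nV; rewrite Vi Vj.
  have /connectP[p pi ->] := A_connect Vi Vj.
  exists (size p) => _ _ t r r0 tN rt {Vj}.
  elim: p i Vi pi => [|l p IHp] i Vi /=; first by rewrite expr0 mul1r.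
  move=> /andP[Ail pl]; have /andP[_ Vl] := AV Ail.
  apply: le_trans (IHp l Vl pl) _; rewrite exprSr -mulrA ler_pM2l; last first.
    by rewrite exprn_gt0// (lt_le_trans ltr01).
  apply: le_trans (feasible_edge r0 rt Ail) _.
  by rewrite ler_wpM2r// ltW// r0.
have /choice[d Hd] : forall ij : 'I_n.+1 * 'I_n.+1, exists d : nat,
    V ij.1 -> V ij.2 -> forall t r, positive r -> t <= N ->
    feasible t r -> r ij.2 <= N ^+ d * r ij.1.
  by case=> i j; exact: dist.
exists (N ^+ (\max_ij d ij)); first by rewrite exprn_gt0// (lt_le_trans ltr01).
move=> t r r0 tN rt i j Vi Vj; apply: le_trans (Hd (i, j) Vi Vj t r r0 tN rt) _.
rewrite /= ler_wpM2r ?(ltW (r0 _ Vi))// ler_weXn2l//.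
exact: leq_bigmax.
Qed.

Let app_gt0 r i : positive r -> V i -> 0 < app r i.
Proof.
move=> r0 /A_succ[j Aij]; rewrite /app (bigD1 j) //=.
apply: ltr_pwDl; first by have /andP[_ /r0] := AV Aij.
by apply: sumr_ge0 => l /andP[/AV/andP[_ /r0/ltW]].
Qed.

Let feasible_gt0 t r : positive r -> feasible t r -> 0 < t.
Proof.
move=> r0 rt; have := lt_le_trans (app_gt0 r0 V_v0) (rt _ V_v0).
by rewrite pmulr_lgt0// r0.
Qed.

(** The Collatz-Wielandt characterisation of the Perron eigenvalue: minimise [t] over pairs (t, r)
    in a compact box, which by [harnack] loses no candidate with t <= N. The constant vector 1 shows
    that [N] itself is feasible. *)
Let minimal_feasible : exists lam r, [/\ positive r, feasible lam r &
  forall t s, positive s -> feasible t s -> lam <= t].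
Proof.
have [M M0 HM] := harnack.
(* A row vector encodes a pair: entry 0 is [t], the others are [r]. Entries outside [V] are set to 1
   when a candidate is moved into the box. *)
pose box (i : 'I_n.+2) : set R := if unlift ord0 i is Some j
  then `[M^-1, M]%classic else `[0, N]%classic.
pose F : set 'rV[R]_n.+2 := [set x | forall i, box i (x ord0 i)].
pose rv (x : 'rV[R]_n.+2) (i : 'I_n.+1) : R := x ord0 (lift ord0 i).
pose G : set 'rV[R]_n.+2 := [set x : 'rV[R]_n.+2 | feasible (x ord0 ord0) (rv x)].
have cF : compact F.
  apply: rV_compact => i; rewrite /box.
  by case: unliftP => [j _|_]; exact: segment_compact.
have cG : closed G.
  have -> : G = \bigcap_(i in [set i | V i])
      ((fun x : 'rV[R]_n.+2 => x ord0 ord0 * rv x i - app (rv x) i) @^-1` [set y | 0 <= y]).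
    by apply/seteqP; split=> x xG i /xG /=; rewrite subr_ge0.
  apply: closed_bigI => i Vi.
  have /continuous_closedP : continuous (fun x : 'rV[R]_n.+2 =>
      x ord0 ord0 * rv x i - app (rv x) i); last by apply; exact: closed_ge.
  have c0 : continuous (fun x : 'rV[R]_n.+2 => x ord0 ord0).
    exact: matrix_normedtype.coord_continuous.
  have cr j : continuous (fun x : 'rV[R]_n.+2 => rv x j).
    exact: matrix_normedtype.coord_continuous.
  move=> x; apply: (cvgB (cvgM (c0 x) (cr i x))).
  rewrite /app; apply: cvg_big => [|j _]; last exact: cr.
  exact: add_continuous.
have cFG := compact_closedI cF cG.
have pos x : F x -> positive (rv x).
  move=> Fx i _; have := Fx (lift ord0 i); rewrite /box liftK /= in_itv /=.
  by move=> /andP[+ _]; apply: lt_le_trans; rewrite invr_gt0.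
have inFG t s : positive s -> t <= N -> feasible t s ->
    exists2 x, (F `&` G) x & x ord0 ord0 = t.
  move=> s0 tN st; have t0 := feasible_gt0 s0 st.
  pose x : 'rV[R]_n.+2 := \row_i if unlift ord0 i is Some j
    then (if V j then s j / s v0 else 1) else t.
  have x0 : x ord0 ord0 = t by rewrite mxE unlift_none.
  have xj j : x ord0 (lift ord0 j) = if V j then s j / s v0 else 1.
    by rewrite mxE liftK.
  have M1 : 1 <= M.
    by have := HM _ _ s0 tN st _ _ V_v0 V_v0; rewrite -ler_pdivrMr ?s0// divff// gt_eqF// s0.
  exists x => //; split.
    move=> i; rewrite /box; case: unliftP => [j ->|->]; last first.
      by rewrite x0 /= in_itv /= ltW.
    rewrite xj /= in_itv /=; case: ifPn => Vj; last by rewrite M1 invf_le1// M1.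
    have [sj s0'] := (s0 _ Vj, s0 _ V_v0).
    have HMs := HM _ _ s0 tN st.
    by rewrite ler_pdivlMr// ler_pdivrMl// ler_pdivrMr// !HMs.
  move=> i Vi; rewrite x0 /rv xj Vi /app.
  rewrite (eq_bigr (fun j => s j / s v0)); last first.
    by move=> j /AV/andP[_ Vj]; rewrite xj Vj.
  by rewrite -mulr_suml mulrA ler_pM2r ?invr_gt0 ?s0//; exact: st.
have [x0 [F0 G0]] : F `&` G !=set0.
  have [//|i Vi|x xFG _] := inFG N (fun=> 1) _ (lexx _); last by exists x.
  by rewrite /app mulr1 sumr_const ler_nat -[leqRHS]card_ord max_card.
have cc : {within F `&` G, continuous (fun x : 'rV[R]_n.+2 => x ord0 ord0)}.
  by apply: continuous_subspaceT => x; exact: matrix_normedtype.coord_continuous.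
have [c /set_mem[Fc Gc] cmin] := compact_EVT_min (ex_intro _ x0 (conj F0 G0)) cFG cc.
exists (c ord0 ord0), (rv c); split => // [|t s s0 st]; first exact: pos.
have [tN|/ltW Nt] := leP t N.
  by have [x xFG <-] := inFG _ _ s0 tN st; apply: cmin; exact: mem_set.
apply: le_trans Nt; have := Fc ord0; rewrite /box unlift_none /= in_itv /=.
by case/andP.
Qed.

(** If A r = lam r failed at one index, applying I + A repeatedly would carry the strict inequality
    backwards along paths to every index of [V]; then some t < lam would be feasible, against
    minimality. *)
Lemma perron : exists lam r, [/\ 0 < lam, (forall i, V i -> 0 < r i) &
  forall i, V i -> \sum_(j | A i j) r j = lam * r i].
Proof.
have [lam [r [r0 rl rmin]]] := minimal_feasible.
have lam0 := feasible_gt0 r0 rl.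
exists lam, r; split => // i0 Vi0; apply/eqP; apply: contraT => neq.
have s0 : app r i0 < lam * r i0 by rewrite lt_neqAle neq rl.
pose S r i := r i + app r i.
have S_pos s : positive s -> positive (S s).
  by move=> s0' i Vi; rewrite addr_gt0 ?app_gt0 ?s0'.
have defect s i : lam * S s i - app (S s) i =
    (lam * s i - app s i) + \sum_(j | A i j) (lam * s j - app s j).
  rewrite /S {2}/app big_split /= -/(app s i) -/(app (app s) i) sumrB -mulr_sumr.
  rewrite -/(app s i) -/(app (app s) i); ring.
have S_feas s : positive s -> feasible lam s -> feasible lam (S s).
  move=> s0' sl i Vi; rewrite -subr_ge0 defect addr_ge0 ?subr_ge0 ?sl//.
  by apply: sumr_ge0 => j /AV/andP[_ Vj]; rewrite subr_ge0 sl.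
pose it d := iter d S r.
have itP d : positive (it d) /\ feasible lam (it d).
  by elim: d => [//|d [p f]]; split; [exact: S_pos|exact: S_feas].
have it_mono d d' i : (d <= d')%N -> V i ->
    app (it d) i < lam * it d i -> app (it d') i < lam * it d' i.
  move=> dd' Vi; rewrite -(subnK dd'); elim: (d' - d)%N => // l IHl /IHl {}IHl.
  rewrite addSn /= -subr_gt0 defect ltr_pwDl ?subr_gt0//.
  by apply: sumr_ge0 => j /AV/andP[_ Vj]; rewrite subr_ge0; have [_ ->] := itP (l + d)%N.
have strict i : exists d, V i -> app (it d) i < lam * it d i.
  have [Vi|nV] := boolP (V i); last by exists 0%N.
  have /connectP[p] := A_connect Vi Vi0.
  elim: p i Vi => [|l p IHp] i Vi /= => [_ <-|/andP[Ail pl] pE]; first by exists 0%N.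
  have /andP[_ Vl] := AV Ail; have [d Hd] := IHp l Vl pl pE.
  exists d.+1 => _; rewrite /= -subr_gt0 defect ltr_wpDl ?subr_ge0; first by [].
    by have [_ ->] := itP d.
  rewrite (bigD1 l) //= ltr_pwDl ?subr_gt0 ?Hd//.
  by apply: sumr_ge0 => j /andP[/AV/andP[_ Vj] _]; rewrite subr_ge0; have [_ ->] := itP d.
have [d Hd] := choice strict.
pose D := \max_i d i; have [pD fD] := itP D.
have strictD i : V i -> app (it D) i < lam * it D i.
  by move=> Vi; apply: it_mono (Hd i Vi) => //; exact: leq_bigmax.
(* The least factor feasible for [it D]; as a maximum of finitely many ratios below [lam] it is
   itself below [lam]. *)
pose t := \big[Order.max/0]_(i | V i) (app (it D) i / it D i).
have tlam : t < lam by apply: bigmax_lt => // i Vi; rewrite ltr_pdivrMr ?strictD// pD.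
suff : lam <= t by rewrite leNgt tlam.
apply: (rmin _ (it D)) => // i Vi; rewrite -ler_pdivrMr ?pD//.
exact: (le_bigmax_cond 0 (fun i => app (it D) i / it D i) Vi).
Qed.

End perron_frobenius.

(** * Shifts of finite type *)

Section sft_blocks.
Variables (k : nat) (A : 'M[bool]_k.+1).
Local Notation T := (fullshift k.+1).
Local Notation sh := (@shiftmap k.+1).
Local Notation X := (sft A).
Hypothesis X_irr : irreducible X.

Definition occurs (i : 'I_k.+1) : bool := `[< block X [:: i] >].

(** Stranded symbols are removed, so that every path in this graph extends to a point of X; [A]
    alone may admit words that are not blocks. *)
Definition edge (i j : 'I_k.+1) : bool := [&& A i j, occurs i & occurs j].

Lemma sft_iter_shift n x : X x -> X (iter n sh x).
Proof. by move=> Xx i; rewrite !iter_shiftmap addnS; exact: Xx. Qed.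

Lemma sft_blockP w : block X w <-> exists2 x, X x & initial_block x (size w) = w.
Proof.
split=> [[x Xx [i wE]]|[x Xx xw]].
  by exists (iter i sh x); [exact: sft_iter_shift|rewrite -wE].
by exists x => //; exists 0%N.
Qed.

Lemma occurs_coord x n : X x -> occurs (x n).
Proof.
move=> Xx; apply/asboolP; exists x => //; exists n.
by rewrite /initial_block /mkseq /= iter_shiftmap addn0.
Qed.

Lemma edge_coord x n : X x -> edge (x n) (x n.+1).
Proof. by move=> Xx; rewrite /edge Xx !occurs_coord. Qed.

Lemma sft_block_path i v : block X (i :: v) <-> occurs i && path edge i v.
Proof.
split=> [/sft_blockP[x Xx xE]|].
  have [x0 xv] : x 0%N = i /\ initial_block (sh x) (size v) = v.
    by move: xE; rewrite /= initial_blockSl => -[].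
  rewrite -x0 occurs_coord //= -xv; elim: (size v) x Xx {xE x0 xv} => // n IHn x Xx.
  rewrite initial_blockSl /= edge_coord //=.
  by apply: IHn; exact: (sft_iter_shift 1).
elim: v i => [|j v IHv] i /=; first by rewrite andbT => /asboolP.
move=> /and3P[_ /and3P[Aij _ oj] jv].
have /sft_blockP[x Xx xE] : block X (j :: v) by apply: IHv; rewrite oj.
apply/sft_blockP; exists (fun n => if n is n'.+1 then x n' else i) => [[|n]|] //=.
  by move: xE; rewrite /= initial_blockSl => -[-> _].
by rewrite initial_blockSl; congr (_ :: _); rewrite -[RHS]xE.
Qed.

Lemma edge_occurs i j : edge i j -> occurs i && occurs j.
Proof. by case/and3P => _ -> ->. Qed.

(** The path has at least one edge even when i = j, which yields successors and predecessors. *)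
Lemma edge_path_ex i j : occurs i -> occurs j ->
  exists v, path edge i (rcons v j).
Proof.
move=> /asboolP oi /asboolP oj; have [w _ bw] := X_irr oi oj.
exists w; have /sft_block_path/andP[_] : block X (i :: rcons w j).
  by rewrite -cats1.
by [].
Qed.

Lemma edge_connect i j : occurs i -> occurs j -> connect edge i j.
Proof.
move=> oi oj; have [v vp] := edge_path_ex oi oj.
by apply/connectP; exists (rcons v j) => //; rewrite last_rcons.
Qed.

Lemma edge_succ i : occurs i -> exists j, edge i j.
Proof.
move=> oi; have [[|j v] /=] := edge_path_ex oi oi.
  by rewrite andbT => ?; exists i.
by move=> /andP[ij _]; exists j.
Qed.

Lemma edge_pred i : occurs i -> exists j, edge j i.
Proof.
move=> oi; have [v] := edge_path_ex oi oi.
by rewrite rcons_path => /andP[_ ?]; exists (last i v).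
Qed.

Lemma path_edge_occurs i v : occurs i -> path edge i v -> occurs (last i v).
Proof.
elim: v i => //= j v IHv i oi /andP[/edge_occurs/andP[_ oj]]; exact: IHv.
Qed.

Lemma sft_closed : closed (X : set T).
Proof.
have -> : X = \bigcap_n ~` (\bigcup_(ij in [set ij : 'I_k.+1 * 'I_k.+1 | ~~ A ij.1 ij.2])
   ([set x : T | x n = ij.1] `&` [set x : T | x n.+1 = ij.2])).
  apply/seteqP; split=> [x Xx n _ [[i j] /= nA [xi xj]]|x H n].
    by move: nA; rewrite -xi -xj Xx.
  apply: contrapT => /negP nA; apply: (H n I).
  by exists (x n, x n.+1).
apply: closed_bigI => n _; apply: open_closedC.
by apply: bigcup_open => ij _; apply: openI; exact: coord_open.
Qed.

Lemma sft_measurable : measurable (X : set T).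
Proof.
rewrite -[X in measurable X]setCK; apply: measurableC.
by apply: open_measurable_shift; rewrite openC; exact: sft_closed.
Qed.

Lemma word_mass_block (R : realType) (m : probability T R) w :
  m X = 1%E -> 0 < word_mass m w -> block X w.
Proof.
move=> mX w0; apply: contrapT => nbw.
suff : word_mass m w = 0 by move=> w0'; rewrite w0' ltxx in w0.
have mXc : m (~` X) = 0%E.
  by rewrite probability_setC ?mX ?subee//; exact: sft_measurable.
rewrite /word_mass (@subset_measure0 _ _ _ m _ (~` X)) //.
- exact: block_measurable.
- by apply: measurableC; exact: sft_measurable.
- by move=> x /= xw Xx; apply: nbw; apply/sft_blockP; exists x.
Qed.

End sft_blocks.

Section shift_invariance_criterion.
Variables (k : nat) (R : realType) (m : probability (fullshift k.+1) R).
Local Notation T := (fullshift k.+1).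
Local Notation sh := (@shiftmap k.+1).

Lemma shift_invariant_word_mass :
  (forall w, word_mass m w = \sum_a word_mass m (a :: w)) -> shift_invariant m.
Proof.
move=> mc.
pose S : {mfun T >-> T} := HB.pack sh (isMeasurableFun.Build _ _ T T sh (@measurable_shift k)).
suff H : forall B, measurable B -> distribution m S B = m B by [].
apply: eq_measure_block => w.
rewrite [RHS]word_massEfin mc.
transitivity (m (\bigcup_(a in [set` (predT : pred 'I_k.+1)])
    [set x | initial_block x (size (a :: w)) = a :: w])).
  congr (m _); apply/seteqP; split=> x /=.
    by move=> xw; exists (x 0%N) => //=; rewrite initial_blockSl xw.
  by move=> [a _]; rewrite /= initial_blockSl => -[].
rewrite measure_fin_bigcup //; last 2 first.
- apply/trivIsetP => a b _ _ ab; rewrite -subset0 => x /= [xa xb].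
  by move: xa; rewrite /= xb => -[/esym/eqP]; rewrite (negPf ab).
- by move=> a _; exact: block_measurable.
rewrite -(bigfs _ (index_enum_uniq _)); last by move=> z _; rewrite mem_index_enum.
by rewrite -sumEFin; apply: eq_bigr => a _; exact: word_massEfin.
Qed.

End shift_invariance_criterion.

(** * The Parry measure *)

Section parry_measure.
Variables (k : nat) (R : realType) (A : 'M[bool]_k.+1).
Local Notation T := (fullshift k.+1).
Local Notation sh := (@shiftmap k.+1).
Local Notation X := (sft A).
Local Notation E := (edge A).
Local Notation occ := (occurs A).
Hypothesis X_irr : irreducible X.
Hypothesis X_ne : X !=set0.

Lemma occurs_ex : exists i, occ i.
Proof. by have [x Xx] := X_ne; exists (x 0%N); exact: occurs_coord. Qed.

(** The left eigenvector is a right eigenvector of the reversed graph. Both eigenvalues agree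
    because evaluating the pairing of l with A r in two ways gives lam and lam' times the same
    positive number. *)
Lemma edge_eigenvectors : exists lam (r l : 'I_k.+1 -> R),
  [/\ 0 < lam, (forall i, occ i -> 0 < r i) /\ (forall i, occ i -> 0 < l i),
    forall i, occ i -> \sum_(j | E i j) r j = lam * r i &
    forall j, occ j -> \sum_(i | E i j) l i = lam * l j].
Proof.
have [v0 ov0] := occurs_ex.
have [lam [r [lam0 r0 rE]]] := perron R (@edge_occurs _ A) (edge_connect X_irr)
  (edge_succ X_irr) ov0.
pose E' := [rel i j | E j i].
have E'occ i j : E' i j -> occ i && occ j by rewrite andbC; exact: edge_occurs.
have E'conn i j : occ i -> occ j -> connect E' i j.
  by move=> oi oj; rewrite connect_rev; exact: edge_connect.
have [lam' [l [lam'0 l0 lE]]] := perron R E'occ E'conn (edge_pred X_irr) ov0.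
have lamE : lam = lam'.
  have S0 : 0 < \sum_(i | occ i) l i * r i.
    rewrite (bigD1 v0) //= ltr_pwDl ?mulr_gt0 ?l0 ?r0//.
    by apply: sumr_ge0 => i /andP[oi _]; rewrite mulr_ge0// ltW ?l0 ?r0.
  apply: (mulIf (lt0r_neq0 S0)); rewrite !mulr_sumr.
  transitivity (\sum_(i | occ i) \sum_(j | occ j) (if E i j then l i * r j else 0)).
    apply: eq_bigr => i oi; rewrite mulrCA -rE // mulr_sumr -big_mkcondr /=.
    by apply: eq_bigl => j; case: (boolP (E i j)) => [/edge_occurs/andP[_ ->]|]; rewrite ?andbF.
  rewrite exchange_big /=; apply: eq_bigr => j oj; rewrite mulrA -lE // mulr_suml.
  rewrite -big_mkcondr /=.
  by apply: eq_bigl => i /=; case: (boolP (E i j)) => [/edge_occurs/andP[-> _]|]; rewrite ?andbF.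
by exists lam, r, l; split => // j oj; rewrite lamE -lE.
Qed.

Variables (lam : R) (r l : 'I_k.+1 -> R).
Hypotheses (lam_gt0 : 0 < lam) (r_gt0 : forall i, occ i -> 0 < r i)
  (l_gt0 : forall i, occ i -> 0 < l i)
  (rE : forall i, occ i -> \sum_(j | E i j) r j = lam * r i)
  (lE : forall j, occ j -> \sum_(i | E i j) l i = lam * l j).

Let Z := \sum_(i | occ i) l i * r i.

Let Z_gt0 : 0 < Z.
Proof.
have [v0 ov0] := occurs_ex; rewrite /Z (bigD1 v0) //= ltr_pwDl ?mulr_gt0 ?l_gt0 ?r_gt0//.
by apply: sumr_ge0 => i /andP[oi _]; rewrite mulr_ge0// ltW ?l_gt0 ?r_gt0.
Qed.

Definition parry_mass (w : seq 'I_k.+1) : R := if w is i :: v then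
  if occ i && path E i v then l i * r (last i v) / (Z * lam ^+ size v) else 0
  else 1.

Lemma parry_mass_ge0 w : 0 <= parry_mass w.
Proof.
case: w => //= i v; case: ifP => // /andP[oi iv].
have ov := path_edge_occurs oi iv.
by rewrite divr_ge0 ?mulr_ge0 ?exprn_ge0// ltW ?l_gt0 ?r_gt0.
Qed.

Lemma parry_mass_gt0 w : block X w -> 0 < parry_mass w.
Proof.
case: w => //= i v /sft_block_path /[dup] /andP[oi iv] ->.
have ov := path_edge_occurs oi iv.
by rewrite divr_gt0 ?mulr_gt0 ?exprn_gt0 ?l_gt0 ?r_gt0.
Qed.

Lemma parry_mass_eq0 w : ~ block X w -> parry_mass w = 0.
Proof.
case: w => [[]|i v nb] /=; last by rewrite ifN //; apply/negP => /sft_block_path.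
by have [x Xx] := X_ne; exists x => //; exists 0%N.
Qed.

Lemma parry_mass_rcons w : parry_mass w = \sum_a parry_mass (rcons w a).
Proof.
case: w => [|i v] /=.
  under eq_bigr do rewrite andbT expr0 mulr1 /=.
  by rewrite -big_mkcond /= -mulr_suml divff// gt_eqF.
under eq_bigr do rewrite rcons_path andbA last_rcons size_rcons.
case: ifPn => [/andP[oi iv]|_]; last by rewrite big1.
have ov := path_edge_occurs oi iv.
rewrite -big_mkcond /= -mulr_suml -mulr_sumr rE // exprSr.
have := lt0r_neq0 Z_gt0; have := lt0r_neq0 lam_gt0 => l0 z0; field.
by rewrite z0 l0 expf_neq0.
Qed.

Lemma parry_mass_cons w : parry_mass w = \sum_a parry_mass (a :: w).
Proof.
case: w => [|i v]; first by rewrite [LHS](parry_mass_rcons [::]).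
rewrite /parry_mass /=.
have [oi|noi] := boolP (occ i); last first.
  rewrite big1 // => a _; rewrite ifN //.
  by apply: contra noi => /and3P[_ /edge_occurs/andP[]].
case: (boolP (path E i v)) => iv /=; last by rewrite big1 // => a _; rewrite !andbF.
transitivity (\sum_(a | E a i) l a * r (last i v) / (Z * lam ^+ (size v).+1)).
  rewrite -!mulr_suml lE // exprSr.
  have := lt0r_neq0 Z_gt0; have := lt0r_neq0 lam_gt0 => l0 z0; field.
  by rewrite z0 l0 expf_neq0.
rewrite big_mkcond; apply: eq_bigr => a _; rewrite andbT.
by case: ifPn => [/edge_occurs/andP[-> _]|_]; rewrite ?andbF.
Qed.

Lemma parry_mass_transition i v a :
  parry_mass (rcons (i :: v) a) = parry_mass (i :: v) *
  (if E (last i v) a then r a / (r (last i v) * lam) else 0).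
Proof.
rewrite /= rcons_path andbA last_rcons size_rcons.
case: (boolP (occ i && path E i v)) => /= [/andP[oi iv]|]; last by rewrite mul0r.
have /r_gt0/lt0r_neq0 r0 := path_edge_occurs oi iv.
case: ifPn => _; last by rewrite mulr0.
have := lt0r_neq0 Z_gt0; have := lt0r_neq0 lam_gt0 => l0 z0; rewrite exprSr; field.
by rewrite z0 l0 r0 expf_neq0.
Qed.

(** The Markov property: the next transition depends on the last letter only, so every nonempty word
    can serve as the word [u] of a tilting. *)
Lemma parry_mass_renewal i v (w : seq 'I_k.+1) a :
  parry_mass (w ++ rcons (i :: v) a) * parry_mass (i :: v) =
  parry_mass (w ++ i :: v) * parry_mass (rcons (i :: v) a).
Proof.
case: w => [|j w]; first by rewrite /= mulrC.
have -> : (j :: w) ++ rcons (i :: v) a = rcons (j :: (w ++ i :: v)) a.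
  by rewrite /= rcons_cat.
by rewrite !parry_mass_transition last_cat [last _ (i :: v)]/=; ring.
Qed.

Let Kp : R := \sum_i `|ln (l i)| + \sum_i `|ln (r i)| + `|ln Z| + `|ln lam|.

(** The mass is lam^(-n) times a factor depending only on the end letters, hence the constant [Kp]
    independent of the length. *)
Lemma parry_mass_ln w : block X w ->
  `|- ln (parry_mass w) - (size w)%:R * ln lam| <= Kp.
Proof.
case: w => [_|i v bw].
  rewrite /= ln1 mul0r subr0 oppr0 normr0 !addr_ge0// sumr_ge0//.
have /sft_block_path /andP[oi iv] := bw.
have ov := path_edge_occurs oi iv.
rewrite /= oi iv /=.
have [l0 [r0 r0']] := (l_gt0 oi, (r_gt0 oi, r_gt0 ov)).
rewrite ln_div ?posrE ?mulr_gt0 ?exprn_gt0// !lnM ?posrE ?exprn_gt0// lnXn//.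
have Hs (f : 'I_k.+1 -> R) j : `|f j| <= \sum_i `|f i|.
  by rewrite (bigD1 j) //= lerDl sumr_ge0.
have H3 := Hs (fun i => ln (l i)) i; have H1 := Hs (fun i => ln (r i)) (last i v).
rewrite /Kp -[(size v).+1%:R]natr1 -[ln lam *+ _]mulr_natl /=.
have -> : - (ln (l i) + ln (r (last i v)) - (ln Z + (size v)%:R * ln lam)) -
   ((size v)%:R + 1) * ln lam = - ln (l i) + (- ln (r (last i v)) + (ln Z - ln lam)).
  ring.
rewrite -(normrN (ln (l i))) in H3; rewrite -(normrN (ln (r (last i v)))) in H1.
apply: le_trans (ler_normD _ _) _.
apply: le_trans (lerD (lexx _) (ler_normD _ _)) _.
have := ler_normB (ln Z) (ln lam); lra.
Qed.

Lemma parry_measure : exists2 P : probability T R, invariant_probability X P &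
  ((ln lam)%:E <= entropy P sh)%E.
Proof.
have [P PM] := word_measure_exists parry_mass_ge0 erefl parry_mass_rcons.
have Pi : shift_invariant P.
  apply: shift_invariant_word_mass => w; rewrite PM parry_mass_cons.
  by apply: eq_bigr => a _; rewrite PM.
exists P; last first.
  apply: (@entropy_ge_uniform _ _ _ lam Kp) => w; rewrite PM => w0.
  apply: parry_mass_ln; apply: contrapT => nbw.
  by move: w0; rewrite parry_mass_eq0 ?ltxx.
split => //.
have mX : measurable (X : set T) by exact: sft_measurable.
suff m0 : P (~` X) = 0%E.
  by rewrite -[X]setCK probability_setC ?m0 ?sube0//; exact: measurableC.
(* Leaving X means making a forbidden transition at some time; each such event is a finite union of
   cylinders over words that are not blocks. *)
have XcE : ~` X = \bigcup_n [set x : T | ~~ A (x n) (x n.+1)].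
  apply/seteqP; split=> [x nX|x [n _ /= nA] /(_ n)]; last by apply/negP.
  apply: contrapT => H; apply: nX => n; apply: contrapT => /negP nA; apply: H.
  by exists n.
apply: measure_negligible; first exact: measurableC.
rewrite XcE; apply: negligible_bigcup => n.
pose D := [pred w : n.+2.-tuple 'I_k.+1 | ~~ A (nth ord0 w n) (nth ord0 w n.+1)].
have DE : [set x : T | ~~ A (x n) (x n.+1)] = @block_map k n.+2 @^-1` [set` D].
  by apply/seteqP; split=> x /=; rewrite inE /= !block_mapE !nth_mkseq.
have mD : measurable [set x : T | ~~ A (x n) (x n.+1)].
  by rewrite DE; apply: fmeasurable_pred; exact: fmeasurable_block.
apply/negligibleP => //; rewrite -[LHS]fineK ?fin_num_measure//.
congr EFin; rewrite DE law_pred; last exact: fmeasurable_block.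
rewrite big1 // => w /negP nA; rewrite law_block PM parry_mass_eq0 //.
move=> /sft_blockP[x Xx xw]; apply: nA; rewrite -xw size_tuple !nth_mkseq //.
Qed.

End parry_measure.

(** * Measures of maximal entropy *)

Section max_entropy.
Variables (k : nat) (R : realType) (A : 'M[bool]_k.+1).
Local Notation T := (fullshift k.+1).
Local Notation sh := (@shiftmap k.+1).
Local Notation X := (sft A).
Local Notation E := (edge A).
Local Notation occ := (occurs A).
Hypothesis X_irr : irreducible X.
Variable mu : probability T R.
Hypothesis mu_max : max_entropy_measure X mu.

Let mu_inv : shift_invariant mu. Proof. by case: mu_max => -[]. Qed.

Let mu_X : mu X = 1%E. Proof. by case: mu_max => -[]. Qed.

Lemma max_entropy_nonempty : X !=set0.
Proof.
apply: contrapT => X0; suff : mu X = 0%E by rewrite mu_X => /eqP; rewrite onee_eq0.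
by rewrite (_ : X = set0) ?measure0//; rewrite -subset0 => x Xx; apply: X0; exists x.
Qed.

(* The Parry measure shows that mu has entropy at least ln lam, so that tilting the
   Parry weights after a word u cannot decrease the cross entropy: this forces the
   transitions of mu after u to be those of the Parry measure. *)
Lemma max_entropy_word_mass : exists (lam : R) (c r : 'I_k.+1 -> R),
  [/\ 0 < lam, forall i, occ i -> 0 < c i, forall i, occ i -> 0 < r i,
    forall i, occ i -> \sum_(j | E i j) r j = lam * r i &
    forall i v, word_mass mu (i :: v) =
      if occ i && path E i v then c i * r (last i v) / lam ^+ (size v).+1 else 0].
Proof.
have X_ne := max_entropy_nonempty.
have [lam [r [l [lam0 [r0 l0] rE lE]]]] := edge_eigenvectors R X_irr X_ne.
have [P Pinv Pent] := parry_measure X_ne lam0 r0 l0 rE lE.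
have ent : ((ln lam)%:E <= entropy mu sh)%E.
  rewrite (_ : entropy mu sh = ereal_sup [set entropy nu sh | nu in invariant_probability X]).
    by apply: le_trans Pent _; apply: ereal_sup_ubound; exists P.
  by case: mu_max.
pose M := parry_mass A lam r l.
have M0 w : 0 <= M w by exact: parry_mass_ge0.
have Mr w : M w = \sum_a M (rcons w a) by exact: parry_mass_rcons.
have muM w : 0 < word_mass mu w -> 0 < M w.
  by move=> /(word_mass_block mu_X) bw; exact: parry_mass_gt0.
have trans i v a : word_mass mu (rcons (i :: v) a) =
    word_mass mu (i :: v) * (M (rcons (i :: v) a) / M (i :: v)).
  have [u0|] := ltP 0 (word_mass mu (i :: v)); last first.
    move=> u0; have -> : word_mass mu (i :: v) = 0.
      by apply/eqP; rewrite eq_le u0 word_mass_ge0.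
    rewrite mul0r; apply/eqP; rewrite eq_le word_mass_ge0 andbT.
    by apply: le_trans u0; exact: word_mass_rcons_le.
  have ren w b : M (w ++ rcons (i :: v) b) * M (i :: v) =
      M (w ++ i :: v) * M (rcons (i :: v) b) by exact: parry_mass_renewal.
  apply: (window_gain_eq0 M0 Mr muM u0).
  have [K HK] : exists K, forall w, 0 < word_mass mu w -> - ln (M w) <= (size w)%:R * ln lam + K.
    eexists => w /(word_mass_block mu_X) bw.
    have := @parry_mass_ln _ _ _ X_ne lam r l lam0 r0 l0 w bw.
    by rewrite ler_norml => /andP[_]; rewrite lerBlDl; exact.
  have := le_trans ent (entropy_le_window mu_inv M0 erefl Mr muM u0 ren HK).
  by rewrite lee_fin; lra.
(* Forced by the words of length one; longer words follow by the Parry transitions. *)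
pose c i := word_mass mu [:: i] * lam / r i.
have form i v : word_mass mu (i :: v) =
    if occ i && path E i v then c i * r (last i v) / lam ^+ (size v).+1 else 0.
  have [/andP[oi iv]|nb] := boolP (occ i && path E i v); last first.
    apply/eqP; apply: contraNT nb => w0; apply/sft_block_path => //.
    apply: (word_mass_block mu_X); by rewrite lt_neqAle eq_sym w0 word_mass_ge0.
  elim/last_ind: v iv => [_|v a IHv].
    by rewrite /c /= expr1 divfK ?mulfK ?gt_eqF ?r0.
  rewrite rcons_path => /andP[iv va]; rewrite -rcons_cons trans IHv //.
  have ov := path_edge_occurs oi iv.
  have Mv0 : 0 < M (i :: v) by apply: parry_mass_gt0 => //; apply/sft_block_path; rewrite oi.
  have -> : M (rcons (i :: v) a) / M (i :: v) = r a / (r (last i v) * lam).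
    rewrite /M parry_mass_transition // va -/M mulrAC divff ?mul1r//.
    by rewrite gt_eqF.
  rewrite last_rcons size_rcons [in RHS]exprSr /=.
  have := lt0r_neq0 (r0 _ ov); have := lt0r_neq0 lam0 => l0' r0'; field.
  by rewrite l0' r0' expf_neq0.
(* Some symbol j has positive mass, and a path from j to i then has positive mass by [form]. *)
have occ_gt0 i : occ i -> 0 < word_mass mu [:: i].
  move=> oi; have [j mj] : exists j, 0 < word_mass mu [:: j].
    apply: contrapT => H; have : word_mass mu [::] = 0;
      last by rewrite word_mass_nil => /eqP; rewrite oner_eq0.
    rewrite word_mass_rcons big1 // => j _; apply/eqP; rewrite eq_le word_mass_ge0 andbT leNgt.
    by apply/negP => mj; apply: H; exists j.
  have oj : occ j by have /sft_block_path := word_mass_block mu_X mj; rewrite andbT; apply.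
  have [v jv] := edge_path_ex X_irr oj oi.
  apply: (lt_le_trans _ (word_mass_cat_le (j :: v) [:: i] mu_inv)).
  rewrite /= cats1 form oj jv /= last_rcons.
  by rewrite divr_gt0 ?mulr_gt0 ?exprn_gt0 ?invr_gt0 ?r0.
exists lam, c, r; split => // i oi; by rewrite divr_gt0 ?mulr_gt0 ?occ_gt0 ?r0.
Qed.

End max_entropy.

(** * Images under one-block maps *)

Section image_measure.
Variables (k l : nat) (R : realType) (p : 'I_k.+1 -> 'I_l.+1).
Variable mu : probability (fullshift k.+1) R.
Local Notation m := (distribution mu (letterwise p : fullshift k.+1 -> fullshift l.+1)).

Lemma initial_block_letterwise x n :
  initial_block (letterwise p x) n = map p (initial_block x n).
Proof. by rewrite /initial_block /mkseq -map_comp. Qed.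

Lemma image_shift_invariant : shift_invariant mu -> shift_invariant m.
Proof.
move=> mi B mB; rewrite /distribution /pushforward.
rewrite -[RHS]mi //; rewrite -[X in measurable X]setTI.
exact: (@letterwise_measurable k l p measurableT).
Qed.

Lemma image_word_mass_sum w : word_mass m w =
  \sum_(v : (size w).-tuple 'I_k.+1) if map p v == w then word_mass mu v else 0.
Proof.
rewrite -big_mkcond /=; under eq_bigr do rewrite -law_block.
rewrite -(law_pred mu (fun v : (size w).-tuple 'I_k.+1 => map p v == w)); last first.
  exact: fmeasurable_block.
rewrite /word_mass /distribution /pushforward; congr (fine (mu _)).
have pE x : map p (@block_map k (size w) x) = initial_block (letterwise p x) (size w).
  by rewrite block_mapE initial_block_letterwise.
apply/seteqP; split=> x; first by move=> xw; apply/eqP; rewrite pE.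
by move=> /eqP; rewrite pE.
Qed.

Lemma image_probability (X : set (fullshift k.+1)) (Y : set (fullshift l.+1)) :
  measurable X -> measurable Y -> letterwise p @` X `<=` Y -> mu X = 1%E -> m Y = 1%E.
Proof.
move=> mX mY XY muX; apply/eqP; rewrite eq_le probability_le1//= -muX.
apply: le_measure; rewrite ?inE//.
  rewrite -[X in measurable X]setTI.
  exact: (@letterwise_measurable k l p measurableT).
by move=> x Xx; apply: XY; exists x.
Qed.

End image_measure.

(** * Weights of the paths above a word *)

Section transfer.
Variables (k l : nat) (R : realType) (p : 'I_k.+1 -> 'I_l.+1).
Variables (E : rel 'I_k.+1) (r : 'I_k.+1 -> R).

(* Total weight of the E-paths that start at i and lie above w; a path has the
   weight r of its endpoint. *)
Fixpoint transfer (i : 'I_k.+1) (w : seq 'I_l.+1) : R :=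
  if w is b :: w' then \sum_(j | E i j && (p j == b)) transfer j w' else r i.

Lemma transfer_sum i w : \sum_(v : (size w).-tuple 'I_k.+1)
  (if map p v == w then (if path E i v then r (last i v) else 0) else 0) = transfer i w.
Proof.
elim: w i => [|b w IHw] i /=.
  by rewrite (big_tuple0 (fun v => 
    if map p v == [::] then if path E i v then r (last i v) else 0 else 0)).
rewrite (big_tuple_cons _ (fun v => 
  if map p v == b :: w then if path E i v then r (last i v) else 0 else 0)).
rewrite [RHS]big_mkcond /=; apply: eq_bigr => j _.
rewrite -IHw; case: (E i j) => /=; last first.
  by rewrite big1 // => v _; case: ifP.
case: (p j =P b) => [<-|pj]; last first.
  by rewrite big1 // => v _; rewrite eqseq_cons; case: eqP pj.
by apply: eq_bigr => v _; rewrite eqseq_cons eqxx.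
Qed.

Variables (b0 : 'I_l.+1) (a : 'I_k.+1).
Hypothesis fibre_b0 : forall i, (p i == b0) = (i == a).

Lemma transfer_fibre_cons i t : transfer i (b0 :: t) = if E i a then transfer a t else 0.
Proof.
rewrite /=; case: ifPn => Eia.
  rewrite (bigD1 a) /=; last by rewrite Eia fibre_b0 eqxx.
  by rewrite big1 ?addr0// => j; rewrite fibre_b0 => /andP[/andP[_ ->]].
by rewrite big1 // => j; rewrite fibre_b0 => /andP[+ /eqP ja]; rewrite ja (negPf Eia).
Qed.

(** Every path above s b0 t passes through [a] at the letter b0 and splits there. The factor [r a]
    appears because the first piece, ending at [a], carries that endpoint weight. *)
Lemma transfer_renewal i s t :
  transfer i (s ++ b0 :: t) * r a = transfer i (rcons s b0) * transfer a t.
Proof.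
elim: s i => [|b s IHs] i.
  by rewrite /rcons !transfer_fibre_cons; case: ifP => _; rewrite ?mul0r//= mulrC.
by rewrite /= !mulr_suml; apply: eq_bigr => j _; exact: IHs.
Qed.

End transfer.

Section image_max_entropy.
Variables (k l : nat) (R : realType) (p : 'I_k.+1 -> 'I_l.+1).
Variable mu : probability (fullshift k.+1) R.
Local Notation m := (distribution mu (letterwise p : fullshift k.+1 -> fullshift l.+1)).
Variables (E : rel 'I_k.+1) (occ : pred 'I_k.+1) (lam : R) (c r : 'I_k.+1 -> R).
Hypothesis muE : forall i v, word_mass mu (i :: v) =
  if occ i && path E i v then c i * r (last i v) / lam ^+ (size v).+1 else 0.

Lemma image_word_mass b w : word_mass m (b :: w) =
  (\sum_(i | occ i && (p i == b)) c i * transfer p E r i w) / lam ^+ (size w).+1.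
Proof.
rewrite image_word_mass_sum.
rewrite (big_tuple_cons _ (fun v => if map p v == b :: w then word_mass mu v else 0)).
rewrite [in RHS]big_mkcond [RHS]mulr_suml; apply: eq_bigr => i _.
case: (p i =P b) => [pib|pib]; last first.
  rewrite andbF mul0r big1 // => v _; rewrite /= eqseq_cons.
  by case: eqP pib.
case: (boolP (occ i)) => oi; last first.
  by rewrite mul0r big1 // => v _; rewrite muE (negPf oi); case: ifP.
rewrite /= -transfer_sum mulr_sumr mulr_suml; apply: eq_bigr => v _.
rewrite /= eqseq_cons pib eqxx /= muE oi /= size_tuple.
by case: ifP => _; [case: ifP => _|]; rewrite ?mulr0 ?mul0r.
Qed.

Variables (b0 : 'I_l.+1) (a : 'I_k.+1).
Hypothesis fibre_b0 : forall i, (p i == b0) = (i == a).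

Lemma image_word_mass_renewal s t :
  word_mass m (s ++ b0 :: t) * word_mass m [:: b0] =
  word_mass m (rcons s b0) * word_mass m (b0 :: t).
Proof.
have b0E t' : word_mass m (b0 :: t') =
    (if occ a then c a * transfer p E r a t' else 0) / lam ^+ (size t').+1.
  rewrite image_word_mass; congr (_ / _); case: ifP => oa.
    rewrite (bigD1 a) /=; last by rewrite oa fibre_b0 eqxx.
    by rewrite big1 ?addr0// => i; rewrite fibre_b0 => /andP[/andP[_ ->]].
  by rewrite big1 // => i; rewrite fibre_b0 => /andP[+ /eqP ia]; rewrite ia oa.
case: s => [|b s]; first by rewrite /= mulrC.
rewrite cat_cons rcons_cons !b0E 2!image_word_mass; case: (occ a); last by rewrite !mul0r !mulr0.
rewrite mulrACA [RHS]mulrACA -!invfM -!exprD size_cat size_rcons; congr (_ / lam ^+ _).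
  rewrite !mulr_suml; apply: eq_bigr => i _.
  transitivity ((c i * c a) * (transfer p E r i (s ++ b0 :: t) * transfer p E r a [::])).
    by ring.
  by rewrite (transfer_renewal E r fibre_b0); ring.
by rewrite /=; lia.
Qed.

End image_max_entropy.

(** * Uniqueness by relative entropy *)

Section renewal_uniqueness.
Variable R : realType.
Local Notation T := (fullshift 2).
Local Notation one := (ord0 : 'I_2).
Local Notation two := (ord_max : 'I_2).
Variables m nu : probability T R.
Hypotheses (m_inv : shift_invariant m) (nu_inv : shift_invariant nu).
Hypothesis m_renewal : forall s t,
  word_mass m (s ++ one :: t) * word_mass m [:: one] =
  word_mass m (rcons s one) * word_mass m (one :: t).
Hypothesis m_one : 0 < word_mass m [:: one].

Lemma ord2P (b : 'I_2) : b = one \/ b = two.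
Proof. by case: b => [[|[|//]] H]; [left|right]; apply: val_inj. Qed.

Lemma big_ord2 (f : 'I_2 -> R) : \sum_a f a = f one + f two.
Proof.
rewrite big_ord_recl big_ord1; congr (_ + f _).
exact: val_inj.
Qed.

Lemma word2P (w : seq 'I_2) :
  (exists s t, w = s ++ one :: t) \/ w = nseq (size w) two.
Proof.
elim: w => [|b w [[s [t ->]]|wE]]; first by right.
  by left; exists (b :: s), t.
case: (ord2P b) => ->; first by left; exists [::], w.
by right; rewrite /= -wE.
Qed.

Variable D : nat -> R.
Hypothesis D_small : forall e, 0 < e -> exists N, forall n, (N <= n)%N -> D n <= e * n%:R.
Hypothesis nu_le : forall w, word_mass nu w <= expR (D (size w)) * word_mass m w.

Let nu_dom w : 0 < word_mass nu w -> 0 < word_mass m w.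
Proof.
move=> w0; have := lt_le_trans w0 (nu_le w).
by rewrite pmulr_rgt0// expR_gt0.
Qed.

(* The specific relative entropy of nu with respect to m vanishes, whereas tilting m
   after u gains window_gain at each occurrence of u. *)
Let nu_transition u1 u2 a : let u := u1 ++ one :: u2 in
  word_mass nu (rcons u a) * word_mass m u = word_mass nu u * word_mass m (rcons u a).
Proof.
move=> u.
have [u0|] := ltP 0 (word_mass nu u); last first.
  move=> u0; have -> : word_mass nu u = 0.
    by apply/eqP; rewrite eq_le u0 word_mass_ge0.
  rewrite mul0r; have -> : word_mass nu (rcons u a) = 0; last by rewrite mul0r.
  apply/eqP; rewrite eq_le word_mass_ge0 andbT.
  by apply: le_trans u0; exact: word_mass_rcons_le.
have mu0 := nu_dom u0.
have ren w b : word_mass m (w ++ rcons u b) * word_mass m u =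
    word_mass m (w ++ u) * word_mass m (rcons u b).
  have H1 s t : word_mass m (s ++ one :: t) =
      word_mass m (rcons s one) * word_mass m (one :: t) / word_mass m [:: one].
    by rewrite -m_renewal mulfK// gt_eqF.
  rewrite /u !rcons_cat !catA rcons_cons !(H1 (w ++ u1)) !(H1 u1).
  ring.
suff H : window_gain nu (word_mass m) u <= 0.
  rewrite (window_gain_eq0 (word_mass_ge0 m) (word_mass_rcons m) nu_dom u0 H a).
  by rewrite mulrA divfK// gt_eqF.
set g := window_gain _ _ _; rewrite leNgt; apply/negP => g0.
have bound n : (n - size u)%:R * g <= D n.
  rewrite -(ln_tilted_mass nu_inv (word_mass_nil m) nu_dom u0 ren).
  set Q := tilted_mass nu (word_mass m) u.
  have Q0 w : 0 <= Q w by exact: tilted_mass_ge0 (word_mass_ge0 m) _ _.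
  have Qd w : 0 < word_mass nu w -> 0 < Q w.
    exact: (tilted_mass_gt0 nu_inv nu_dom u0).
  have Q1 : \sum_(w : n.-tuple 'I_2) Q w <= \sum_(w : n.-tuple 'I_2) word_mass nu w.
    by rewrite word_mass_sum; exact: (tilted_mass_sum (word_mass_ge0 m) (word_mass_rcons m) u0).
  have := gibbs_sum (fun w : n.-tuple 'I_2 => word_mass_ge0 nu w) (fun w => Q0 w) (fun w => @Qd w) Q1.
  move=> G; apply: (@le_trans _ _ (\sum_(w : n.-tuple 'I_2)
      word_mass nu w * (ln (word_mass nu w) - ln (word_mass m w)))).
    rewrite -subr_ge0 -sumrB; apply: le_trans G _; apply: ler_sum => w _; lra.
  apply: (word_expect_le (f := fun w => ln (word_mass nu w) - ln (word_mass m w))) => w sw w0.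
  have mw := nu_dom w0.
  have : ln (word_mass nu w) <= ln (expR (D (size w)) * word_mass m w).
    by rewrite ler_ln ?posrE ?mulr_gt0 ?expR_gt0.
  rewrite lnM ?posrE ?expR_gt0// expRK sw; lra.
have [N HN] := D_small (divr_gt0 g0 (ltr0n R 2)).
(* More than twice the length of [u], so that (n - |u|) g exceeds n g / 2, the bound on [D n]. *)
pose n := (N + (size u).*2.+1)%N.
have := le_trans (bound n) (HN n (leq_addr _ _)).
rewrite natrB; last by rewrite /n; lia.
rewrite leNgt => /negP; apply.
have : ((size u).*2.+1)%:R <= n%:R :> R by rewrite ler_nat leq_addl.
rewrite -natr1 -muln2 natrM => Hn.
have : 0 < g * (n%:R / 2 - (size u)%:R) by rewrite mulr_gt0//; lra.
lra.
Qed.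

Let c := word_mass nu [:: one] / word_mass m [:: one].

Let nu_one t : word_mass nu (one :: t) = c * word_mass m (one :: t).
Proof.
elim/last_ind: t => [|t a IHt]; first by rewrite /c divfK// gt_eqF.
have := nu_transition [::] t a; rewrite /= IHt => H.
have [m0|] := ltP 0 (word_mass m (one :: t)).
  by apply: (mulIf (lt0r_neq0 m0)); rewrite H; ring.
move=> m0; have mt : word_mass m (one :: rcons t a) = 0.
  apply/eqP; rewrite eq_le word_mass_ge0 andbT; apply: le_trans m0.
  exact: (word_mass_rcons_le m (one :: t) a).
rewrite mt mulr0; apply/eqP; rewrite eq_le word_mass_ge0 andbT.
by apply: le_trans (nu_le _) _; rewrite mt mulr0.
Qed.

(** Proportionality extends to the left by stationarity: with two letters, the mass of 2w is the
    mass of w minus that of 1w, and words starting with 1 are covered by [nu_one]. *)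
Let nu_has_one s t : word_mass nu (s ++ one :: t) = c * word_mass m (s ++ one :: t).
Proof.
elim: s => [|b s IHs]; first exact: nu_one.
case: (ord2P b) => ->; first exact: nu_one.
move: IHs; rewrite (word_mass_cons _ nu_inv) (word_mass_cons (s ++ _) m_inv) !big_ord2.
rewrite nu_one /=; lra.
Qed.

Let nu_two n : word_mass nu (nseq n two) = 1 - c + c * word_mass m (nseq n two).
Proof.
elim: n => [|n]; first by rewrite !word_mass_nil; lra.
rewrite (word_mass_cons _ nu_inv) (word_mass_cons (nseq n two) m_inv) !big_ord2.
rewrite nu_one /=; lra.
Qed.

Variables (K eta : R).
Hypothesis eta_gt0 : 0 < eta.
Hypothesis m_two : forall n, word_mass m (nseq n two) <= K * expR (- (eta * n%:R)).

(** Both measures give 2^n a mass tending to 0: for [nu] the factor expR (D n) consumes at most half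
    of the decay rate [eta]. By [nu_two] the difference 1 - c is a combination of these masses. *)
Let c1 : c = 1.
Proof.
have c0 : 0 <= c by rewrite divr_ge0 ?word_mass_ge0.
have K0 : 0 <= K.
  have := m_two 0; rewrite mulr0 oppr0 expR0 mulr1 word_mass_nil; lra.
have [N HN] := D_small (divr_gt0 eta_gt0 (ltr0n R 2)).
have H n : (N <= n)%N -> `|1 - c| <= K * (1 + c) / (1 + eta / 2 * n%:R).
  move=> Nn; have x0 : 0 <= eta / 2 * n%:R by rewrite mulr_ge0// divr_ge0// ltW.
  have e1 : expR (- (eta / 2 * n%:R)) <= (1 + eta / 2 * n%:R)^-1.
    rewrite expRN lef_pV2 ?posrE ?expR_gt0 ?ltr_wpDr//.
    exact: expR_ge1Dx.
  have m1 : word_mass m (nseq n two) <= K * expR (- (eta / 2 * n%:R)).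
    apply: le_trans (m_two n) _; rewrite ler_wpM2l// ler_expR; lra.
  have n1 : word_mass nu (nseq n two) <= K * expR (- (eta / 2 * n%:R)).
    apply: le_trans (nu_le _) _; rewrite size_nseq.
    apply: (@le_trans _ _ (expR (D n) * (K * expR (- (eta * n%:R))))).
      by rewrite ler_wpM2l ?expR_ge0.
    rewrite mulrCA -expRD ler_wpM2l// ler_expR; have := HN n Nn; lra.
  have mge := word_mass_ge0 m (nseq n two); have nge := word_mass_ge0 nu (nseq n two).
  have cm := ler_wpM2l c0 m1; have cge := mulr_ge0 c0 mge.
  have -> : 1 - c = word_mass nu (nseq n two) - c * word_mass m (nseq n two).
    by rewrite nu_two; lra.
  apply: (@le_trans _ _ (K * (1 + c) * expR (- (eta / 2 * n%:R)))).
    rewrite ler_norml; apply/andP; split; nra.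
  by rewrite ler_wpM2l// mulr_ge0// addr_ge0.
apply/eqP; rewrite eq_sym -subr_eq0 -normr_le0; apply/ler_addgt0Pr => e e0; rewrite add0r.
pose n := (N + (Num.truncn (K * (1 + c) / e / (eta / 2))).+1)%N.
apply: le_trans (H n (leq_addr _ _)) _.
have nR : K * (1 + c) / e / (eta / 2) <= n%:R.
  by apply: le_trans (ltW (truncnS_gt _)) _; rewrite ler_nat leq_addl.
have x0 : 0 <= eta / 2 * n%:R by rewrite mulr_ge0// divr_ge0// ltW.
rewrite ler_pdivrMr ?ltr_wpDr//.
move: nR; rewrite ler_pdivrMr ?divr_gt0// ler_pdivrMr//; nra.
Qed.

Lemma renewal_measure_unique B : measurable B -> nu B = m B.
Proof.
apply: eq_measure_block => w; rewrite !word_massEfin; congr EFin.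
case: (word2P w) => [[s [t ->]]|->]; first by rewrite nu_has_one c1 mul1r.
by rewrite nu_two c1; lra.
Qed.

End renewal_uniqueness.

(** * Ratios of solutions of binary recurrences *)

Section recurrence_ratio.
Variable R : realType.
Implicit Types (z t x y : nat -> R).

Lemma cvg_harmonic_bound t (a C : R) :
  (forall n, `|a - t n.+1| <= C / n.+1%:R) -> t @ \oo --> a.
Proof.
move=> H; rewrite -(cvg_shiftS t); apply/cvgrPdist_le => e e0.
exists (Num.truncn (C / e)) => // n /= en; apply: le_trans (H n) _.
rewrite ler_pdivrMr// mulrC -ler_pdivrMr//.
by apply: le_trans (ltW (truncnS_gt _)) _; rewrite ler_nat ltnS.
Qed.

Lemma ratio_cvg_arithmetic z : (forall n, 0 < z n) ->
  (forall n, z n.+2 = 2 * z n.+1 - z n) -> (fun n => z n.+1 / z n) @ \oo --> (1 : R).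
Proof.
move=> z0 zr; pose d := z 1 - z 0.
have zd n : z n.+1 = z n + d.
  by elim: n => [|n IHn]; [rewrite /d; lra|rewrite zr IHn; lra].
have zn n : z n = z 0 + n%:R * d.
  elim: n => [|n IHn]; first by rewrite mul0r addr0.
  by rewrite zd IHn -natr1; lra.
have d0 : 0 <= d.
  rewrite leNgt; apply/negP => d0.
  have := z0 (Num.truncn (z 0 / - d)).+1; rewrite zn.
  have := truncnS_gt (z 0 / - d); rewrite ltr_pdivrMr ?oppr_gt0//; lra.
apply: (@cvg_harmonic_bound _ _ 1) => n.
have zn0 := z0 n.+1; rewrite zd mulrDl divff ?gt_eqF// opprD addrA subrr sub0r.
rewrite normrN ger0_norm; last by rewrite divr_ge0// ltW.
rewrite ler_pdivrMr// mul1r mulrC ler_pdivlMr ?ltr0n//.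
by rewrite (zn n.+1); have := z0 0%N; lra.
Qed.

(** The deviation z(n+1) - phi z(n), with phi the golden ratio, is multiplied at each step by the
    conjugate root 1 - phi, of modulus at most 2/3, while z stays bounded below. *)
Lemma ratio_cvg_fibonacci z : (forall n, 0 < z n) ->
  (forall n, z n.+2 = z n.+1 + z n) -> exists a : R, (fun n => z n.+1 / z n) @ \oo --> a.
Proof.
move=> z0 zr; pose s := Num.sqrt (5 : R); pose phi := (1 + s) / 2.
have s2 : s * s = 5 by rewrite -expr2 sqr_sqrtr.
have s_ge0 : 0 <= s by exact: sqrtr_ge0.
have s1 : 2 <= s by nra.
have phi2 : phi * phi = phi + 1 by rewrite /phi; nra.
have phi_gt : 3 / 2 <= phi by rewrite /phi; lra.
exists phi; pose e n := z n.+1 - phi * z n.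
have eE n : e n = (1 - phi) ^+ n * e 0%N.
  elim: n => [|n IHn]; first by rewrite mul1r.
  have -> : e n.+1 = (1 - phi) * e n.
    rewrite /e zr; transitivity ((1 - phi) * (z n.+1 - phi * z n) +
      (phi + 1 - phi * phi) * z n); first by ring.
    by rewrite phi2 subrr mul0r addr0.
  by rewrite IHn exprS mulrA.
have pw n : `|(1 - phi) ^+ n| <= 2 / n.+1%:R.
  rewrite normrX; have q0 : 0 <= `|1 - phi| by [].
  have q1 : `|1 - phi| * (3 / 2) <= 1.
    rewrite ltr0_norm; last lra.
    nra.
  have H : `|1 - phi| ^+ n * (1 + n%:R / 2) <= 1.
    elim: n => [|n IHn]; first by rewrite expr0 mul0r addr0 mulr1.
    rewrite exprS -natr1; have qn : 0 <= `|1 - phi| ^+ n by rewrite exprn_ge0.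
    have n0 : 0 <= n%:R :> R by [].
    have := ler_wpM2l q0 IHn.
    have : `|1 - phi| <= 2 / 3 by lra.
    nra.
  rewrite ler_pdivlMr ?ltr0n// -natr1; have : 0 <= `|1 - phi| ^+ n by rewrite exprn_ge0.
  nra.
have zm n : z 1%N <= z n.+1.
  by elim: n => // n IHn; rewrite zr; have := z0 n; lra.
apply: (@cvg_harmonic_bound _ _ (2 * `|e 0%N| / z 1%N)) => n.
have zn := z0 n.+1.
have -> : phi - z n.+2 / z n.+1 = - (e n.+1 / z n.+1).
  by rewrite /e mulrBl mulfK ?gt_eqF// opprB.
rewrite normrN normrM normfV (gtr0_norm zn) eE normrM.
have e0 : 0 <= `|e 0%N| by [].
have -> : 2 * `|e 0%N| / z 1%N / n.+1%:R = 2 / n.+1%:R * `|e 0%N| / z 1%N by ring.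
apply: ler_pM; rewrite ?mulr_ge0 ?invr_ge0 ?(ltW zn)//; last by rewrite lef_pV2 ?posrE// zm.
rewrite ler_wpM2r//; apply: le_trans (pw _) _.
by rewrite ler_pM2l// lef_pV2 ?posrE ?ltr0n// ler_nat.
Qed.

Lemma ratio_cvg_geometric z (c : R) : (forall n, 0 < z n) ->
  (forall n, z n.+2 = c * z n.+1) -> (fun n => z n.+1 / z n) @ \oo --> c.
Proof.
move=> z0 zr; apply: (@cvg_harmonic_bound _ _ 0) => n.
by rewrite zr mulfK ?gt_eqF// subrr normr0 mul0r.
Qed.

(* The matrix ((p, q), (r, s)) has trace tau and determinant delta with (tau, delta)
   one of (0, -1), (1, -1), (2, 1) or (tau, 0); ratios of solutions of
   z_(n+2) = tau z_(n+1) - delta z_n converge, except possibly in the period-two case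
   (0, -1), where the telescoping relation on L forces z to be constant. *)
Lemma binary_matrix_ratio_cvg (p q r s u v : bool) x y (C1 C2 D lam : R)
    (L := fun n => (C1 * x n + C2 * y n) / lam ^+ n) :
  0 < lam -> x 0%N = 0 \/ x 0%N = 1 -> y 0%N = 0 \/ y 0%N = 1 ->
  (forall n, x n.+1 = p%:R * x n + q%:R * y n) ->
  (forall n, y n.+1 = r%:R * x n + s%:R * y n) ->
  (forall n, 0 < L n) -> (forall n, 0 < u%:R * x n + v%:R * y n) ->
  (forall n, L n - L n.+1 = D * (u%:R * x n + v%:R * y n) / lam ^+ n) ->
  exists a : R, (fun n => L n.+1 / L n) @ \oo --> a.
Proof.
move=> lam0 x0 y0 xr yr L0 al0 Lr.
pose z n := C1 * x n + C2 * y n.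
have z0 n : 0 < z n by have := L0 n; rewrite /L pmulr_lgt0// invr_gt0 exprn_gt0.
suff [a za] : exists a : R, (fun n => z n.+1 / z n) @ \oo --> a.
  exists (a / lam).
  have -> : (fun n => L n.+1 / L n) = (fun n => z n.+1 / z n / lam).
    apply/funext => n; rewrite /L -/(z n) -/(z n.+1) exprS.
    have := lt0r_neq0 (z0 n); have := lt0r_neq0 lam0 => l0 zn; field.
    by rewrite zn l0 expf_neq0.
  by apply: cvgMl.
have zr n : z n.+2 = (p%:R + s%:R) * z n.+1 - (p%:R * s%:R - q%:R * r%:R) * z n.
  by rewrite /z !(xr, yr); ring.
have geo (c : R) : (forall n, z n.+2 = c * z n.+1) ->
    exists a : R, (fun n => z n.+1 / z n) @ \oo --> a.
  by move=> H; exists c; exact: ratio_cvg_geometric.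
have ari : (forall n, z n.+2 = 2 * z n.+1 - z n) ->
    exists a : R, (fun n => z n.+1 / z n) @ \oo --> a.
  by move=> H; exists 1; exact: ratio_cvg_arithmetic.
have fib : (forall n, z n.+2 = z n.+1 + z n) ->
    exists a : R, (fun n => z n.+1 / z n) @ \oo --> a.
  by move=> H; exact: ratio_cvg_fibonacci.
have swap : p = false -> s = false -> q = true -> r = true ->
    exists a : R, (fun n => z n.+1 / z n) @ \oo --> a.
  move=> p0 s0 q1 r1; have {}xr n : x n.+1 = y n by rewrite xr p0 q1 mul0r add0r mul1r.
  have {}yr n : y n.+1 = x n by rewrite yr s0 r1 mul0r addr0 mul1r.
  have x1 := xr 0%N; have y1 := yr 0%N; have x2 := xr 1%N; have y2 := yr 1%N.
  (* One step exchanges x and y. Positivity at times 0 and 1, with values 0 or 1, leaves no room for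
     the combination to change. *)
  have al01 : u%:R * x 1%N + v%:R * y 1%N = u%:R * x 0%N + v%:R * y 0%N.
    have := al0 0%N; have := al0 1%N; rewrite x1 y1.
    by case: x0 => ->; case: y0 => ->; case: (u); case: (v); rewrite /= ?mulr0n ?mulr1n; lra.
  (* The telescoping relation at times 0 and 1 gives lam z1 - z0 = lam z0 - z1, hence (lam + 1) (z1
     - z0) = 0. *)
  have z10 : z 1%N = z 0%N.
    have := Lr 0%N; have := Lr 1%N; rewrite al01 /L -/(z 0%N) -/(z 1%N) -/(z 2%N).
    have -> : z 2%N = z 0%N by rewrite /z x2 y2 x1 y1; ring.
    rewrite expr0 expr1 expr2 !divr1 => H1 H0.
    move: H1 H0; set D' := D * _; move=> H1 H0.
    have E1 : z 1%N * lam - z 0%N = D' * lam.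
      have l0 := lt0r_neq0 lam0.
      have -> : z 1%N * lam - z 0%N = (z 1%N / lam - z 0%N / (lam * lam)) * (lam * lam).
        by field.
      by rewrite H1; field.
    have E0 : z 0%N * lam - z 1%N = D' * lam.
      by rewrite -H0 mulrBl divfK ?gt_eqF.
    have : (z 1%N - z 0%N) * (lam + 1) = 0 by lra.
    by move/eqP; rewrite mulf_eq0 subr_eq0 (gt_eqF (addr_gt0 lam0 ltr01)) orbF => /eqP.
  have zc n : z n = z 0%N.
    elim: n {-2}n (leqnn n) => [|n IHn] [|[|j]] // jn.
    by rewrite -(IHn j (ltnW jn)) /z !(xr, yr).
  exists 1; rewrite (_ : (fun n => _) = cst 1); first exact: cvg_cst.
  by apply/funext => n; rewrite !zc divff// gt_eqF.
move: swap; have := zr; case: (p); case: (q); case: (r); case: (s) => /= H swap.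
all: try by apply: swap.
all: try by apply: ari => n; rewrite H; lra.
all: try by apply: fib => n; rewrite H; lra.
all: try by apply: (geo 1) => n; rewrite H; lra.
all: try by apply: (geo 2) => n; rewrite H; lra.
all: by apply: (geo 0) => n; rewrite H; lra.
Qed.

End recurrence_ratio.

(** * The potential of an additive renewal measure *)

Section potential.
Variable R : realType.
Local Notation T := (fullshift 2).
Local Notation sh := (@shiftmap 2).
Local Notation one := (ord0 : 'I_2).
Local Notation two := (ord_max : 'I_2).
Variables (m : probability T R) (Y : set T).
Hypothesis m_inv : shift_invariant m.
Hypothesis m_renewal : forall s t,
  word_mass m (s ++ one :: t) * word_mass m [:: one] =
  word_mass m (rcons s one) * word_mass m (one :: t).
Hypothesis Y_ne : Y !=set0.
Hypothesis Y_shift : forall y, Y y -> Y (sh y).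
Hypothesis Y_gt0 : forall y n, Y y -> 0 < word_mass m (initial_block y n).

(* y_0 ... y_(N - 1) 1 2 2 2 ... *)
Definition switch (y : T) N : T :=
  fun i => if (i < N)%N then y i else if i == N then one else two.
Hypothesis Y_switch : forall y N, Y y -> (forall i, N = i.+1 -> y i = two) ->
  Y (switch y N).

Let one_twos : T := fun i => if i == 0%N then one else two.

Let Y_one_twos : Y one_twos.
Proof.
have [y Yy] := Y_ne; have := Y_switch (N := 0%N) Yy.
rewrite (_ : switch y 0 = one_twos); first by apply.
by apply/funext => -[|i].
Qed.

Let Y_one_twos_one N : Y (switch one_twos N.+2).
Proof. by apply: Y_switch => // i [<-]. Qed.

Let block_switch N : initial_block (sh (switch one_twos N.+1)) N.+1 = rcons (nseq N two) one.
Proof.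
rewrite initial_blockS; congr rcons; last by rewrite /shiftmap /switch ltnn eqxx.
apply: (@eq_from_nth _ one); rewrite ?size_mkseq ?size_nseq// => i iN.
by rewrite nth_mkseq// nth_nseq iN /shiftmap /switch ltnS iN.
Qed.

Let block_switch1 N : initial_block (switch one_twos N.+1) N.+2 = one :: rcons (nseq N two) one.
Proof. by rewrite initial_blockSl block_switch. Qed.

Lemma twos_one_gt0 N : 0 < word_mass m (rcons (nseq N two) one).
Proof.
case: N => [|N]; last by rewrite -block_switch; exact/Y_gt0/Y_shift.
exact: (Y_gt0 1 Y_one_twos).
Qed.

Lemma one_twos_one_gt0 N : 0 < word_mass m (one :: rcons (nseq N.+1 two) one).
Proof. by rewrite -block_switch1; exact: Y_gt0. Qed.

Let L N := word_mass m (rcons (nseq N two) one).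

Variable c : nat -> R.
Hypothesis m_additive : forall y n n', Y y -> (0 < n)%N -> (0 < n')%N ->
  `|ln (word_mass m (initial_block y (n + n'))) - ln (word_mass m (initial_block y n))
    - ln (word_mass m (initial_block (iter n sh y) n'))| <= c n.

Variable kap : R.
Hypothesis kap_cvg : (fun N => L N.+1 / L N) @ \oo --> kap.

Let L_gt0 N : 0 < L N. Proof. exact: twos_one_gt0. Qed.

Let L_split N : word_mass m (one :: rcons (nseq N two) one) = L N - L N.+1.
Proof. by rewrite /L (word_mass_cons (rcons (nseq N two) one) m_inv) big_ord2 addrK. Qed.

Let e1 := expR (- c 1).

Let ln_diff_ge (x y z : R) : 0 < x -> 0 < y -> 0 < z ->
  `|ln x - ln y - ln z| <= c 1 -> y * e1 <= x / z.
Proof.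
move=> x0 y0 z0; rewrite ler_norml => /andP[+ _] => H.
rewrite -(@lnK _ (y * e1)) ?posrE ?mulr_gt0 ?expR_gt0//.
rewrite -(@lnK _ (x / z)) ?posrE ?divr_gt0// ler_expR.
rewrite lnM ?posrE ?expR_gt0// expRK ln_div ?posrE//; lra.
Qed.

(** Additivity applied to the first letter 2 of 2^(N+2) 1. Together with [ratio_le] it keeps the
    limit [kap] strictly between 0 and 1, where both logarithms of the potential are continuous. *)
Let ratio_ge N : word_mass m [:: two] * e1 <= L N.+2 / L N.+1.
Proof.
have Ys := Y_shift (Y_one_twos_one N.+1).
have t0 : 0 < word_mass m [:: two].
  by have := Y_gt0 1 (Y_shift Y_one_twos).
apply: ln_diff_ge => //.
have := m_additive Ys (ltn0Sn 0) (ltn0Sn N.+1).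
rewrite (_ : iter 1 sh _ = sh (sh (switch one_twos N.+3)))//.
rewrite add1n block_switch (_ : initial_block _ 1 = [:: two])//.
rewrite (_ : initial_block (sh (sh (switch one_twos N.+3))) N.+2 = rcons (nseq N.+1 two) one)//.
by have := congr1 behead (block_switch N.+2); rewrite initial_blockSl.
Qed.

(** By [L_split] the complement of the ratio to 1 is m[1 2^(N+1) 1] / m[2^(N+1) 1], and additivity
    bounds it below. At least one 2 separates the 1s because 11 may be forbidden in Y. *)
Let ratio_le N : L N.+2 / L N.+1 <= 1 - word_mass m [:: one] * e1.
Proof.
have o0 : 0 < word_mass m [:: one] by have := Y_gt0 1 Y_one_twos.
have := m_additive (Y_one_twos_one N) (ltn0Sn 0) (ltn0Sn N.+1).
rewrite (_ : iter 1 sh _ = sh (switch one_twos N.+2))// add1n.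
rewrite block_switch1 block_switch (_ : initial_block _ 1 = [:: one])//.
have a0 : 0 < word_mass m (one :: rcons (nseq N.+1 two) one).
  exact: one_twos_one_gt0.
move=> /(ln_diff_ge a0 o0 (L_gt0 N.+1)); rewrite L_split mulrBl divff ?gt_eqF//; lra.
Qed.

Let kap_gt0 : 0 < kap.
Proof.
have t0 : 0 < word_mass m [:: two] by have := Y_gt0 1 (Y_shift Y_one_twos).
apply: (@lt_le_trans _ _ (word_mass m [:: two] * e1)).
  by rewrite mulr_gt0// expR_gt0.
move: kap_cvg; rewrite -(cvg_shiftS (fun N => L N.+1 / L N)) => cv.
rewrite -(cvg_lim _ cv)//; apply: limr_ge; first by apply/cvg_ex; exists kap.
by apply: nearW => N; exact: ratio_ge.
Qed.

Let kap_lt1 : kap < 1.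
Proof.
have o0 : 0 < word_mass m [:: one] by have := Y_gt0 1 Y_one_twos.
apply: (@le_lt_trans _ _ (1 - word_mass m [:: one] * e1)); last first.
  by rewrite ltrBlDr ltrDl mulr_gt0// expR_gt0.
move: kap_cvg; rewrite -(cvg_shiftS (fun N => L N.+1 / L N)) => cv.
rewrite -(cvg_lim _ cv)//; apply: limr_le; first by apply/cvg_ex; exists kap.
by apply: nearW => N; exact: ratio_le.
Qed.

Let kappa (y : T) : R := if pselect (exists n, y n == one) is left H
  then L (ex_minn H).+1 / L (ex_minn H) else kap.

Let kappa_first y N : y N = one -> (forall i, (i < N)%N -> y i = two) ->
  kappa y = L N.+1 / L N.
Proof.
move=> yN y2; rewrite /kappa; case: pselect => [H|nH]; last first.
  by exfalso; apply: nH; exists N; rewrite yN.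
case: ex_minnP => n /eqP yn nmin.
suff -> : n = N by [].
apply/eqP; rewrite eqn_leq nmin ?yN//= leqNgt; apply/negP => /y2.
by rewrite yn.
Qed.

Let kappa_none y : (forall i, y i = two) -> kappa y = kap.
Proof.
move=> y2; rewrite /kappa; case: pselect => // H; exfalso.
by case: H => n; rewrite y2.
Qed.

Let first_one (y : T) : (exists2 N, y N = one & forall i, (i < N)%N -> y i = two) \/
  (forall i, y i = two).
Proof.
have [H|nH] := pselect (exists n, y n == one); last first.
  by right => i; case: (ord2P (y i)) => // yi; exfalso; apply: nH; exists i; rewrite yi.
left; case: (ex_minnP H) => N /eqP yN Nmin; exists N => // i iN.
case: (ord2P (y i)) => // /eqP /Nmin; by rewrite leqNgt iN.
Qed.

(** The potential g of the overview: [kappa (sh y)] is the conditional mass of a 2 in front of 2^N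
    1, where N counts the 2s up to the next 1, and its limit [kap] if no 1 follows. *)
Definition log_ratio (y : T) : R :=
  if y 0%N == one then ln (1 - kappa (sh y)) else ln (kappa (sh y)).

(** If a 1 occurs after the first letter, the value depends only on the letters up to it. Otherwise
    points near [y] have their next 1 far away, and convergence of the ratios to [kap] applies. *)
Let log_ratio_block y (e : R) : 0 < e -> exists n, forall z,
  initial_block z n = initial_block y n -> `|log_ratio y - log_ratio z| <= e.
Proof.
move=> e0.
have [[N yN y2]|y2] := first_one (sh y).
  exists N.+2 => z /initial_blockP zy.
  suff -> : log_ratio z = log_ratio y by rewrite subrr normr0 ltW.
  rewrite /log_ratio zy // (kappa_first yN y2) (@kappa_first (sh z) N) //.
    by rewrite /shiftmap zy; [exact: yN|lia].
  by move=> i iN; rewrite /shiftmap zy; [exact: y2|lia].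
have c0 : (fun N => ln (L N.+1 / L N)) @ \oo --> ln kap.
  by apply: continuous_cvg => //; exact: continuous_ln.
have c1 : (fun N => ln (1 - L N.+1 / L N)) @ \oo --> ln (1 - kap).
  apply: continuous_cvg; first by apply: continuous_ln; rewrite subr_gt0.
  by apply: cvgB => //; exact: cvg_cst.
have [n0 _ H0] := (cvgrPdist_le _ _).1 c0 _ e0.
have [n1 _ H1] := (cvgrPdist_le _ _).1 c1 _ e0.
exists (maxn n0 n1).+1 => z /initial_blockP zy.
rewrite /log_ratio zy // (kappa_none y2).
have [[N zN z2]|z2] := first_one (sh z); last first.
  by rewrite (kappa_none z2); case: ifP => _; rewrite subrr normr0 ltW.
rewrite (kappa_first zN z2).
have NN : (maxn n0 n1 <= N)%N.
  rewrite leqNgt; apply/negP => NN.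
  by have := zN; rewrite /shiftmap zy// -/(sh y N) y2.
case: ifP => _; [apply: H1|apply: H0]; apply: leq_trans NN; rewrite ?leq_maxl ?leq_maxr//.
Qed.

Let block_first (y : T) N n : y N = one -> (forall i, (i < N)%N -> y i = two) -> (N < n)%N ->
  exists t, initial_block y n = nseq N two ++ one :: t.
Proof.
move=> yN y2 Nn; exists (drop N.+1 (initial_block y n)).
rewrite -{1}[initial_block y n](cat_take_drop N.+1) -cat_rcons; congr (_ ++ _).
rewrite take_initial_block// initial_blockS yN; congr rcons.
apply: (@eq_from_nth _ one); rewrite ?size_mkseq ?size_nseq// => i iN.
by rewrite nth_mkseq// nth_nseq iN y2.
Qed.

(** Renewal at the first 1 after y_0 cancels the rest of the word in the quotient of the two
    masses. *)
Let log_ratioE y n : Y y -> y n.+1 = one ->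
  ln (word_mass m (initial_block y n.+2)) =
  log_ratio y + ln (word_mass m (initial_block (sh y) n.+1)).
Proof.
move=> Yy yn.
have [[N yN y2]|/(_ n)] := first_one (sh y); last by rewrite /shiftmap yn.
have Nn : (N < n.+1)%N.
  rewrite ltnNge; apply/negP => nN.
  by have := y2 n nN; rewrite /shiftmap yn.
have [t tE] := block_first yN y2 Nn.
have o0 : 0 < word_mass m [:: one] by have := Y_gt0 1 Y_one_twos.
have p1 := Y_gt0 n.+2 Yy; have p2 := Y_gt0 n.+1 (Y_shift Yy).
move: p1 p2; rewrite initial_blockSl tE => p1 p2.
have E1 := m_renewal (nseq N two) t; have E2 := m_renewal (y 0%N :: nseq N two) t.
rewrite -/(L N) in E1.
have ot0 : 0 < word_mass m (one :: t).
  by have := mulr_gt0 p2 o0; rewrite E1 pmulr_rgt0.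
have q0 : 0 < word_mass m (rcons (y 0%N :: nseq N two) one).
  by have := mulr_gt0 p1 o0; rewrite E2 pmulr_lgt0.
have -> : word_mass m (y 0%N :: nseq N two ++ one :: t) =
    word_mass m (rcons (y 0%N :: nseq N two) one) / L N * word_mass m (nseq N two ++ one :: t).
  apply: (mulIf (lt0r_neq0 o0)); rewrite E2 -[RHS]mulrA E1 mulrA divfK //.
  exact: lt0r_neq0.
rewrite lnM ?posrE ?divr_gt0//; congr (_ + _).
rewrite /log_ratio (kappa_first yN y2); move: q0.
case: (ord2P (y 0%N)) => ->.
  by rewrite eqxx rcons_cons L_split mulrBl divff // lt0r_neq0.
by [].
Qed.

Lemma birkhoffS (f : T -> R) n y : birkhoff f n.+1 y = f y + birkhoff f n (sh y).
Proof.
rewrite /birkhoff big_ord_recl; congr (_ + _); apply: eq_bigr => i _.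
by rewrite lift0 iterSr.
Qed.

Let birkhoff_log_ratio y n j : Y y -> y (n + j)%N = one ->
  ln (word_mass m (initial_block y (n + j.+1))) =
  birkhoff log_ratio n y + ln (word_mass m (initial_block (iter n sh y) j.+1)).
Proof.
elim: n y => [|n IHn] y Yy yj; first by rewrite /birkhoff big_ord0 add0r.
rewrite addSn addnS log_ratioE// birkhoffS.
have syj : sh y (n + j)%N = one by rewrite /shiftmap -addSn.
by rewrite -addnS (IHn _ (Y_shift Yy) syj) addrA iterSr.
Qed.

Let log_ratio_continuous : continuous log_ratio.
Proof.
move=> y U /nbhs_ballP[e e0 eU]; have e20 : 0 < e / 2 by rewrite divr_gt0.
have [n Hn] := log_ratio_block y e20.
apply/nbhs_blockP; exists n => z /= /Hn zy; apply: eU; rewrite /ball /=.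
by apply: le_lt_trans zy _; rewrite ltr_pdivrMr// ltr_pMr// ltr1n.
Qed.

Let birkhoff_block n y (e : R) : 0 < e -> exists n', forall z,
  initial_block z n' = initial_block y n' ->
  `|birkhoff log_ratio n y - birkhoff log_ratio n z| <= e.
Proof.
elim: n y e => [|n IHn] y e e0.
  by exists 0%N => z _; rewrite /birkhoff !big_ord0 subrr normr0 ltW.
have e20 : 0 < e / 2 by rewrite divr_gt0.
have [n1 H1] := log_ratio_block y e20; have [n2 H2] := IHn (sh y) _ e20.
exists (maxn n1 n2.+1) => z /initial_blockP zy; rewrite !birkhoffS opprD addrACA.
rewrite [e]splitr; apply: le_trans (ler_normD _ _) _; apply: lerD.
  by apply: H1; apply/initial_blockP => i lin; apply: zy; rewrite leq_max lin.
apply: H2; apply/initial_blockP => i lin; apply: zy.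
by rewrite leq_max ltnS lin orbT.
Qed.

(** If a 1 occurs at a position at least n, the Birkhoff sum telescopes exactly and the error is the
    additivity defect at the cut n, bounded by [c n] however far that 1 lies. If none does, y is
    approximated by points with a distant 1, which keep the same n-block. *)
Lemma weakly_additive_potential : exists2 g : T -> R, continuous g &
  forall y n, Y y -> (0 < n)%N ->
  `|ln (word_mass m (initial_block y n)) - birkhoff g n y| <= c n.
Proof.
exists log_ratio => // y n Yy n0.
have main z j : Y z -> z (n + j)%N = one ->
    `|ln (word_mass m (initial_block z n)) - birkhoff log_ratio n z| <= c n.
  move=> Yz zj; have := m_additive Yz n0 (ltn0Sn j).
  have E (u v w : R) : u + v - w - v = - (w - u) by ring.
  by rewrite birkhoff_log_ratio// E normrN.
have [[j /main]|H] := pselect (exists j, y (n + j)%N = one); first exact.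
have y2 i : (n <= i)%N -> y i = two.
  move=> ni; case: (ord2P (y i)) => // yi; exfalso; apply: H.
  by exists (i - n)%N; rewrite subnKC.
apply/ler_addgt0Pr => e e0; have [n' Hn'] := birkhoff_block n y e0.
(* The inserted 1 lies beyond the n-block and beyond the block that controls the Birkhoff sum up to
   [e]; the letter before it is a 2, as [Y_switch] requires. *)
pose N := (maxn n n').+1; have nN : (n < N)%N by rewrite ltnS leq_maxl.
have switchE k : (k <= N)%N -> initial_block (switch y N) k = initial_block y k.
  by move=> kN; apply/initial_blockP => i ik; rewrite /switch (leq_trans ik kN).
have YN : Y (switch y N) by apply: Y_switch => // i [<-]; exact/y2/leq_maxl.
have sN : switch y N (n + (N - n))%N = one.
  by rewrite subnKC ?(ltnW nN)// /switch ltnn eqxx.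
have := main _ _ YN sN; rewrite switchE ?(ltnW nN)// => mainN.
have -> : ln (word_mass m (initial_block y n)) - birkhoff log_ratio n y =
    ln (word_mass m (initial_block y n)) - birkhoff log_ratio n (switch y N) -
    (birkhoff log_ratio n y - birkhoff log_ratio n (switch y N)) by ring.
apply: le_trans (ler_normB _ _) _; apply: lerD mainN _.
by apply: Hn'; rewrite switchE// leqW// leq_maxr.
Qed.

End potential.

(** * Exponential decay of avoidance *)

Section avoidance_decay.
Variables (k l : nat) (R : realType) (p : 'I_k.+1 -> 'I_l.+1).
Variables (E : rel 'I_k.+1) (occ : pred 'I_k.+1) (lam : R) (r : 'I_k.+1 -> R).
Hypothesis E_occ : forall i j, E i j -> occ i && occ j.
Hypothesis lam_gt0 : 0 < lam.
Hypothesis r_gt0 : forall i, occ i -> 0 < r i.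
Hypothesis rE : forall i, occ i -> \sum_(j | E i j) r j = lam * r i.
Variables (b : 'I_l.+1) (a : 'I_k.+1).
Hypothesis pa : p a != b.
Hypothesis path_a : forall i, occ i -> exists v, path E i (rcons v a).

Let S n i : R := transfer p E r i (nseq n b).

Let SS n i : S n.+1 i = \sum_(j | E i j && (p j == b)) S n j.
Proof. by []. Qed.

Let S_ge0 n i : occ i -> 0 <= S n i.
Proof.
elim: n i => [|n IHn] i oi; first exact/ltW/r_gt0.
by rewrite SS; apply: sumr_ge0 => j /andP[/E_occ/andP[_ oj] _]; exact: IHn.
Qed.

Let S_step n i : occ i -> S n.+1 i <= lam * S n i.
Proof.
elim: n i => [|n IHn] i oi.
  rewrite /S /= -rE // [leRHS](bigID (fun j => p j == b)) /= lerDl.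
  by apply: sumr_ge0 => j /andP[/E_occ/andP[_ /r_gt0/ltW]].
rewrite SS (SS n) mulr_sumr; apply: ler_sum => j /andP[/E_occ/andP[_ oj] _].
exact: IHn.
Qed.

Let S_le n i : occ i -> S n i <= lam ^+ n * r i.
Proof.
move=> oi; elim: n => [|n IHn]; first by rewrite mul1r.
apply: le_trans (S_step n oi) _; rewrite exprS -mulrA.
by rewrite ler_pM2l.
Qed.

Let S_lt_mono n d i : occ i -> (d <= n)%N -> S d i < lam ^+ d * r i ->
  S n i < lam ^+ n * r i.
Proof.
move=> oi dn Sd; rewrite -(subnK dn); elim: (n - d)%N => // e IHe.
rewrite addSn; apply: le_lt_trans (S_step _ oi) _.
by rewrite exprS -mulrA ltr_pM2l.
Qed.

Let S_lt i : occ i -> exists d, S d i < lam ^+ d * r i.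
Proof.
move=> oi; have [v] := path_a oi.
elim: v i oi => [|j v IHv] i oi /=.
  rewrite andbT => Eia; exists 1%N.
  rewrite /S /= expr1 -rE // [ltRHS](bigID (fun j => p j == b)) /= ltrDl.
  rewrite (bigD1 a) /=; last by rewrite Eia.
  have /andP[_ /r_gt0 ra] := E_occ Eia.
  rewrite ltr_pwDl//; apply: sumr_ge0 => j /andP[/andP[/E_occ/andP[_ oj] _] _].
  exact/ltW/r_gt0.
move=> /andP[Eij jv]; have /andP[_ oj] := E_occ Eij.
have [d Sd] := IHv j oj jv; exists d.+1.
apply: (@le_lt_trans _ _ (\sum_(j | E i j) S d j)).
  rewrite SS [leRHS](bigID (fun j => p j == b)) /= lerDl.
  by apply: sumr_ge0 => j' /andP[/E_occ/andP[_ oj'] _]; exact: S_ge0.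
rewrite exprSr -mulrA -rE // mulr_sumr (bigD1 j) //= [ltRHS](bigD1 j) //=.
apply: ltr_leD => //; apply: ler_sum => j' /andP[/E_occ/andP[_ oj'] _].
exact: S_le.
Qed.

(** Without the constraint the total weight after n steps would be lam^n r_i. Each i has a path that
    escapes to [a], so after some [N] common to all i a fraction is lost, and this loss repeats
    every [N] steps. *)
Lemma transfer_decay : exists2 eta : R, 0 < eta &
  exists2 K : R, 0 < K & forall n i, occ i ->
    transfer p E r i (nseq n b) <= K * expR (- (eta * n%:R)) * (lam ^+ n * r i).
Proof.
have /choice[d Hd] : forall i, exists d, occ i -> S d i < lam ^+ d * r i.
  by move=> i; case: (pselect (occ i)) => [/S_lt[d Sd]|noi]; [exists d|exists 0%N].
pose N := (\max_i d i).+1.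
have SN i : occ i -> S N i < lam ^+ N * r i.
  by move=> oi; apply: (S_lt_mono oi _ (Hd i oi)); rewrite leqW// leq_bigmax.
(* The default 1/2 keeps [th] positive even if all these weights vanish, so that its logarithm is a
   genuine rate. *)
pose th := \big[Order.max/(2^-1 : R)]_(i | occ i) (S N i / (lam ^+ N * r i)).
have lN0 : 0 < lam ^+ N by rewrite exprn_gt0.
have th1 : th < 1.
  apply: bigmax_lt => [|i oi]; first by lra.
  by rewrite ltr_pdivrMr ?mul1r ?SN// mulr_gt0 ?r_gt0.
have th0 : 0 < th.
  by apply: (@lt_le_trans _ _ 2^-1) => //; exact: bigmax_ge_id.
have Sth n i : occ i -> S (n + N) i <= th * lam ^+ N * S n i.
  elim: n i => [|n IHn] i oi.
    rewrite add0n -mulrA -ler_pdivrMr ?mulr_gt0 ?r_gt0//.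
    exact: (le_bigmax_cond _ (fun i => S N i / (lam ^+ N * r i)) oi).
  rewrite addSn SS (SS n) mulr_sumr; apply: ler_sum => j /andP[/E_occ/andP[_ oj] _].
  exact: IHn.
have Sq q s i : occ i -> S (q * N + s) i <= th ^+ q * (lam ^+ (q * N + s) * r i).
  move=> oi; elim: q => [|q IHq]; first by rewrite mul0n add0n expr0 mul1r S_le.
  rewrite mulSn -addnA addnC; apply: le_trans (Sth _ _ oi) _.
  apply: le_trans (ler_wpM2l (ltW (mulr_gt0 th0 lN0)) IHq) _.
  by rewrite le_eqVlt; apply/orP; left; apply/eqP; rewrite exprS !exprD; ring.
pose eta := - ln th / N%:R.
have N0 : 0 < N%:R :> R by rewrite ltr0n.
have eta0 : 0 < eta by rewrite divr_gt0// oppr_gt0 ln_lt0// th0.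
have etaN : eta * N%:R = - ln th by rewrite divfK ?gt_eqF.
(* This constant pays for the remainder of n modulo [N], during which no loss is counted. *)
exists eta => //; exists (expR (eta * N%:R)); first exact: expR_gt0.
move=> n i oi; rewrite -/(S n i).
have nE := divn_eq n N; rewrite [in leLHS]nE; apply: le_trans (Sq _ _ _ oi) _.
rewrite -nE ler_pM2r ?mulr_gt0 ?exprn_gt0 ?r_gt0//.
rewrite -[in leLHS](@lnK _ th) ?posrE// -expRM_natl -expRD ler_expR.
have -> : ln th = - (eta * N%:R) by rewrite etaN opprK.
have : n%:R <= (n %/ N)%:R * N%:R + N%:R :> R.
  by rewrite -natrM -natrD ler_nat {1}nE leq_add2l ltnW// ltn_mod.
by move=> /(ler_wpM2l (ltW eta0)); lra.
Qed.

End avoidance_decay.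

(** * Counting blocks in fibres *)

Section fibre_count.
Variables (k l : nat) (R : realType) (A : 'M[bool]_k.+1) (p : 'I_k.+1 -> 'I_l.+1).
Local Notation X := (sft A).
Local Notation phi := (rel_pressure_seq X p (cst (0 : R))).
Implicit Types y : fullshift l.+1.

(** For the zero potential every section has the same sum, the number of fibre blocks, so the
    supremum is over a singleton; choosing one point in each cylinder shows that a section
    exists. *)
Lemma rel_pressure_seq_count n y : phi n y =
  \sum_(v : n.-tuple 'I_k.+1 | (map p v == initial_block y n) && `[< block X v >]) 1.
Proof.
set D := fun v : n.-tuple 'I_k.+1 => (map p v == initial_block y n) && `[< block X v >].
have fibD (v : n.-tuple 'I_k.+1) : fibre_block X p n y v <-> D v.
  split=> [[bv _ /eqP pv]|/andP[/eqP pv /asboolP bv]]; last first.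
    by split => //; rewrite size_tuple.
  by rewrite /D pv /=; apply/asboolP.
have sum_section E : fibre_section X p n y E ->
    \sum_(x \in E) expR (birkhoff (cst (0 : R)) n x) = \sum_(v | D v) 1.
  move=> [E1 E2].
  have /choice[h hP] : forall v : n.-tuple 'I_k.+1, exists x, D v -> E x /\ cylinder X v x.
    move=> v; have [/fibD /E1[x [Ex _]]|nD] := boolP (D v); first by exists x.
    by exists point.
  have EE : E = h @` [set` D].
    apply/seteqP; split=> [x Ex|_ [v /= Dv <-]]; last by have [] := hP v Dv.
    have [w fw cw] := E2 x Ex; have [bw sw pw] := fw.
    have [x' [_ x'u]] := E1 w fw.
    have sw' : size w == n by apply/eqP.
    have Dw : D (Tuple sw') by apply/fibD.
    exists (Tuple sw') => //=; have hw := hP _ Dw.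
    by rewrite -(x'u _ hw) (x'u x).
  rewrite EE fsbig_image; last first.
    move=> v v' /set_mem Dv /set_mem Dv' hv.
    have [_ [_ /= h1]] := hP v Dv; have [_ [_ /= h2]] := hP v' Dv'.
    by apply: val_inj; rewrite /= -h1 -h2 hv !size_tuple.
  rewrite -(bigfs _ (index_enum_uniq _)); last by move=> z _; rewrite mem_index_enum.
  by apply: eq_bigr => v _; rewrite /birkhoff /= big1 ?expR0.
rewrite /rel_pressure_seq -/D.
rewrite (_ : [set s | _] = [set \sum_(v | D v) 1]); first exact: sup1.
apply/seteqP; split=> [_ [E sE ->]|_ ->]; first exact: sum_section.
have /choice[h hP] : forall w : seq 'I_k.+1, exists x, block X w -> cylinder X w x.
  move=> w; have [/sft_blockP[x Xx xw]|nb] := pselect (block X w); last by exists point.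
  by exists x => _; split.
pose E := [set h v | v in [set` D]].
have sE : fibre_section X p n y E.
  split=> [w fw|_ [v /= /fibD fv <-]]; last first.
    by exists v => //; apply: hP; case: fv.
  have [bw sw pw] := fw; have sw' : size w == n by apply/eqP.
  exists (h w); split; first split; [|exact: hP|].
    by exists (Tuple sw') => //=; apply/fibD.
  move=> _ [[v /= /fibD[bv _ _] <-] [_ /= vw]].
  have [_ /= vv] := hP _ bv.
  by congr h; rewrite -vw -[RHS]vv size_tuple sw.
by exists E => //; rewrite sum_section.
Qed.

Lemma rel_pressure_seq_continuous n : continuous (phi n).
Proof.
move=> y U /nbhs_singleton Uy; apply/nbhs_blockP; exists n => z /= zy.
by rewrite /preimage /= rel_pressure_seq_count zy -rel_pressure_seq_count.
Qed.

Variable mu : probability (fullshift k.+1) R.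
Local Notation m := (distribution mu (letterwise p : fullshift k.+1 -> fullshift l.+1)).
Variables (lam : R) (c r : 'I_k.+1 -> R).
Hypothesis lam_gt0 : 0 < lam.
Hypothesis c_gt0 : forall i, occurs A i -> 0 < c i.
Hypothesis r_gt0 : forall i, occurs A i -> 0 < r i.
Hypothesis muE : forall i v, word_mass mu (i :: v) =
  if occurs A i && path (edge A) i v then c i * r (last i v) / lam ^+ (size v).+1 else 0.

Lemma rel_pressure_seq_gt0 n x : X x -> 0 < phi n (letterwise p x).
Proof.
move=> Xx; rewrite rel_pressure_seq_count (bigD1 (@block_map k n x)) /=.
  by rewrite ltr_pwDl// sumr_ge0.
rewrite block_mapE -initial_block_letterwise eqxx /=; apply/asboolP.
apply/sft_blockP; exists x => //; by rewrite size_mkseq.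
Qed.

Lemma image_word_mass_phi : exists2 K : R, 0 <= K & forall n x, X x -> (0 < n)%N ->
  0 < word_mass m (initial_block (letterwise p x) n) /\
  `|ln (word_mass m (initial_block (letterwise p x) n)) -
    (ln (phi n (letterwise p x)) - n%:R * ln lam)| <= K.
Proof.
(* Crude bounds: a sum of positive terms dominates each of them, so every factor c_i r_j lies
   between 1 / K1 and K2. *)
pose K1 : R := \sum_(i | occurs A i) \sum_(j | occurs A j) (c i * r j)^-1.
pose K2 : R := \sum_(i | occurs A i) \sum_(j | occurs A j) (c i * r j).
have cr0 i j : occurs A i -> occurs A j -> 0 < c i * r j.
  by move=> oi oj; rewrite mulr_gt0 ?c_gt0 ?r_gt0.
have le_sum (f : 'I_k.+1 -> 'I_k.+1 -> R) i j : (forall i j, occurs A i -> occurs A j -> 0 < f i j) ->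
    occurs A i -> occurs A j ->
    f i j <= \sum_(i | occurs A i) \sum_(j | occurs A j) f i j.
  move=> f0 oi oj; rewrite (bigD1 i) //= (bigD1 j oj) /= -addrA lerDl.
  apply: addr_ge0; first by apply: sumr_ge0 => j' /andP[oj' _]; exact/ltW/f0.
  apply: sumr_ge0 => i' /andP[oi' _]; apply: sumr_ge0 => j' oj'; exact/ltW/f0.
exists (`|ln K1| + `|ln K2|); first by rewrite addr_ge0.
move=> n x Xx n0; set y := letterwise p x; set w := initial_block y n.
have o0 : occurs A (x 0%N) by exact: occurs_coord.
have phi0 : 0 < phi n y by exact: rel_pressure_seq_gt0.
have K10 : 0 < K1.
  apply: lt_le_trans (le_sum (fun i j => (c i * r j)^-1) _ _ _ o0 o0).
    by rewrite invr_gt0 cr0.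
  by move=> i j oi oj; rewrite invr_gt0 cr0.
have K20 : 0 < K2 by apply: lt_le_trans (cr0 _ _ o0 o0) (le_sum (fun i j => c i * r j) _ _ cr0 o0 o0).
have mE : word_mass m w = \sum_(v : n.-tuple 'I_k.+1 | (map p v == w) && `[< block X v >]) word_mass mu v.
  have cast n' (w' : seq 'I_l.+1) : size w' = n' -> word_mass m w' =
      \sum_(v : n'.-tuple 'I_k.+1) (if map p v == w' then word_mass mu v else 0).
    by move=> <-; exact: image_word_mass_sum.
  rewrite (cast n) ?size_mkseq// [RHS]big_mkcond; apply: eq_bigr => v _.
  case: eqP => //= _; case: asboolP => // nbv.
  case: n n0 @w v {phi0 cast} nbv => [//|n] _ w v nbv.
  case/tupleP: v nbv => i v nbv.
  by rewrite muE ifN//; apply/negP => /sft_block_path.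
have mu_bounds (v : n.-tuple 'I_k.+1) : block X v ->
    K1^-1 / lam ^+ n <= word_mass mu v <= K2 / lam ^+ n.
  case: n n0 @w v {phi0 mE} => [//|n] _ w v.
  case/tupleP: v => i v bv; have /andP[oi iv] := (sft_block_path A i v).1 bv.
  have ov := path_edge_occurs oi iv.
  rewrite muE oi iv /= size_tuple !ler_pM2r ?invr_gt0 ?exprn_gt0//.
  apply/andP; split; last exact: (le_sum (fun i j => c i * r j)).
  rewrite -[leRHS]invrK lef_pV2 ?posrE ?invr_gt0 ?cr0//.
  apply: (le_sum (fun i j => (c i * r j)^-1)) => // i' j' oi' oj'.
  by rewrite invr_gt0 cr0.
have ln0 : 0 < lam ^+ n by rewrite exprn_gt0.
have lo : K1^-1 / lam ^+ n * phi n y <= word_mass m w.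
  rewrite mE rel_pressure_seq_count mulr_sumr; apply: ler_sum => v /andP[_ /asboolP bv].
  by rewrite mulr1; case/andP: (mu_bounds v bv).
have hi : word_mass m w <= K2 / lam ^+ n * phi n y.
  rewrite mE rel_pressure_seq_count mulr_sumr; apply: ler_sum => v /andP[_ /asboolP bv].
  by rewrite mulr1; case/andP: (mu_bounds v bv).
have lo0 : 0 < K1^-1 / lam ^+ n * phi n y by rewrite !mulr_gt0 ?invr_gt0.
have mw0 := lt_le_trans lo0 lo; split => //.
have hi0 := lt_le_trans mw0 hi.
have : ln (K1^-1 / lam ^+ n * phi n y) <= ln (word_mass m w) by rewrite ler_ln ?posrE.
have : ln (word_mass m w) <= ln (K2 / lam ^+ n * phi n y) by rewrite ler_ln ?posrE.
rewrite !lnM ?posrE ?mulr_gt0 ?invr_gt0// !lnV ?posrE// lnXn// -[ln lam *+ n]mulr_natl.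
have := ler_norm (ln K1); have := ler_norm (ln K2).
have := normr_ge0 (ln K1); have := normr_ge0 (ln K2).
by rewrite ler_norml => *; apply/andP; split; lra.
Qed.

End fibre_count.

(** * Logarithmic forms of the bounds *)

Section logarithmic_bounds.
Variable R : realType.

Lemma le_expRM (a b c : R) : 0 < a -> 0 < b -> (a <= expR c * b) = (ln a <= c + ln b).
Proof.
by move=> a0 b0; rewrite -ler_ln ?posrE ?mulr_gt0 ?expR_gt0// lnM ?posrE ?expR_gt0// expRK.
Qed.

Lemma expRM_le (a b c : R) : 0 < a -> 0 < b -> (expR c * b <= a) = (c + ln b <= ln a).
Proof.
by move=> a0 b0; rewrite -ler_ln ?posrE ?mulr_gt0 ?expR_gt0// lnM ?posrE ?expR_gt0// expRK.
Qed.

Lemma additivity_bounds_ln k (Y : set (fullshift k)) (f : nat -> fullshift k -> R) C :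
  (forall y n, Y y -> Y (iter n (@shiftmap k) y)) ->
  (forall y n, Y y -> (0 < n)%N -> 0 < f n y) ->
  additivity_bounds Y f C <-> forall y n n', Y y -> (0 < n)%N -> (0 < n')%N ->
    `|ln (f (n + n')%N y) - ln (f n y) - ln (f n' (iter n (@shiftmap k) y))| <= C n.
Proof.
move=> Yit f0.
have H y n n' : Y y -> (0 < n)%N -> (0 < n')%N ->
   (expR (- C n) * (f n y * f n' (iter n (@shiftmap k) y)) <= f (n + n')%N y
    /\ f (n + n')%N y <= expR (C n) * (f n y * f n' (iter n (@shiftmap k) y))) <->
   `|ln (f (n + n')%N y) - ln (f n y) - ln (f n' (iter n (@shiftmap k) y))| <= C n.
  move=> Yy n0 n'0; have f1 := f0 y n Yy n0; have f2 := f0 _ n' (Yit y n Yy) n'0.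
  have f3 : 0 < f (n + n')%N y by rewrite f0// addn_gt0 n0.
  rewrite expRM_le ?le_expRM ?mulr_gt0// lnM ?posrE// ler_norml.
  split=> [[h1 h2]|/andP[h1 h2]]; [apply/andP|]; split; lra.
split=> Hb y n n' Yy n0 n'0; first exact/H/Hb.
exact/H/Hb.
Qed.

Lemma cylinder_mass k (Y : set (fullshift k.+1)) (m : probability (fullshift k.+1) R) w :
  measurable Y -> m Y = 1%E -> fine (m (cylinder Y w)) = word_mass m w.
Proof.
move=> mY mY1; rewrite /word_mass /cylinder; congr fine.
set B := [set x | _]; have mB : measurable B by exact: block_measurable.
have -> : m B = (m (B `&` Y) + m (B `\` Y))%E.
  by rewrite addeC -measureDI.
rewrite setIC (_ : m (B `\` Y) = 0%E) ?adde0//.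
have mYc : m (~` Y) = 0%E by rewrite probability_setC// mY1 subee.
apply: (@subset_measure0 _ _ _ m _ (~` Y)) => //; first exact: measurableD.
exact: measurableC.
Qed.

Lemma gibbs_bounds_ln k (Y : set (fullshift k.+1)) (m : probability (fullshift k.+1) R)
    g P (C : nat -> R) :
  measurable Y -> m Y = 1%E -> (forall n, (0 < n)%N -> 0 < C n) ->
  gibbs_bounds Y g m P C <-> forall y n, Y y -> (0 < n)%N ->
    0 < word_mass m (initial_block y n) /\
    `|ln (word_mass m (initial_block y n)) - (birkhoff g n y - n%:R * P)| <= ln (C n).
Proof.
move=> mY mY1 C0.
have H y n : Y y -> (0 < n)%N ->
  (let q := fine (m (cylinder Y (initial_block y n))) / expR (- n%:R * P + birkhoff g n y) in
    (C n)^-1 <= q /\ q <= C n) <->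
  (0 < word_mass m (initial_block y n) /\
    `|ln (word_mass m (initial_block y n)) - (birkhoff g n y - n%:R * P)| <= ln (C n)).
  move=> Yy n0; rewrite cylinder_mass//=; have Cn := C0 n n0.
  set w := word_mass _ _; set e := expR _; have e0 : 0 < e by exact: expR_gt0.
  have lne : ln e = birkhoff g n y - n%:R * P by rewrite expRK; lra.
  split=> [[h1 h2]|[w0 +]].
    have w0 : 0 < w.
      have : 0 < w / e by apply: lt_le_trans h1; rewrite invr_gt0.
      by rewrite pmulr_lgt0// invr_gt0.
    split => //; rewrite -lne -ln_div ?posrE// ler_norml -lnV ?posrE//.
    by rewrite !ler_ln ?posrE ?invr_gt0 ?divr_gt0// h1 h2.
  rewrite -lne -ln_div ?posrE// ler_norml -lnV ?posrE//.
  by rewrite !ler_ln ?posrE ?invr_gt0 ?divr_gt0// => /andP[].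
split=> Hb y n Yy n0; first by apply/H => //; exact: Hb.
by apply/(H y n) => //; exact: Hb.
Qed.

Lemma cvg_invn : (fun n => n%:R^-1 : R) @ \oo --> (0 : R).
Proof. by rewrite -(cvg_shiftS (fun n => n%:R^-1 : R)); exact: cvg_harmonic. Qed.

Lemma gibbs_weak_gibbs k (Y : set (fullshift k.+1)) (m : probability (fullshift k.+1) R) g :
  gibbs Y g m -> weak_gibbs Y g m.
Proof.
move=> [P [C [C0 H]]]; exists P, (fun=> C); split => //.
rewrite -(mul0r (ln C)); apply: cvgMl.
exact: cvg_invn.
Qed.

End logarithmic_bounds.

(** * Uniqueness of weak Gibbs measures *)

Section weak_gibbs_uniqueness.
Variable R : realType.
Local Notation T := (fullshift 2).
Local Notation one := (ord0 : 'I_2).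
Local Notation two := (ord_max : 'I_2).
Variables (m : probability T R) (B : 'M[bool]_2).
Local Notation Y := (sft B).
Hypothesis m_invY : invariant_probability Y m.
Hypothesis m_renewal : forall s t,
  word_mass m (s ++ one :: t) * word_mass m [:: one] =
  word_mass m (rcons s one) * word_mass m (one :: t).
Hypothesis m_one : 0 < word_mass m [:: one].
Variables (K eta : R).
Hypothesis eta_gt0 : 0 < eta.
Hypothesis m_two : forall n, word_mass m (nseq n two) <= K * expR (- (eta * n%:R)).

Lemma weak_gibbs_small (C : nat -> R) : (fun n => n%:R^-1 * ln (C n)) @ \oo --> (0 : R) ->
  forall e, 0 < e -> exists N, forall n, (N <= n)%N -> (0 < n)%N -> ln (C n) <= e * n%:R.
Proof.
move=> /cvgrPdist_le H e e0; have [N _ HN] := H e e0; exists N => n Nn n0.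
have := HN n Nn; rewrite /= sub0r normrN => /(le_trans (ler_norm _)).
by rewrite mulrC ler_pdivrMr// ltr0n.
Qed.

Lemma weak_gibbs_unique g (nu : probability T R) : weak_gibbs Y g m ->
  invariant_probability Y nu -> weak_gibbs Y g nu ->
  forall A, measurable A -> nu A = m A.
Proof.
move=> [P [C [C0 Cs mG]]] [nuY nu_inv] [P' [C' [C'0 C's nuG]]].
have [mY m_inv] := m_invY; have measY : measurable (Y : set T) := sft_measurable B.
move: mG nuG => /(gibbs_bounds_ln _ _ measY mY C0) mG /(gibbs_bounds_ln _ _ measY nuY C'0) nuG.
(* The Gibbs constants count twice: once in comparing word masses, once in bounding n (P - P'). The
   empty word, where the Gibbs bounds say nothing, has mass 1 for both measures. *)
pose D n := if n == 0%N then 0 else 2 * (ln (C n) + ln (C' n)).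
have word_Y (la : probability T R) w : la Y = 1%E -> 0 < word_mass la w ->
    exists2 y, Y y & initial_block y (size w) = w.
  by move=> laY /(word_mass_block laY)/sft_blockP.
(* The pressures may differ a priori; summing the comparison of masses over all n-words, where both
   totals are 1, controls the difference. *)
have PP n : (0 < n)%N -> n%:R * (P - P') <= ln (C n) + ln (C' n).
  move=> n0; suff : 1 <= expR (n%:R * (P' - P) + (ln (C n) + ln (C' n))).
    by rewrite -expR0 ler_expR; lra.
  set e := expR _; rewrite -[leLHS](word_mass_sum m n) -[leRHS]mulr1.
  rewrite -(word_mass_sum nu n) mulr_sumr.
  apply: ler_sum => w _; rewrite {}/e.
  have [w0|] := ltP 0 (word_mass m w); last first.
    by move=> w0; apply: le_trans w0 _; rewrite mulr_ge0 ?expR_ge0// word_mass_ge0.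
  have [y Yy yw] := word_Y _ _ mY w0; rewrite size_tuple in yw.
  have [m0 mb] := mG y n Yy n0; have [nu0 nub] := nuG y n Yy n0.
  move: m0 mb nu0 nub; rewrite yw => m0 mb nu0 nub; rewrite le_expRM//.
  by move: mb nub; rewrite !ler_norml => /andP[? ?] /andP[? ?]; lra.
apply: (renewal_measure_unique m_inv nu_inv m_renewal m_one _ _ eta_gt0 m_two (D := D)).
  move=> e e0; have e40 : 0 < e / 4 by rewrite divr_gt0.
  have [N HN] := weak_gibbs_small Cs e40; have [N' HN'] := weak_gibbs_small C's e40.
  exists (maxn N N').+1 => n Nn; have n0 : (0 < n)%N by apply: leq_trans Nn.
  rewrite /D -[n == 0%N]negbK -lt0n n0 /=.
  have := HN n _ n0; have := HN' n _ n0.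
  move=> /(_ (leq_trans (leq_maxr _ _) (ltnW Nn))) h1.
  by move=> /(_ (leq_trans (leq_maxl _ _) (ltnW Nn))) h2; lra.
move=> w; have [w0|] := ltP 0 (word_mass nu w); last first.
  by move=> w0; apply: le_trans w0 _; rewrite mulr_ge0 ?expR_ge0// word_mass_ge0.
have [y Yy yw] := word_Y _ _ nuY w0.
have [s0|s0] := posnP (size w).
  by move: s0 => /size0nil ->; rewrite !word_mass_nil /D eqxx expR0 mulr1.
have [m0 mb] := mG y _ Yy s0; have [nu0 nub] := nuG y _ Yy s0.
move: m0 mb nu0 nub; rewrite yw => m0 mb nu0 nub; rewrite le_expRM//.
rewrite /D -[size w == 0%N]negbK -lt0n s0 /=.
have := PP _ s0; move: mb nub; rewrite !ler_norml => /andP[? ?] /andP[? ?]; lra.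
Qed.

End weak_gibbs_uniqueness.

(** * The theorem *)

Section two_symbol_factor.
Variables (R : realType) (A : 'M[bool]_3) (B : 'M[bool]_2) (p : 'I_3 -> 'I_2).
Variable mu : probability (fullshift 3) R.
Local Notation T := (fullshift 2).
Local Notation sh := (@shiftmap 2).
Local Notation one := (ord0 : 'I_2).
Local Notation two := (ord_max : 'I_2).
Local Notation X := (sft A).
Local Notation Y := (sft B).
Local Notation m := (distribution mu (letterwise p : fullshift 3 -> T)).
Local Notation phi := (rel_pressure_seq X p (cst (0 : R))).
Local Notation a := (inord 0 : 'I_3).
Local Notation b := (inord 1 : 'I_3).
Local Notation c := (inord 2 : 'I_3).
Hypothesis X_irr : irreducible X.
Hypothesis Y_shape : Y = [set: T] \/ Y = sft golden_mean.
Hypotheses (pa : p a = inord 0) (pb : p b = inord 1) (pc : p c = inord 1).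
Hypothesis pi_factor : factor_map X Y (letterwise p).
Hypothesis mu_max : max_entropy_measure X mu.

Let inord2_0 : inord 0 = one. Proof. by apply: val_inj; rewrite /= inordK. Qed.

Let inord2_1 : inord 1 = two. Proof. by apply: val_inj; rewrite /= inordK. Qed.

Lemma ord3P (i : 'I_3) : [\/ i = a, i = b | i = c].
Proof.
case: i => [[|[|[|//]]] H]; [apply: Or31|apply: Or32|apply: Or33];
  by apply: val_inj; rewrite /= inordK.
Qed.

Let ord3_neq : [/\ (a == b) = false, (a == c) = false & (b == c) = false].
Proof. by split; apply/negbTE/eqP => /(congr1 val); rewrite /= !inordK. Qed.

Let big_ord3 (P : pred 'I_3) (f : 'I_3 -> R) : \sum_(i | P i) f i =
  (if P a then f a else 0) + (if P b then f b else 0) + (if P c then f c else 0).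
Proof.
have [ab ac bc] := ord3_neq.
rewrite big_mkcond (bigD1 a) //= (bigD1 b) 1?eq_sym ?ab//= (bigD1 c) /=; last first.
  by rewrite ![c == _]eq_sym ac bc.
rewrite big1 ?addr0 ?addrA// => i.
by case: (ord3P i) => ->; rewrite eqxx ?andbF.
Qed.

Let p_one i : (p i == one) = (i == a).
Proof.
have [ab ac bc] := ord3_neq.
case: (ord3P i) => ->; rewrite ?pa ?pb ?pc ?inord2_0 ?inord2_1 ?eqxx//.
  by rewrite [RHS]eq_sym ab.
by rewrite [RHS]eq_sym ac.
Qed.

Let p_two i : (p i == two) = (i != a).
Proof. by rewrite -p_one; case: (ord2P (p i)) => ->. Qed.

Let Y_lift y : Y y -> exists2 x, X x & letterwise p x = y.
Proof. by case: pi_factor => _ <- _ [x Xx <-]; exists x. Qed.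

Let Y_image x : X x -> Y (letterwise p x).
Proof. by case: pi_factor => _ <- _ Xx; exists x. Qed.

Let Y_ne : Y !=set0.
Proof. by have [x Xx] := max_entropy_nonempty mu_max; exists (letterwise p x); exact: Y_image. Qed.

Let Y_shift y : Y y -> Y (sh y).
Proof. exact: (sft_iter_shift 1). Qed.

Let Y_switch y N : Y y -> (forall i, N = i.+1 -> y i = two) -> Y (switch y N).
Proof.
move=> Yy yN; case: Y_shape => YE; rewrite YE // => i.
rewrite mxE /switch; case: (ltngtP i.+1 N) => iN.
- have : Y y by []; by rewrite YE => /(_ i); rewrite mxE.
- by rewrite orbT.
- by rewrite (yN i).
Qed.

Let m_Y : invariant_probability Y m.
Proof.
have [[muX mui] _] := mu_max; split; last exact: image_shift_invariant.
apply: (image_probability (sft_measurable A) (sft_measurable B) _ muX).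
by move=> _ [x Xx <-]; exact: Y_image.
Qed.

Let m_inv : shift_invariant m. Proof. by case: m_Y. Qed.

Let occ_a : occurs A a.
Proof.
have [y Yy] := Y_ne.
have /Y_lift[x Xx xy] : Y (switch y 0) by apply: Y_switch.
have : p (x 0%N) == one by rewrite -[p (x 0%N)]/(letterwise p x 0%N) xy.
by rewrite p_one => /eqP <-; exact: occurs_coord.
Qed.

(** Gathers the facts about the image measure on which both parts rest: comparison with [phi],
    renewal, decay of m[2^n] and convergence of the ratios. *)
Lemma factor_max_entropy : exists K lam eta Keta kap : R,
  [/\ forall y n, Y y -> (0 < n)%N -> 0 < word_mass m (initial_block y n) /\
        `|ln (word_mass m (initial_block y n)) - (ln (phi n y) - n%:R * ln lam)| <= K,
      forall s t, word_mass m (s ++ one :: t) * word_mass m [:: one] =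
        word_mass m (rcons s one) * word_mass m (one :: t),
      0 < eta, forall n, word_mass m (nseq n two) <= Keta * expR (- (eta * n%:R)) &
      (fun N => word_mass m (rcons (nseq N.+1 two) one) /
                word_mass m (rcons (nseq N two) one)) @ \oo --> kap].
Proof.
have [lam [cc [r [lam0 c0 r0 rE muE]]]] := max_entropy_word_mass X_irr mu_max.
have [K K0 HK] := image_word_mass_phi p lam0 c0 r0 muE.
have path_a i : occurs A i -> exists v, path (edge A) i (rcons v a).
  by move=> oi; exact: edge_path_ex.
have pan : p a != two by rewrite p_two negbK.
have [eta eta0 [Ke Ke0 HKe]] := transfer_decay (@edge_occurs _ A) lam0 r0 rE pan path_a.
have bound y n : Y y -> (0 < n)%N -> 0 < word_mass m (initial_block y n) /\
    `|ln (word_mass m (initial_block y n)) - (ln (phi n y) - n%:R * ln lam)| <= K.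
  by move=> /Y_lift[x Xx <-]; exact: HK.
have renew := image_word_mass_renewal muE p_one.
exists K, lam, eta.
pose Z := \sum_(i | occurs A i && (p i == two)) cc i * r i.
have Z0 : 0 <= Z.
  by apply: sumr_ge0 => i /andP[oi _]; rewrite mulr_ge0// ltW ?c0 ?r0.
(* The summand 1 covers n = 0; the factor [expR eta] compensates that n + 1 letters make only n
   transitions. *)
exists (1 + Ke * expR eta * Z / lam).
have Y_gt0 y n : Y y -> 0 < word_mass m (initial_block y n).
  by move=> Yy; case: n => [|n]; [rewrite word_mass_nil|have [] := bound y n.+1 Yy isT].
have decay n : word_mass m (nseq n two) <=
    (1 + Ke * expR eta * Z / lam) * expR (- (eta * n%:R)).
  case: n => [|n].
    rewrite word_mass_nil mulr0 oppr0 expR0 mulr1 lerDl.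
    by rewrite divr_ge0 ?(ltW lam0)// !mulr_ge0 ?expR_ge0 ?(ltW Ke0).
  rewrite (image_word_mass p muE) size_nseq mulrDl mul1r.
  apply: (@le_trans _ _ (Ke * expR eta * Z / lam * expR (- (eta * n.+1%:R)))); last first.
    by rewrite lerDr expR_ge0.
  rewrite -natr1 mulrDr mulr1 opprD expRD.
  have -> : Ke * expR eta * Z / lam * (expR (- (eta * n%:R)) * expR (- eta)) =
      Ke * expR (- (eta * n%:R)) * (lam ^+ n * Z) / lam ^+ n.+1.
    rewrite exprS (expRN eta); have := lt0r_neq0 lam0; have := lt0r_neq0 (expR_gt0 eta).
    by move=> e1 l1; field; rewrite l1 e1 expf_neq0.
  rewrite ler_pM2r ?invr_gt0 ?exprn_gt0// /Z !mulr_sumr; apply: ler_sum => i /andP[oi _].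
  have := ler_wpM2l (ltW (c0 _ oi)) (HKe n i oi); lra.
pose F N i := transfer p (edge A) r i (rcons (nseq N two) one).
have ra := r0 _ occ_a; have ra0 := lt0r_neq0 ra.
have FS N i : F N.+1 i = (edge A i b)%:R * F N b + (edge A i c)%:R * F N c.
  have [ab ac bc] := ord3_neq; rewrite /F /= big_ord3 !p_two eqxx andbF add0r.
  rewrite [b == a]eq_sym [c == a]eq_sym ab ac !andbT.
  by case: edge; case: edge; rewrite /= ?mul1r ?mul0r.
have F0 i : F 0%N i / r a = 0 \/ F 0%N i / r a = 1.
  rewrite /F [rcons _ _]/= (transfer_fibre_cons _ _ p_one) /=.
  by case: ifP => _; [right; rewrite divff|left; rewrite mul0r].
(* Every path above 2^N 1 ends at [a], so after division by [r a] these count the paths from [b] and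
   [c]. They start with values 0 or 1 and evolve by the zero-one matrix of edges between [b] and
   [c]. *)
pose x N := F N b / r a; pose y N := F N c / r a.
pose C1 := (occurs A b)%:R * cc b * r a / lam ^+ 2.
pose C2 := (occurs A c)%:R * cc c * r a / lam ^+ 2.
pose D := cc a * r a / lam ^+ 3.
have l0 := lt0r_neq0 lam0.
have twosE N : word_mass m (rcons (nseq N.+1 two) one) = (C1 * x N + C2 * y N) / lam ^+ N.
  have [ab ac bc] := ord3_neq.
  rewrite [rcons _ _]/= (image_word_mass p muE) size_rcons size_nseq big_ord3 !p_two.
  rewrite eqxx andbF add0r [b == a]eq_sym [c == a]eq_sym ab ac !andbT.
  rewrite -!/(F N _) /C1 /C2 /x /y !exprS.
  by case: (occurs A b); case: (occurs A c); rewrite /=; field; rewrite ra0 l0 expf_neq0.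
have oneE N : word_mass m (one :: rcons (nseq N.+1 two) one) =
    D * ((edge A a b)%:R * x N + (edge A a c)%:R * y N) / lam ^+ N.
  have [ab ac bc] := ord3_neq.
  rewrite (image_word_mass p muE) size_rcons size_nseq big_ord3 !p_one.
  rewrite eqxx andbT occ_a [b == a]eq_sym [c == a]eq_sym ab ac !andbF !addr0.
  rewrite -/(F N.+1 a) FS /D /x /y !exprS; field.
  by rewrite ra0 l0 expf_neq0.
have [kap kapE] : exists kap : R, (fun N => ((C1 * x N.+1 + C2 * y N.+1) / lam ^+ N.+1) /
    ((C1 * x N + C2 * y N) / lam ^+ N)) @ \oo --> kap.
  apply: (@binary_matrix_ratio_cvg _ (edge A b b) (edge A b c) (edge A c b) (edge A c c)
    (edge A a b) (edge A a c) x y C1 C2 D) => //; try exact: F0.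
  - by move=> N; rewrite /x /y FS; ring.
  - by move=> N; rewrite /x /y FS; ring.
  - move=> N; rewrite -twosE; exact: (twos_one_gt0 Y_ne Y_shift Y_gt0 Y_switch).
  - move=> N; have := one_twos_one_gt0 Y_ne Y_gt0 Y_switch N.
    rewrite oneE mulrAC pmulr_rgt0 // /D !mulr_gt0 ?invr_gt0 ?exprn_gt0 ?c0 ?r0 ?occ_a//.
  - move=> N; rewrite -!twosE -oneE.
    by rewrite (word_mass_cons (rcons (nseq N.+1 two) one) m_inv) big_ord2 addrK.
exists kap; split => //.
rewrite -(cvg_shiftS (fun N => word_mass m (rcons (nseq N.+1 two) one) / _)).
by under eq_fun do rewrite !twosE.
Qed.

Let Y_iter y n : Y y -> Y (iter n sh y).
Proof. exact: sft_iter_shift. Qed.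

Let phi_gt0 y n : Y y -> (0 < n)%N -> 0 < phi n y.
Proof. by move=> /Y_lift[x Xx <-] _; exact: rel_pressure_seq_gt0. Qed.

Let birkhoffD (g : T -> R) n n' y :
  birkhoff g (n + n') y = birkhoff g n y + birkhoff g n' (iter n sh y).
Proof.
elim: n y => [|n IHn] y; first by rewrite /birkhoff big_ord0 add0r.
by rewrite addSn !birkhoffS IHn addrA iterSr.
Qed.

(** Replacing [phi] by the masses costs [K] for each of the three terms, while the powers of lam
    cancel. The pressure is 0 because the potential is a logarithm of conditional masses of [m]. *)
Let additive_potential C : additivity_bounds Y phi C -> exists K : R, 0 <= K /\
  exists2 g : T -> R, continuous g & gibbs_bounds Y g m 0 (fun n => expR (C n + K)).
Proof.
move=> /(additivity_bounds_ln _ Y_iter phi_gt0) phiC.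
have [K [lam [eta [Keta [kap [bound renew eta0 decay kapE]]]]]] := factor_max_entropy.
have Y_gt0 y n : Y y -> 0 < word_mass m (initial_block y n).
  by move=> Yy; case: n => [|n]; [rewrite word_mass_nil|have [] := bound y n.+1 Yy isT].
have K0 : 0 <= K.
  by have [y Yy] := Y_ne; have [_] := bound y 1%N Yy isT; exact: le_trans.
have mC y n n' : Y y -> (0 < n)%N -> (0 < n')%N ->
  `|ln (word_mass m (initial_block y (n + n'))) - ln (word_mass m (initial_block y n))
    - ln (word_mass m (initial_block (iter n sh y) n'))| <= C n + 3 * K.
  move=> Yy n0 n'0; have := phiC y n n' Yy n0 n'0.
  have [_] := bound y n Yy n0; have [_] := bound _ n' (Y_iter n Yy) n'0.
  have [_] := bound y (n + n')%N Yy (ltn_addr _ n0).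
  rewrite !ler_norml natrD => /andP[? ?] /andP[? ?] /andP[? ?] /andP[? ?].
  by apply/andP; split; lra.
have [g gc gE] := weakly_additive_potential m_inv renew Y_ne Y_shift Y_gt0 Y_switch mC kapE.
exists (3 * K); split; first by rewrite mulr_ge0.
exists g => //; apply/gibbs_bounds_ln => [||n _|y n Yy n0].
- exact: sft_measurable.
- by case: m_Y.
- exact: expR_gt0.
- by split; [exact: Y_gt0|rewrite mulr0 subr0 expRK; exact: gE].
Qed.

Let weak_gibbs_unique_invariant (g : T -> R) : weak_gibbs Y g m ->
  forall nu, invariant_probability Y nu -> weak_gibbs Y g nu ->
  forall D, measurable D -> nu D = m D.
Proof.
move=> mg nu nuY nug.
have [K [lam [eta [Keta [kap [bound renew eta0 decay _]]]]]] := factor_max_entropy.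
have Y_one : 0 < word_mass m [:: one].
  have [y Yy] := Y_ne; have Y0 : Y (switch y 0) by exact: Y_switch.
  by have [] := bound _ 1%N Y0 isT.
exact: (weak_gibbs_unique m_Y renew Y_one eta0 decay mg).
Qed.

Let phi_positive_continuous : positive_continuous_seq Y phi.
Proof.
move=> n n0; split; last by move=> y Yy; exact: phi_gt0.
by apply: continuous_subspaceT; exact: rel_pressure_seq_continuous.
Qed.

Lemma almost_additive_gibbs : almost_additive Y phi <->
  exists g : T -> R, {within Y, continuous g} /\ unique_invariant Y (gibbs Y g) m.
Proof.
split=> [[_ [C [C0 /additive_potential[K [K0 [g gc mg]]]]]]|[g [_ [_ [P [C [C0 mg]]] _]]]].
  exists g; split; first exact: continuous_subspaceT.
  have gm : gibbs Y g m by exists 0, (expR (C + K)); split; [exact: expR_gt0|].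
  split => // nu nuY nug; apply: weak_gibbs_unique_invariant nuY _.
    exact: gibbs_weak_gibbs gm.
  exact: gibbs_weak_gibbs.
split; first exact: phi_positive_continuous.
have [K [lam [_ [_ [_ [bound _ _ _ _]]]]]] := factor_max_entropy.
have {}mg := (gibbs_bounds_ln g P (sft_measurable B) (proj1 m_Y) (fun _ _ => C0)).1 mg.
have CK y n : Y y -> (0 < n)%N ->
    `|ln (phi n y) - (birkhoff g n y + n%:R * (ln lam - P))| <= K + ln C.
  move=> Yy n0; have [_] := bound y n Yy n0; have [_] := mg y n Yy n0.
  by rewrite !ler_norml => /andP[? ?] /andP[? ?]; apply/andP; split; lra.
have CK0 : 0 <= K + ln C.
  by have [y Yy] := Y_ne; exact: le_trans (CK y 1%N Yy isT).
(* Birkhoff sums are exactly additive, so only the three comparison errors remain; the summand 1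
   makes the constant strictly positive. *)
exists (3 * (K + ln C) + 1); split; first by lra.
apply/(additivity_bounds_ln _ Y_iter phi_gt0) => y n n' Yy n0 n'0.
have := CK y n Yy n0; have := CK _ n' (Y_iter n Yy) n'0.
have := CK y (n + n')%N Yy (ltn_addr _ n0); rewrite birkhoffD natrD !ler_norml.
by move=> /andP[? ?] /andP[? ?] /andP[? ?]; apply/andP; split; lra.
Qed.

Lemma weakly_almost_additive_weak_gibbs : weakly_almost_additive Y phi ->
  exists g : T -> R, {within Y, continuous g} /\ unique_invariant Y (weak_gibbs Y g) m.
Proof.
move=> [_ [C [C0 C_small /additive_potential[K [K0 [g gc mg]]]]]].
exists g; split; first exact: continuous_subspaceT.
have gm : weak_gibbs Y g m.
  exists 0, (fun n => expR (C n + K)); split => // [n _|]; first exact: expR_gt0.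
  rewrite (_ : (fun n => _) = (fun n => C n / n%:R + n%:R^-1 * K)); last first.
    by apply/funext => n; rewrite expRK mulrDr mulrC.
  rewrite -[0 in X in _ --> X]addr0; apply: cvgD => //.
  rewrite -(mul0r K); apply: cvgMl; exact: cvg_invn.
split => // nu nuY nug; exact: (weak_gibbs_unique_invariant gm nuY nug).
Qed.

End two_symbol_factor.

Theorem corollary4p3 (R : realType)
    (X : set (fullshift 3)) (Y : set (fullshift 2)) (p : 'I_3 -> 'I_2)
    (mu : probability (fullshift 3) R)
    (X_sft : is_sft X) (X_irr : irreducible X)
    (Y_sft : is_sft Y) (Y_irr : irreducible Y)
    (Y_shape : Y = [set: fullshift 2] \/ Y = sft golden_mean)
    (p1 : p (inord 0) = inord 0) (p2 : p (inord 1) = inord 1)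
    (p3 : p (inord 2) = inord 1)
    (pi_factor : factor_map X Y (letterwise p))
    (mu_max : max_entropy_measure X mu) :
  (almost_additive Y (rel_pressure_seq X p (cst (0 : R))) <->
     exists g : fullshift 2 -> R,
       {within Y, continuous g} /\
       unique_invariant Y (gibbs Y g) (distribution mu (letterwise p)))
  /\
  (weakly_almost_additive Y (rel_pressure_seq X p (cst (0 : R))) ->
     exists g : fullshift 2 -> R,
       {within Y, continuous g} /\
       unique_invariant Y (weak_gibbs Y g) (distribution mu (letterwise p))).
Proof.
move: X_sft Y_sft => [A XA] [B YB]; subst X Y.
split; first exact: almost_additive_gibbs.
exact: weakly_almost_additive_weak_gibbs.
Qed.
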